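(* For the action of the pseudogroup $\Gamma$ of all point transformations of $\mathbb R^2$ on the jet bundles $J^k\pi$: 1. $J^k\pi$, $k=0,1$, is an orbit of the action of $\Gamma$. 2. $J^2\pi$ is the union of two orbits of the action of $\Gamma$, $\mathrm{Orb}_2^0$ and $\mathrm{Orb}_2^2$: (a) $\mathrm{Orb}_2^0$ is a generic orbit, described by the inequality $(F^1,F^2)\neq0$; (b) $\mathrm{Orb}_2^2$ is a degenerate orbit of codimension $2$, described as a submanifold of $J^2\pi$ by the equations $F^1=0$, $F^2=0$. 3. $J^3\pi$ is a union of some orbits of the action of $\Gamma$. One of these orbits, $\mathrm{Orb}_3^0$, is a generic orbit, described by the inequality $F^3\neq0$.
   Context: All manifolds and maps are smooth. Let $\pi:\mathbb R^2\times\mathbb R^4\to\mathbb R^2$ be the product bundle with base coordinates $(x^1,x^2)=(x,y)$ and fibre coordinates $u^1,\dots,u^4$; its sections $p\mapsto(p,a^0(p),a^1(p),a^2(p),a^3(p))$ are identified with equations $y''=a^3y'^3+a^2y'^2+a^1y'+a^0$. A point transformation is a diffeomorphism $f$ of an open subset of $\mathbb R^2$ onto an open subset of $\mathbb R^2$; $\Gamma$ is the pseudogroup of all of them. The lift $f^{(0)}$ sends $(p,u)$ to $(f(p),\tilde u)$, where, with $g=(g^1,g^2)=f^{-1}$, subscripts denoting partial derivatives at $f(p)$, $A=g^1_1+g^1_2t$, $B=g^2_1+g^2_2t$, $Q^i=g^i_{11}+2g^i_{12}t+g^i_{22}t^2$, $J=g^1_1g^2_2-g^1_2g^2_1$, the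 $\tilde u^i$ are determined by the identity in $t$: $\sum_{i=0}^3\tilde u^{i+1}t^i=J^{-1}\bigl(\sum_{i=0}^3u^{i+1}B^iA^{3-i}-AQ^2+BQ^1\bigr)$ (this is the transformation of the coefficients of the equation under the change of variables $f$). $J^k\pi$ is the bundle of $k$-jets of sections of $\pi$ ($J^0\pi$ is the total space of $\pi$) with coordinates $x^j,u^i_\sigma$, and $\Gamma$ acts on it by $f^{(k)}(j^k_pS)=j^k_{f(p)}(f^{(0)}\circ S\circ f^{-1})$. $D_j$ is the total derivative with respect to $x^j$. A generic orbit is an orbit of codimension $0$. $F^1=3u^1_{22}-2u^2_{12}+u^3_{11}+3u^4u^1_1-3u^3u^1_2+2u^2u^2_2-u^2u^3_1-3u^1u^3_2+6u^1u^4_1$, $F^2=u^2_{22}-2u^3_{12}+3u^4_{11}-3u^1u^4_2+3u^2u^4_1-2u^3u^3_1+u^3u^2_2+3u^4u^2_1-6u^4u^1_2$, $F^3=F^2(F^1D_1F^2-F^2D_1F^1)-F^1(F^1D_2F^2-F^2D_2F^1)+(F^1)^3u^4-(F^1)^2F^2u^3+F^1(F^2)^2u^2-(F^2)^3u^1$. *)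

(* Defs.v *)
From HB Require Import structures.
From mathcomp Require Import all_boot all_order all_algebra.
From mathcomp Require Import all_classical all_reals all_analysis.

Set Implicit Arguments.
Unset Strict Implicit.
Unset Printing Implicit Defensive.

Import Order.TTheory GRing.Theory Num.Theory.
Import numFieldNormedType.Exports.

Local Open Scope classical_set_scope.
Local Open Scope ring_scope.

(* [Ck n U f] : f is of class C^n on U.  For finite-dimensional V this is the
   usual notion, since all directional derivatives are then controlled by the
   partial ones. *)
Fixpoint Ck {R : realType} {V W : normedModType R} (n : nat) (U : set V)
    (f : V -> W) {struct n} : Prop :=
  match n with
  | 0%N => forall x, U x -> {for x, continuous f}
  | m.+1 => (forall x, U x -> differentiable f x) /\
            (forall v : V, Ck m U ('D_v f))
  end.

Definition smooth_on {R : realType} {V W : normedModType R} (U : set V)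
    (f : V -> W) : Prop := forall n, Ck n U f.

(* N is cut out inside the open set W by the c equations Phi = 0, which are
   regular: the differential of Phi is onto at every point of the zero set. *)
Definition regular_equations {R : realType} {V : normedModType R} (c : nat)
    (W : set V) (Phi : V -> 'rV[R]_c) (N : set V) : Prop :=
  [/\ open W, smooth_on W Phi,
      (forall x, W x -> Phi x = 0 -> forall w, exists v, 'd Phi x v = w)
    & N `&` W = [set x | W x /\ Phi x = 0]].

(* N is an embedded submanifold of codimension c; for c = 0 this says that N
   is open. *)
Definition submanifold_codim {R : realType} {V : normedModType R} (c : nat)
    (N : set V) : Prop :=
  forall x, N x -> exists (W : set V) (Phi : V -> 'rV[R]_c),
    W x /\ regular_equations W Phi N.

Definition partial {R : realType} (j : 'I_2) (h : 'rV[R]_2 -> R) :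
    'rV[R]_2 -> R := 'D_(delta_mx 0 j) h.

(* The multi-index s = (a, b) stands for a derivatives in x^1 and b in x^2. *)
Definition partials {R : realType} (s : nat * nat) (h : 'rV[R]_2 -> R) :
    'rV[R]_2 -> R :=
  iter s.1 (partial 0) (iter s.2 (partial 1) h).

Definition midx (k : nat) : seq (nat * nat) :=
  [seq ((n - b)%N, b) | n <- iota 0 k.+1, b <- iota 0 n.+1].

(* Coordinates x^j and u^i_s, |s| <= k; the column s of the matrix holds the
   u^i_(nth (0, 0) (midx k) s), i < 4. *)
Definition jet (R : realType) (k : nat) : normedModType R :=
  ('rV[R]_2 * 'M[R]_(4, size (midx k)))%type.

(* The coordinate u^(i+1)_s of a k-jet (and 0 if |s| > k). *)
Definition jcoord {R : realType} {k : nat} (theta : jet R k) (i : 'I_4)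
    (s : nat * nat) : R :=
  if insub (index s (midx k)) is Some m then theta.2 i m else 0.

Definition total_space (R : realType) : normedModType R :=
  ('rV[R]_2 * 'rV[R]_4)%type.

Definition local_section {R : realType} (V : set 'rV[R]_2)
    (S : 'rV[R]_2 -> total_space R) : Prop :=
  [/\ open V, smooth_on V S & forall p, V p -> (S p).1 = p].

Definition jet_of {R : realType} (k : nat) (S : 'rV[R]_2 -> total_space R)
    (p : 'rV[R]_2) : jet R k :=
  (p, \matrix_(i < 4, m < size (midx k))
        partials (nth (0, 0)%N (midx k) m) (fun q => (S q).2 0 i) p).

(* Both maps are total functions of which only the restrictions to [pt_dom]
   and to its image are relevant. *)
Record point_transformation (R : realType) := PointTransformation {
  pt_dom : set 'rV[R]_2;
  pt_fun : 'rV[R]_2 -> 'rV[R]_2;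
  pt_inv : 'rV[R]_2 -> 'rV[R]_2;
  pt_dom_open : open pt_dom;
  pt_img_open : open (pt_fun @` pt_dom);
  pt_funK : forall p, pt_dom p -> pt_inv (pt_fun p) = p;
  pt_fun_smooth : smooth_on pt_dom pt_fun;
  pt_inv_smooth : smooth_on (pt_fun @` pt_dom) pt_inv
}.

(* The vector of the new coefficients at the point q, where g is the inverse
   of the change of variables.  The identity in t is read in {poly R}, with
   t = 'X; its right-hand side has degree at most 3. *)
Definition lift_coef {R : realType} (g : 'rV[R]_2 -> 'rV[R]_2) (q : 'rV[R]_2)
    (u : 'rV[R]_4) : 'rV[R]_4 :=
  let d (i : 'I_2) s : R := partials s (fun x => g x 0 i) q in
  let A : {poly R} := (d 0 (1, 0)%N)%:P + d 0 (0, 1)%N *: 'X in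
  let B : {poly R} := (d 1 (1, 0)%N)%:P + d 1 (0, 1)%N *: 'X in
  let Q (i : 'I_2) : {poly R} :=
    (d i (2, 0)%N)%:P + (2 * d i (1, 1)%N) *: 'X + d i (0, 2)%N *: 'X^2 in
  let J : R := d 0 (1, 0)%N * d 1 (0, 1)%N - d 0 (0, 1)%N * d 1 (1, 0)%N in
  let rhs : {poly R} :=
    J^-1 *: (\sum_(i < 4) u 0 i *: (B ^+ i * A ^+ (3 - i))
             - A * Q 1 + B * Q 0) in
  \row_(i < 4) rhs`_i.

Definition lift0 {R : realType} (f : point_transformation R)
    (z : total_space R) : total_space R :=
  (pt_fun f z.1, lift_coef (pt_inv f) (pt_fun f z.1) z.2).

(* The graph of f^(k). *)
Definition prolongation {R : realType} (k : nat) (f : point_transformation R)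
    (theta theta' : jet R k) : Prop :=
  exists (V : set 'rV[R]_2) (S : 'rV[R]_2 -> total_space R) (p : 'rV[R]_2),
    [/\ local_section V S, V p, pt_dom f p, theta = jet_of k S p
      & theta' = jet_of k (lift0 f \o S \o pt_inv f) (pt_fun f p)].

Definition jet_orbit {R : realType} (k : nat) (theta : jet R k) : set (jet R k) :=
  [set theta' | exists f : point_transformation R,
                  prolongation f theta theta'].

Definition is_orbit {R : realType} (k : nat) (O : set (jet R k)) : Prop :=
  exists theta, O = jet_orbit theta.

Definition generic_orbit {R : realType} (k : nat) (O : set (jet R k)) : Prop :=
  is_orbit O /\ submanifold_codim 0 O.

Definition jproj {R : realType} (k : nat) (theta : jet R k.+1) : jet R k :=
  (theta.1, \matrix_(i < 4, m < size (midx k))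
              jcoord theta i (nth (0, 0)%N (midx k) m)).

(* D_j = d/dx^j + sum_(i, s) u^i_(s + 1_j) d/du^i_s, i.e. the derivative along
   the vector of J^k with components (1_j, u^i_(s + 1_j)). *)
Definition total_vector {R : realType} (k : nat) (j : 'I_2)
    (theta : jet R k.+1) : jet R k :=
  (delta_mx 0 j, \matrix_(i < 4, m < size (midx k))
     let s := nth (0, 0)%N (midx k) m in
     jcoord theta i ((s.1 + (j == 0%R))%N, (s.2 + (j == 1%R))%N)).

Definition totalD {R : realType} (k : nat) (j : 'I_2) (F : jet R k -> R)
    (theta : jet R k.+1) : R :=
  'D_(total_vector j theta) F (jproj theta).

(* [ucoord theta i a b] is u^i_(1..12..2) with 1 <= i <= 4, a ones, b twos. *)
Definition ucoord {R : realType} (k : nat) (theta : jet R k) (i a b : nat) : R :=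
  jcoord theta (inord i.-1) (a, b).

Local Notation u := ucoord.

Definition F1 {R : realType} (z : jet R 2) : R :=
  3 * u z 1 0 2 - 2 * u z 2 1 1 + u z 3 2 0
  + 3 * u z 4 0 0 * u z 1 1 0 - 3 * u z 3 0 0 * u z 1 0 1
  + 2 * u z 2 0 0 * u z 2 0 1 - u z 2 0 0 * u z 3 1 0
  - 3 * u z 1 0 0 * u z 3 0 1 + 6 * u z 1 0 0 * u z 4 1 0.

Definition F2 {R : realType} (z : jet R 2) : R :=
  u z 2 0 2 - 2 * u z 3 1 1 + 3 * u z 4 2 0
  - 3 * u z 1 0 0 * u z 4 0 1 + 3 * u z 2 0 0 * u z 4 1 0
  - 2 * u z 3 0 0 * u z 3 1 0 + u z 3 0 0 * u z 2 0 1
  + 3 * u z 4 0 0 * u z 2 1 0 - 6 * u z 4 0 0 * u z 1 0 1.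

Definition F3 {R : realType} (z : jet R 3) : R :=
  let f1 := F1 (jproj z) in
  let f2 := F2 (jproj z) in
  let D1 F := totalD 0 F z in
  let D2 F := totalD 1 F z in
  f2 * (f1 * D1 F2 - f2 * D1 F1) - f1 * (f1 * D2 F2 - f2 * D2 F1)
  + f1 ^+ 3 * u z 4 0 0 - f1 ^+ 2 * f2 * u z 3 0 0
  + f1 * f2 ^+ 2 * u z 2 0 0 - f2 ^+ 3 * u z 1 0 0.

(* Main.v *)
Require Import Defs.
From HB Require Import structures.
From mathcomp Require Import all_boot all_order all_algebra.
From mathcomp Require Import all_classical all_reals all_analysis.
From mathcomp Require Import ring lra.
Import Order.TTheory GRing.Theory Num.Theory.
Import numFieldNormedType.Exports.
Local Open Scope classical_set_scope.
Local Open Scope ring_scope.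
Set Implicit Arguments.
Unset Strict Implicit.
Unset Printing Implicit Defensive.

(* A jet is brought to a normal form by changes of variables whose inverse g is
   polynomial.  For g = id + h with h homogeneous of degree n, n = 2, ..., 5, the
   lift fixes the coordinates of order < n - 2 and translates those of order n - 2
   by an expression linear in h.  This kills all the coordinates of order 0 and 1,
   and leaves in order 2 only the two combinations F1 and F2, in order 3 only the
   four combinations D_i F1, D_i F2.  Under f, (F1, F2) is multiplied by the
   Jacobian matrix of g, transposed, and by its determinant J, and F3 is multiplied
   by J^5.  Linear maps therefore reduce (F1, F2) to (0, 0) or (1, 0), and if
   F3 <> 0 then a quadratic and a linear map reduce the derivatives of F1 and F2
   to D_2 F2 = 1 alone.  Conversely, vanishing of (F1, F2), or of F3, is preserved
   along orbits. *)

(** * Maps of class C^n *)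

Section Smooth.
Variable R : realType.
Implicit Types V W Z : normedModType R.

(** A homogeneous h of degree n has 2(n + 1) coefficients, against 4(n - 1) coordinates of order n -
    2. For n = 2 the two spare coefficients are the quadratic projective changes, which fix order 0
    and serve later to adjust the derivatives of F1 and F2; for n = 3 the counts agree; for n = 4, 5
    there remain 2 and 4 coordinates, as many as there are F_i and D_j F_i. The main obstacle is the
    size of the derivatives of a lifted section. F1 and F2 are therefore carried along as two extra
    rows with their own transformation law, so that D_j F_i takes one derivative of a short formula
    instead of three of the lift. Orbits are defined through graphs in which a section is chosen, so
    their symmetry and transitivity, hence functoriality of the lift, have to be proved. Normal
    forms live on 3-jets; lower orders follow by truncation, because the same f and S relate jets of
    every order. *)

Lemma diff_of_bound V W (f : V -> W) (df : {linear V -> W}) x :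
  continuous df ->
  (forall e, 0 < e -> \forall h \near 0, `|f (h + x) - f x - df h| <= e * `|h|) ->
  differentiable f x /\ 'd f x = df :> (V -> W).
Proof.
move=> dfc fdf.
have E : f \o shift x = cst (f x) + df +o_ 0 id.
  apply/eqaddoP => e e0; have := fdf e e0; apply: filter_app.
  by near=> h; rewrite !fctE /= opprD addrA.
have Ed := diff_unique dfc E.
by split=> //; apply/diff_locallyP; rewrite Ed.
Unshelve. all: by end_near. Qed.

Lemma near_differentiable V W (f g : V -> W) x :
  (\near x, f x = g x) -> differentiable f x -> differentiable g x.
Proof.
move=> fg df.
have [] // := @diff_of_bound _ _ g ('d f x) x.
  exact: diff_continuous.
move=> e e0.
have [_ /eqaddoP /(_ e e0)] := (diff_locallyP x f).1 df.
have fg0 : \forall h \near 0, f (h + x) = g (h + x).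
  by move: fg; rewrite (near_shift 0 x)/=; apply: filter_app; near=> y; rewrite subr0.
move: fg0; apply: filter_app2; near=> h => /= Eh.
rewrite -Eh -(nbhs_singleton fg).
by rewrite !fctE /= opprD addrA.
Unshelve. all: by end_near. Qed.

Lemma CkS n V W (U : set V) (f : V -> W) :
  Ck n.+1 U f <->
  (forall x, U x -> differentiable f x) /\ (forall v, Ck n U ('D_v f)).
Proof. by []. Qed.

Lemma Ck_sub n V W (U U' : set V) (f : V -> W) :
  U' `<=` U -> Ck n U f -> Ck n U' f.
Proof.
move=> sU; elim: n f => [|n IH] f /=.
  by move=> H x /sU; apply: H.
by case/CkS=> H1 H2; apply/CkS; split=> [x /sU|v]; [apply: H1|apply: IH].
Qed.

Lemma Ck_pred n V W (U : set V) (f : V -> W) : Ck n.+1 U f -> Ck n U f.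
Proof.
elim: n f => [|n IH] f /CkS[H1 H2].
  by move=> x Ux; apply: differentiable_continuous; apply: H1.
by apply/CkS; split=> // v; apply: IH.
Qed.

Lemma eq_Ck n V W (U : set V) (f g : V -> W) :
  open U -> (forall x, U x -> f x = g x) -> Ck n U f -> Ck n U g.
Proof.
move=> oU; elim: n f g => [|n IH] f g fg.
  move=> H x Ux; have nfg : \near x, f x = g x.
    by near=> y; apply: fg; near: y; exact: open_nbhs_nbhs.
  rewrite /prop_for /continuous_at -fg//.
  by apply: cvg_trans (H x Ux); apply: near_eq_cvg.
have nfg x : U x -> \near x, f x = g x.
  by move=> Ux; near=> y; apply: fg; near: y; exact: open_nbhs_nbhs.
case/CkS=> H1 H2; apply/CkS; split=> [x Ux|v].
  exact: near_differentiable (nfg x Ux) (H1 x Ux).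
by apply: IH (H2 v) => x Ux; apply: near_eq_derive; apply: nfg.
Unshelve. all: by end_near. Qed.

Lemma Ck_differentiable n V W (U : set V) (f : V -> W) x :
  Ck n.+1 U f -> U x -> differentiable f x.
Proof. by case=> H _; apply: H. Qed.

Lemma Ck_derive n V W (U : set V) (f : V -> W) v :
  Ck n.+1 U f -> Ck n U ('D_v f).
Proof. by case=> _; apply. Qed.

Lemma Ck_cst n V W (U : set V) (w : W) : Ck n U (fun _ : V => w).
Proof.
elim: n w => [|n IH] w /=; first by move=> x _; apply: cst_continuous.
split=> [x _|v]; first exact: differentiable_cst.
rewrite (_ : 'D_v _ = (fun=> 0)); first exact: IH.
by apply/funext => x; apply: derive_cst.
Qed.

Lemma CkD n V W (U : set V) (f g : V -> W) : open U ->
  Ck n U f -> Ck n U g -> Ck n U (fun x => f x + g x).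
Proof.
move=> oU; elim: n f g => [|n IH] f g.
  by move=> Hf Hg x Ux; apply: continuousD; [apply: Hf|apply: Hg].
case/CkS=> Hf1 Hf2 /CkS[Hg1 Hg2]; apply/CkS; split=> [x Ux|v].
  by apply: differentiableD; [apply: Hf1|apply: Hg1].
apply: (@eq_Ck _ _ _ _ (fun x => 'D_v f x + 'D_v g x)) => // [x Ux|].
  by rewrite deriveD//; apply: diff_derivable; [apply: Hf1|apply: Hg1].
exact: IH.
Qed.

(** A continuous linear map commutes with every ['D_v], so the induction closes without a product
    rule. Entries, scalings, pairs and projections below are instances. *)
Lemma Ck_lin n V W W' (U : set V) (f : V -> W) (l : W -> W') : open U ->
  linear l -> continuous l -> Ck n U f -> Ck n U (fun x => l (f x)).
Proof.
move=> oU ll lc; pose lM := GRing.isLinear.Build _ _ _ _ _ ll.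
pose L : {linear W -> W'} := HB.pack l lM.
elim: n f => [|n IH] f.
  by move=> H x Ux; apply: continuous_comp; [apply: H|apply: lc].
case/CkS=> H1 H2; have dl y : differentiable l y.
  exact: (@linear_differentiable _ _ _ L).
apply/CkS; split=> [x Ux|v]; first by apply: differentiable_comp; [apply: H1|].
apply: (@eq_Ck _ _ _ _ (fun x => l ('D_v f x))) => // [x Ux|]; last exact: IH.
have dfx := H1 x Ux.
rewrite [RHS](@deriveE _ _ _ (l \o f)); last exact: differentiable_comp.
by rewrite diff_comp//= (@diff_lin _ _ _ L _ lc) deriveE.
Qed.

Lemma CkM n V (U : set V) (f g : V -> R) : open U ->
  Ck n U f -> Ck n U g -> Ck n U (fun x => f x * g x).
Proof.
move=> oU; elim: n f g => [|n IH] f g.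
  by move=> Hf Hg x Ux; apply: continuousM; [apply: Hf|apply: Hg].
move=> Hf Hg; have /CkS[Hf1 Hf2] := Hf; have /CkS[Hg1 Hg2] := Hg; apply/CkS; split=> [x Ux|v].
  by apply: differentiableM; [apply: Hf1|apply: Hg1].
apply: (@eq_Ck _ _ _ _ (fun x => f x * 'D_v g x + g x * 'D_v f x)) => // [x Ux|].
  by rewrite deriveM//; apply: diff_derivable; [apply: Hf1|apply: Hg1].
by apply: CkD => //; apply: IH => //; apply: Ck_pred.
Qed.

Lemma CkV n V (U : set V) (f : V -> R) : open U ->
  (forall x, U x -> f x != 0) -> Ck n U f -> Ck n U (fun x => (f x)^-1).
Proof.
move=> oU f0; elim: n f f0 => [|n IH] f f0.
  by move=> Hf x Ux; apply: continuousV; [apply: f0|apply: Hf].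
move=> Hf; have /CkS[Hf1 Hf2] := Hf; apply/CkS; split=> [x Ux|v].
  by apply: differentiableV; [apply: Hf1|apply: f0].
apply: (@eq_Ck _ _ _ _ (fun x => - 1 * ((f x)^-1 * (f x)^-1 * 'D_v f x))) => // [x Ux|].
  rewrite deriveV ?f0//; last by apply: diff_derivable; apply: Hf1.
  by rewrite /GRing.scale /= expr2 invfM mulN1r mulNr.
apply: CkM; [by []|exact: Ck_cst|].
by apply: CkM => //; apply: CkM => //; apply: IH => //; apply: Ck_pred.
Qed.

Lemma Ck_coord n V p q (U : set V) (f : V -> 'M[R]_(p, q)) i j : open U ->
  Ck n U f -> Ck n U (fun x => f x i j).
Proof.
move=> oU; apply: (@Ck_lin _ _ _ _ _ _ (fun M : 'M[R]_(p, q) => M i j : R)) => //.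
  by move=> a u v; rewrite !mxE.
exact: coord_continuous.
Qed.

Lemma Ck_scale n V W (U : set V) (a : V -> R) (w : W) : open U ->
  Ck n U a -> Ck n U (fun x => a x *: w).
Proof.
move=> oU; apply: (@Ck_lin _ _ R W _ _ (fun t : R => t *: w)) => //.
  by move=> c u v; rewrite scalerDl -scalerA.
exact: scalel_continuous.
Qed.

Lemma Ck_sum n V W (U : set V) (I : Type) (r : seq I) (P : pred I)
    (f : I -> V -> W) : open U ->
  (forall i, P i -> Ck n U (f i)) -> Ck n U (fun x => \sum_(i <- r | P i) f i x).
Proof.
move=> oU H; elim: r => [|i r IH].
  rewrite (_ : (fun _ => _) = fun=> 0); first exact: Ck_cst.
  by apply/funext => x; rewrite big_nil.
case Pi : (P i).
  rewrite (_ : (fun _ => _) = fun x => f i x + \sum_(i <- r | P i) f i x).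
    by apply: CkD => //; apply: H.
  by apply/funext => x; rewrite big_cons Pi.
by rewrite (_ : (fun _ => _) = fun x => \sum_(i <- r | P i) f i x)//;
  apply/funext => x; rewrite big_cons Pi.
Qed.

Lemma Ck_mx n V p q (U : set V) (f : V -> 'M[R]_(p, q)) : open U ->
  (forall i j, Ck n U (fun x => f x i j)) -> Ck n U f.
Proof.
move=> oU H; rewrite (_ : f = fun x => \sum_i \sum_j f x i j *: delta_mx i j).
  by apply: Ck_sum => // i _; apply: Ck_sum => // j _; apply: Ck_scale.
by apply/funext => x; apply: matrix_sum_delta.
Qed.

Lemma Ck_pair n V W1 W2 (U : set V) (f : V -> W1) (g : V -> W2) : open U ->
  Ck n U f -> Ck n U g -> Ck n U (fun x => (f x, g x)).
Proof.
move=> oU Hf Hg.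
rewrite (_ : (fun _ => _) = fun x => ((f x, 0) + (0, g x) : (W1 * W2)%type)); last first.
  by apply/funext => x; congr (_, _); rewrite /= ?addr0 ?add0r.
apply: CkD => //.
  apply: (@Ck_lin _ _ _ (W1 * W2)%type _ _ (fun w : W1 => (w, 0))) => //.
    by move=> a u v; congr (_, _); rewrite /= ?scaler0 ?addr0.
  by move=> x; apply: cvg_pair => //; apply: cvg_cst.
apply: (@Ck_lin _ _ _ (W1 * W2)%type _ _ (fun w : W2 => (0, w))) => //.
  by move=> a u v; congr (_, _); rewrite /= ?scaler0 ?addr0.
by move=> x; apply: cvg_pair => //; apply: cvg_cst.
Qed.

Lemma Ck_snd n V W1 W2 (U : set V) (f : V -> (W1 * W2)%type) : open U ->
  Ck n U f -> Ck n U (fun x => (f x).2).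
Proof.
move=> oU; apply: (@Ck_lin _ _ (W1 * W2)%type W2 _ _ (fun w => w.2)) => //.
by move=> x; apply: cvg_snd.
Qed.

Lemma Ck_id n V (U : set V) : Ck n U (fun x : V => x).
Proof.
case: n => [|[|n]].
- by move=> x _; apply: cvg_id.
- split=> [x _|v]; first by [].
  rewrite (_ : 'D_v _ = fun=> v); first by move=> x _; apply: cst_continuous.
  by apply/funext => x; apply: derive_id.
- split=> [x _|v]; first by [].
  rewrite (_ : 'D_v _ = fun=> v); first exact: Ck_cst.
  by apply/funext => x; apply: derive_id.
Qed.

Lemma derive_rV m W (h : 'rV[R]_m -> W) x v : differentiable h x ->
  'D_v h x = \sum_j v 0 j *: 'D_(delta_mx 0 j) h x.
Proof.
move=> dh; rewrite deriveE// [v in LHS]row_sum_delta linear_sum.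
by apply: eq_bigr => j _; rewrite linearZ/= deriveE.
Qed.

Lemma derive_comp V W Z (f : V -> W) (h : W -> Z) x v :
  differentiable f x -> differentiable h (f x) ->
  'D_v (h \o f) x = 'D_('D_v f x) h (f x).
Proof.
move=> df dh; rewrite deriveE; last exact: differentiable_comp.
by rewrite diff_comp//= !deriveE.
Qed.

Lemma derive_coord V p q (f : V -> 'M[R]_(p, q)) x v i j : differentiable f x ->
  'D_v (fun y => f y i j) x = ('D_v f x) i j.
Proof.
by move=> df; rewrite derive_mx ?mxE//; apply: diff_derivable.
Qed.

(** The chain rule expresses the derivatives of the composite by partial derivatives of h composed
    with f; hence h is generalized in the induction, while f only drops one class by [Ck_pred]. *)
Lemma Ck_comp n V m (U : set V) (U' : set 'rV[R]_m) (f : V -> 'rV[R]_m)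
    (h : 'rV[R]_m -> R) : open U -> (forall x, U x -> U' (f x)) ->
  Ck n U f -> Ck n U' h -> Ck n U (fun x => h (f x)).
Proof.
move=> oU fU; elim: n h => [|n IH] h.
  by move=> Hf Hh x Ux; apply: continuous_comp; [apply: Hf|apply: Hh; apply: fU].
move=> Hf /CkS[Hh1 Hh2]; have /CkS[Hf1 Hf2] := Hf; apply/CkS; split=> [x Ux|v].
  by apply: differentiable_comp; [apply: Hf1|apply: Hh1; apply: fU].
apply: (@eq_Ck _ _ _ _
  (fun x => \sum_j ('D_v f x) 0 j * 'D_(delta_mx 0 j) h (f x))) => // [x Ux|].
  have dfx := Hf1 x Ux; have dhx := Hh1 _ (fU x Ux).
  by rewrite [RHS](derive_comp v dfx dhx) (derive_rV _ dhx).
apply: Ck_sum => // j _; apply: CkM => //; first exact: Ck_coord.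
by apply: IH (Hh2 _); apply: Ck_pred.
Qed.

Lemma derive_line V W (f : V -> W) p v (t : R) : differentiable f (p + t *: v) ->
  is_derive t 1 (fun t : R => f (p + t *: v)) ('D_v f (p + t *: v)).
Proof.
move=> df; have dl : is_diff t (fun t : R => p + t *: v) ( *:%R^~ v).
  exact: is_diff_eq (is_diffD (is_diff_cst p t) (is_diff_scalel t v)) (add0r _).
have dc : differentiable (f \o (fun t : R => p + t *: v)) t.
  by apply: differentiable_comp.
apply: DeriveDef; first exact: diff_derivable.
rewrite [LHS](@derive_comp R _ _ (fun t : R => p + t *: v) f)// [X in 'D_X f _]deriveE//.
by rewrite (@diff_val _ _ _ _ _ _ _ dl)/= scale1r.
Qed.

Lemma MVT_line V (f : V -> R) p v (s : R) : 0 < s ->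
  (forall t, 0 <= t <= s -> differentiable f (p + t *: v)) ->
  exists2 c, 0 < c < s & f (p + s *: v) - f p = s * 'D_v f (p + c *: v).
Proof.
move=> s0 df.
have [| |c cs] := @MVT R (fun t : R => f (p + t *: v)) (fun t => 'D_v f (p + t *: v)) _ _ s0.
- move=> t; rewrite in_itv/= => /andP[t0 ts]; apply: derive_line.
  by apply: df; rewrite !ltW.
- apply: derivable_within_continuous => t; rewrite in_itv/= => ts.
  by have [] := derive_line (df t ts).
rewrite scale0r addr0 subr0 mulrC => E; by exists c.
Qed.

Lemma derive_shift_dir V W (f : V -> W) c v x : differentiable f (x + c) ->
  differentiable (fun y => f (y + c)) x /\
  'D_v (fun y => f (y + c)) x = 'D_v f (x + c).
Proof.
move=> df; have ds : is_diff x (fun y : V => y + c) id.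
  exact: is_diff_eq (is_diffD (is_diff_id x) (is_diff_cst c x)) (addr0 _).
split; first exact: (@differentiable_comp _ _ _ _ (fun y => y + c) f).
rewrite [LHS](@derive_comp _ _ _ (fun y => y + c) f)//.
by rewrite [X in 'D_X f _]deriveE// (@diff_val _ _ _ _ _ _ _ ds).
Qed.

(** The mean value theorem is used twice: along v for the increment f(. + s w) - f, then along w for
    ['D_v f]. The left-hand side is symmetric in v and w. *)
Lemma second_difference V (U : set V) (f : V -> R) p v w (s : R) : 0 < s ->
  (forall t r, 0 <= t <= s -> 0 <= r <= s -> U (p + t *: v + r *: w)) ->
  Ck 2 U f ->
  exists t r, [/\ 0 < t < s, 0 < r < s &
    f (p + s *: v + s *: w) - f (p + s *: v) - f (p + s *: w) + f p
    = s ^+ 2 * 'D_w ('D_v f) (p + t *: v + r *: w)].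
Proof.
move=> s0 HU /CkS[Hf1 Hf2].
have s0' : 0 <= s <= s by rewrite lexx ltW.
have z0 : 0 <= (0 : R) <= s by rewrite lexx ltW.
have dsh t : 0 <= t <= s -> differentiable f (p + t *: v + s *: w).
  by move=> ts; apply: Hf1; apply: HU.
have dnsh t : 0 <= t <= s -> differentiable f (p + t *: v).
  by move=> ts; apply: Hf1; have := HU t 0 ts z0; rewrite scale0r addr0.
have [|t ts E] := @MVT_line V (fun x => f (x + s *: w) - f x) p v s s0.
  move=> t ts; apply: differentiableB; last exact: dnsh.
  by apply: (derive_shift_dir v (dsh t ts)).1.
have tsW : 0 <= t <= s by case/andP: ts => ? ?; rewrite !ltW.
have [|r rs E2] := @MVT_line V ('D_v f) (p + t *: v) w s s0.
  by move=> r rs; have /CkS[H _] := Hf2 v; apply: H; apply: HU.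
exists t, r; split=> //.
rewrite expr2 -mulrA -E2.
move: E; rewrite deriveB; last 2 first.
  by apply: diff_derivable; apply: (derive_shift_dir v (dsh t tsW)).1.
  by apply: diff_derivable; apply: dnsh.
rewrite (derive_shift_dir v (dsh t tsW)).2 => <-.
by rewrite opprB [RHS]addrA [RHS]addrAC.
Qed.

Lemma dist_half (a b c e : R) :
  `|a - c| < e / 2 -> `|b - c| < e / 2 -> `|a - b| <= e.
Proof.
move=> ac bc; rewrite -(subrKA c) (splitr e).
by apply: le_trans (ler_normD _ _) _; apply: lerD; [|rewrite distrC]; apply: ltW.
Qed.

(** Schwarz's theorem. The two mixed derivatives, taken at points of a small parallelogram, equal
    the same second difference divided by s^2; continuity at p brings their values at p within every
    e of each other. *)
Lemma derive_comm V (U : set V) (f : V -> R) p v w : open U -> U p -> Ck 2 U f ->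
  'D_w ('D_v f) p = 'D_v ('D_w f) p.
Proof.
move=> oU Up Hf.
have cvw : {for p, continuous ('D_w ('D_v f))} by case: (Hf) => _ /(_ v)[_ /(_ w)]; apply.
have cwv : {for p, continuous ('D_v ('D_w f))} by case: (Hf) => _ /(_ w)[_ /(_ v)]; apply.
apply/eqP; rewrite -subr_eq0 -normr_le0; apply/ler_addgt0Pr => e e0; rewrite add0r.
have e2 : 0 < e / 2 by rewrite divr_gt0.
have : \forall x \near p, [/\ U x, `|'D_w ('D_v f) p - 'D_w ('D_v f) x| < e / 2
   & `|'D_v ('D_w f) p - 'D_v ('D_w f) x| < e / 2].
  apply: filterS3 (open_nbhs_nbhs (conj oU Up)) _ _; last 2 first.
  - by move/cvgrPdist_lt : cvw => /(_ _ e2); apply.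
  - by move/cvgrPdist_lt : cwv => /(_ _ e2); apply.
  - by move=> x; exact: And3.
move=> /nbhs_ballP[r /= r0 Hr].
(* The parallelogram with sides s v and s w at p fits in the ball of radius r; the + 1 keeps the
   divisor positive when v = w = 0. *)
pose s := r / (2 * (`|v| + `|w| + 1)).
have N0 : 0 < `|v| + `|w| + 1 by rewrite ltr_wpDl// addr_ge0.
have s0 : 0 < s by rewrite divr_gt0// mulr_gt0.
have box t u : 0 <= t <= s -> 0 <= u <= s -> ball p r (p + t *: v + u *: w).
  move=> /andP[t0 ts] /andP[u0 us]; rewrite -ball_normE /ball_/=.
  rewrite -addrA opprD addrA subrr sub0r normrN.
  apply: le_lt_trans (ler_normD _ _) _; rewrite !normrZ !ger0_norm//.
  apply: (@le_lt_trans _ _ (s * (`|v| + `|w| + 1))).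
    by rewrite !mulrDr mulr1 -[leLHS]addr0; apply: lerD (ltW s0); apply: lerD; apply: ler_wpM2r.
  by rewrite /s invfM mulrA mulfVK ?gt_eqF//= ltr_pdivrMr// ltr_pMr// ltr1n.
have HU t u : 0 <= t <= s -> 0 <= u <= s -> U (p + t *: v + u *: w).
  by move=> ts us; have [] := Hr _ (box t u ts us).
have HU' t u : 0 <= t <= s -> 0 <= u <= s -> U (p + t *: w + u *: v).
  by move=> ts us; rewrite addrAC; apply: HU.
have lW (t : R) : 0 < t < s -> 0 <= t <= s by move=> /andP[? ?]; rewrite !ltW.
have [t1 [r1 [/lW t1s /lW r1s E1]]] := second_difference s0 HU Hf.
have [t2 [r2 [/lW t2s /lW r2s E2]]] := second_difference s0 HU' Hf.
have E : 'D_w ('D_v f) (p + t1 *: v + r1 *: w) = 'D_v ('D_w f) (p + t2 *: w + r2 *: v).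
  apply: (@mulfI _ (s ^+ 2)); first by rewrite expf_neq0// gt_eqF.
  apply: etrans (esym E1) (etrans _ E2).
  by rewrite [p + _ + s *: w]addrAC [X in X + f p]addrAC.
have [_ H1 _] := Hr _ (box _ _ t1s r1s).
have [_ _ H2] := Hr _ (box _ _ r2s t2s).
rewrite E in H1; rewrite addrAC in H2.
exact: dist_half H1 H2.
Qed.

End Smooth.

(** * Partial derivatives in the plane *)

Section Partial.
Variable R : realType.
Local Notation E := 'rV[R]_2.
Implicit Types (f g h : E -> R) (U W : set E) (j : 'I_2) (s : nat * nat).

Lemma smooth_sub (V Z : normedModType R) (U W : set V) (f : V -> Z) :
  W `<=` U -> smooth_on U f -> smooth_on W f.
Proof. by move=> WU H n; apply: Ck_sub (H n). Qed.

Lemma eq_smooth (V Z : normedModType R) (U : set V) (f g : V -> Z) : open U ->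
  (forall x, U x -> f x = g x) -> smooth_on U f -> smooth_on U g.
Proof. by move=> oU fg H n; apply: eq_Ck (H n). Qed.

Lemma smooth_cst (V : normedModType R) (U : set V) (c : R) : smooth_on U (fun=> c).
Proof. by move=> n; apply: Ck_cst. Qed.

Section Pointwise.
Variables (V : normedModType R) (U : set V) (f g : V -> R).
Hypotheses (oU : open U) (Hf : smooth_on U f) (Hg : smooth_on U g).

Lemma smoothD : smooth_on U (fun x => f x + g x).
Proof. by move=> n; apply: CkD. Qed.

Lemma smoothM : smooth_on U (fun x => f x * g x).
Proof. by move=> n; apply: CkM. Qed.

Lemma smoothN : smooth_on U (fun x => - f x).
Proof.
apply: (@eq_smooth _ _ _ (fun x => -1 * f x)) => // [x _|n].
  by rewrite mulN1r.
by apply: CkM => //; apply: smooth_cst.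
Qed.

Lemma smoothV : (forall x, U x -> f x != 0) -> smooth_on U (fun x => (f x)^-1).
Proof. by move=> f0 n; apply: CkV. Qed.

Lemma smoothX n : smooth_on U (fun x => f x ^+ n).
Proof.
move=> k; elim: n => [|n IH]; first exact: Ck_cst.
apply: (@eq_Ck _ _ _ _ _ (fun x => f x * f x ^+ n)) => //; last exact: CkM.
by move=> x _; rewrite exprS.
Qed.

End Pointwise.

Lemma smooth_comp U W h (g : E -> E) : open U -> (forall x, U x -> W (g x)) ->
  smooth_on U g -> smooth_on W h -> smooth_on U (fun x => h (g x)).
Proof. by move=> oU gU Hg Hh n; apply: Ck_comp gU (Hg n) (Hh n). Qed.

Lemma smooth_coord (V : normedModType R) p q (U : set V) (f : V -> 'M[R]_(p, q)) i k :
  open U -> smooth_on U f -> smooth_on U (fun x => f x i k).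
Proof. by move=> oU Hf n; apply: Ck_coord. Qed.

Lemma smooth_mx (V : normedModType R) p q (U : set V) (f : V -> 'M[R]_(p, q)) :
  open U -> (forall i k, smooth_on U (fun x => f x i k)) -> smooth_on U f.
Proof. by move=> oU Hf n; apply: Ck_mx => // i k; apply: Hf. Qed.

Lemma smooth_partial j U f : smooth_on U f -> smooth_on U (partial j f).
Proof. by move=> Hf n; apply: Ck_derive (Hf n.+1). Qed.

Lemma smooth_partials s U f : smooth_on U f -> smooth_on U (partials s f).
Proof.
case: s => a b Hf; rewrite /partials /=.
by elim: a => [|a IH] /=; [elim: b => //= b IH|]; apply: smooth_partial.
Qed.

Lemma smooth_differentiable (V W : normedModType R) (U : set V) (f : V -> W) x :
  smooth_on U f -> U x -> differentiable f x.
Proof. by move=> Hf; apply: Ck_differentiable (Hf 1%N). Qed.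

Lemma smooth_derivable (V W : normedModType R) (U : set V) (f : V -> W) x v :
  smooth_on U f -> U x -> derivable f x v.
Proof. by move=> Hf Ux; apply/diff_derivable/(smooth_differentiable Hf). Qed.

Lemma partial_cst j (c : R) x : partial j (fun=> c) x = 0.
Proof. exact: derive_cst. Qed.

Lemma partialD j U f g x : smooth_on U f -> smooth_on U g -> U x ->
  partial j (fun x => f x + g x) x = partial j f x + partial j g x.
Proof.
by move=> Hf Hg Ux; apply: deriveD; [apply: smooth_derivable Hf Ux|apply: smooth_derivable Hg Ux].
Qed.

Lemma partialM j U f g x : smooth_on U f -> smooth_on U g -> U x ->
  partial j (fun x => f x * g x) x = partial j f x * g x + f x * partial j g x.
Proof.
move=> Hf Hg Ux; rewrite [LHS]deriveM; first by rewrite [LHS]addrC [X in X + _ = _]mulrC.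
  exact: smooth_derivable Hf Ux.
exact: smooth_derivable Hg Ux.
Qed.

Lemma partialN j U f x : smooth_on U f -> U x ->
  partial j (fun x => - f x) x = - partial j f x.
Proof. by move=> Hf Ux; apply: deriveN; apply: smooth_derivable Hf Ux. Qed.

Lemma partialV j U f x : smooth_on U f -> U x -> f x != 0 ->
  partial j (fun x => (f x)^-1) x = - ((f x)^-1 * (f x)^-1 * partial j f x).
Proof.
move=> Hf Ux f0; rewrite [LHS]deriveV//; last exact: smooth_derivable Hf Ux.
by rewrite /GRing.scale /= expr2 invfM mulNr.
Qed.

Lemma partial_comp j U W (g : E -> E) h x : smooth_on U g -> smooth_on W h ->
  U x -> W (g x) ->
  partial j (fun x => h (g x)) x =
  partial j (fun x => g x 0 0) x * partial 0 h (g x) +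
  partial j (fun x => g x 0 1) x * partial 1 h (g x).
Proof.
move=> Hg Hh Ux Wx; have dg := smooth_differentiable Hg Ux.
have dh := smooth_differentiable Hh Wx.
rewrite [LHS](@derive_comp _ _ _ _ g h)// derive_rV// big_ord_recl big_ord1.
by rewrite -!derive_coord// (_ : lift ord0 ord0 = 1)//; apply/val_inj.
Qed.

Lemma eq_partial j U f g x : open U -> (forall x, U x -> f x = g x) -> U x ->
  partial j f x = partial j g x.
Proof.
move=> oU fg Ux; apply: near_eq_derive.
by apply: filterS (open_nbhs_nbhs (conj oU Ux)) => y; apply: fg.
Qed.

Lemma partialsS0 a b f : partials (a.+1, b) f = partial 0 (partials (a, b) f).
Proof. by []. Qed.

(** [partials] applies the x^2-derivatives innermost, so an outer one has to be moved past the
    x^1-derivatives by Schwarz's theorem. *)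
Lemma partialsS1 a b U f x : open U -> smooth_on U f -> U x ->
  partials (a, b.+1) f x = partial 1 (partials (a, b) f) x.
Proof.
move=> oU Hf; elim: a x => [|a IH] x Ux //.
rewrite !partialsS0 (eq_partial _ oU IH Ux).
exact: derive_comm oU Ux (smooth_partials (a, b) Hf 2%N).
Qed.

Lemma eq_partials s U f g x : open U -> (forall x, U x -> f x = g x) -> U x ->
  partials s f x = partials s g x.
Proof.
case: s => a b oU fg; rewrite /partials /=.
elim: a x => [|a IH] x Ux /=; last exact: eq_partial oU IH Ux.
elim: b x Ux => [|b IH] x Ux /=; first exact: fg.
exact: eq_partial oU IH Ux.
Qed.

End Partial.

(* Derivatives of composite expressions are computed by formal differentiation [tder]
   of such terms, so that identities between jets become polynomial identities. *)
Inductive term (T : Type) : Type :=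
  | Var of T | Nat of nat | Add of term T & term T | Mul of term T & term T
  | Opp of term T.
Arguments Nat {T}.

(** Directions and components are booleans inside terms, so that formal derivatives reduce by
    computation. *)
Definition ix (b : bool) : 'I_2 := if b then 1 else 0.

Section Term.
Variable T : Type.

Fixpoint eval (S : pzRingType) (e : T -> S) (t : term T) : S :=
  match t with
  | Var v => e v
  | Nat n => n%:R
  | Add t1 t2 => eval e t1 + eval e t2
  | Mul t1 t2 => eval e t1 * eval e t2
  | Opp t1 => - eval e t1
  end.

Fixpoint tder (d : T -> term T) (t : term T) : term T :=
  match t with
  | Var v => d v
  | Nat _ => Nat 0
  | Add t1 t2 => Add (tder d t1) (tder d t2)
  | Mul t1 t2 => Add (Mul (tder d t1) t2) (Mul t1 (tder d t2))
  | Opp t1 => Opp (tder d t1)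
  end.

Definition tders (d : bool -> T -> term T) (s : nat * nat) (t : term T) : term T :=
  iter s.1 (tder (d false)) (iter s.2 (tder (d true)) t).

Fixpoint tall (P : T -> bool) (t : term T) : bool :=
  match t with
  | Var v => P v
  | Nat _ => true
  | Add t1 t2 | Mul t1 t2 => tall P t1 && tall P t2
  | Opp t1 => tall P t1
  end.

(** The predicate bounds the variables that occur, so that two environments need only agree up to
    the order at hand. *)
Lemma eq_eval (S : pzRingType) (e e' : T -> S) P t : tall P t ->
  (forall v, P v -> e v = e' v) -> eval e t = eval e' t.
Proof.
move=> Pt H; elim: t Pt => [v|n|t1 IH1 t2 IH2|t1 IH1 t2 IH2|t IH] //=.
- exact: H.
- by case/andP=> /IH1 -> /IH2 ->.
- by case/andP=> /IH1 -> /IH2 ->.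
- by move/IH ->.
Qed.

Lemma tall_sub (P Q : T -> bool) t : (forall v, P v -> Q v) -> tall P t -> tall Q t.
Proof.
move=> PQ; elim: t => [v|n|t1 IH1 t2 IH2|t1 IH1 t2 IH2|t IH] //=; first exact: PQ.
- by case/andP=> /IH1 -> /IH2.
- by case/andP=> /IH1 -> /IH2.
Qed.

Lemma tall_tder d (P Q : T -> bool) t : (forall v, P v -> Q v) ->
  (forall v, P v -> tall Q (d v)) -> tall P t -> tall Q (tder d t).
Proof.
move=> PQ H; elim: t => [v|n|t1 IH1 t2 IH2|t1 IH1 t2 IH2|t IH] //=; first exact: H.
- by case/andP=> /IH1 -> /IH2.
- case/andP=> P1 P2; rewrite IH1// IH2// andbT.
  by rewrite (tall_sub PQ P1) (tall_sub PQ P2).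
Qed.

Lemma tall_tders d (P : T -> bool) s t : (forall j v, P v -> tall P (d j v)) ->
  tall P t -> tall P (tders d s t).
Proof.
case: s => a b H Pt; rewrite /tders /=.
elim: a => [|a IH] /=; last by apply: tall_tder (H false) IH.
by elim: b => [|b IH] //=; apply: tall_tder (H true) IH.
Qed.

Lemma smooth_eval (R : realType) (V : normedModType R) (U : set V) (e : T -> V -> R) t :
  open U -> (forall v, smooth_on U (e v)) -> smooth_on U (fun x => eval (e ^~ x) t).
Proof.
move=> oU Se; elim: t => [v|n|t1 H1 t2 H2|t1 H1 t2 H2|t H] /=; first exact: Se.
- exact: smooth_cst.
- exact: smoothD.
- exact: smoothM.
- exact: smoothN.
Qed.

Section Eval.
Variables (R : realType) (U : set 'rV[R]_2) (e : T -> 'rV[R]_2 -> R).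
Variable d : bool -> T -> term T.
Hypothesis oU : open U.
Hypothesis e_smooth : forall v, smooth_on U (e v).
Hypothesis e_partial : forall j v x, U x ->
  partial (ix j) (e v) x = eval (e ^~ x) (d j v).

Lemma partial_eval j t x : U x ->
  partial (ix j) (fun x => eval (e ^~ x) t) x = eval (e ^~ x) (tder (d j) t).
Proof.
move=> Ux; have S t1 := smooth_eval t1 oU e_smooth.
elim: t => [v|n|t1 H1 t2 H2|t1 H1 t2 H2|t H] /=; first exact: e_partial.
- exact: partial_cst.
- by rewrite (partialD _ (S t1) (S t2) Ux) H1 H2.
- by rewrite (partialM _ (S t1) (S t2) Ux) H1 H2.
- by rewrite (partialN _ (S t) Ux) H.
Qed.

Lemma partials_eval s t x : U x ->
  partials s (fun x => eval (e ^~ x) t) x = eval (e ^~ x) (tders d s t).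
Proof.
case: s => a b; rewrite /partials /tders /=.
elim: a x => [|a IH] x Ux /=; last first.
  by rewrite (eq_partial _ oU IH Ux) (partial_eval false).
elim: b x Ux => [|b IH] x Ux //=.
by rewrite (eq_partial _ oU IH Ux) (partial_eval true).
Qed.

End Eval.
End Term.

(** * The inverse function theorem *)

Section InverseFunction.
Variable R : realType.
Local Notation E := 'rV[R]_2.

Lemma ball_fixed_point (q : E) (r : R) (T : E -> E) : 0 <= r ->
  (forall x, `|q - x| <= r -> `|q - T x| <= r) ->
  (forall x y, `|q - x| <= r -> `|q - y| <= r -> `|T x - T y| <= 2^-1 * `|x - y|) ->
  exists2 x, `|q - x| <= r & x = T x.
Proof.
move=> r0 TB Tc.
pose X : completeNormedModType R := HB.pack_for (completeNormedModType R) 'rV[R]_2.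
pose U : set X := [set x | `|q - x| <= r].
have TU : set_fun U U (T : X -> X) by move=> x; apply: TB.
have h0 : 0 <= (2^-1 : R) by rewrite invr_ge0.
have [|||x Ux xT] := @banach_fixed_point R X U (mkfun TU).
- exists (NngNum h0); split; first by rewrite /= invf_lt1// ltr1n.
  by move=> [x y] [/= Ux Uy]; apply: Tc.
- exact: (@closed_closed_ball_ R 'rV[R]_2 q r).
- by exists q; rewrite /U /= subrr normr0.
by exists x.
Qed.

Lemma I2P (j : 'I_2) : j = 0 \/ j = 1.
Proof. by case: j => -[|[|//]] j2; [left|right]; apply/val_inj. Qed.

Lemma rV2P (x y : E) : x 0 0 = y 0 0 -> x 0 1 = y 0 1 -> x = y.
Proof.
by move=> E0 E1; apply/rowP => j; case: (I2P j) => ->.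
Qed.

Lemma rV2_norm_le (x : E) c : 0 <= c ->
  (`|x| <= c) = (`|x 0 0| <= c) && (`|x 0 1| <= c).
Proof.
move=> c0; rewrite [`|x|]mx_normrE; apply/bigmax_leP/andP => [[_ H]|[H0 H1]].
  by split; [apply: (H (0, 0))|apply: (H (0, 1))].
by split=> // -[i j] _ /=; rewrite ord1; case: (I2P j) => ->.
Qed.

Lemma rV2_coord_le (x : E) j : `|x 0 j| <= `|x|.
Proof.
have := lexx `|x|; rewrite {1}rV2_norm_le// => /andP[H0 H1].
by case: (I2P j) => ->.
Qed.

Lemma derive_partial (f : E -> R) x v : differentiable f x ->
  'D_v f x = v 0 0 * partial 0 f x + v 0 1 * partial 1 f x.
Proof.
move=> df; rewrite derive_rV// big_ord_recl big_ord1.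
by rewrite (_ : lift ord0 ord0 = 1)//; apply/val_inj.
Qed.

(** Mean value theorem on the segment from y to x, which stays in the ball by convexity. The factor
    2 counts the partial derivatives, the norm being the maximum of the coordinates. *)
Lemma scalar_lipschitz (f : E -> R) q r c : 0 <= c ->
  (forall x, `|q - x| <= r -> differentiable f x) ->
  (forall j x, `|q - x| <= r -> `|partial j f x| <= c) ->
  forall x y, `|q - x| <= r -> `|q - y| <= r -> `|f x - f y| <= 2 * c * `|x - y|.
Proof.
move=> c0 df pf x y qx qy.
have seg t : 0 <= t <= 1 -> `|q - (y + t *: (x - y))| <= r.
  move=> /andP[t0 t1].
  have -> : q - (y + t *: (x - y)) = (1 - t) *: (q - y) + t *: (q - x).
    by apply/rowP => j; rewrite !mxE; ring.
  apply: le_trans (ler_normD _ _) _; rewrite !normrZ !ger0_norm ?subr_ge0//.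
  have -> : r = (1 - t) * r + t * r by ring.
  by apply: lerD; apply: ler_wpM2l => //; rewrite subr_ge0.
have [t ts|c1 /andP[c10 c11]] := @MVT_line R _ f y (x - y) 1 ltr01.
  by apply: df; apply: seg.
have cs : 0 <= c1 <= 1 by rewrite !ltW.
rewrite scale1r mul1r [y + (x - y)]addrC subrK => ->.
rewrite derive_partial; last by apply: df; apply: seg.
apply: le_trans (ler_normD _ _) _; rewrite !normrM.
have -> : 2 * c * `|x - y| = `|x - y| * c + `|x - y| * c by ring.
by apply: lerD; apply: ler_pM; rewrite ?rV2_coord_le//; apply: pf; apply: seg.
Qed.

Variables (g : E -> E) (W : set E) (q : E).
Hypotheses (oW : open W) (Wq : W q) (g_smooth : smooth_on W g).

Let dg i j (x : E) : R := partial j (fun y => g y 0 i) x.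
Let J x := dg 0 0 x * dg 1 1 x - dg 0 1 x * dg 1 0 x.
Hypothesis J0 : J q != 0.

(* Cramer's rule for the inverse of 'd g x. *)
Let L x (h : E) : E := \row_(i < 2)
  (if i == 0 then (h 0 0 * dg 1 1 x - h 0 1 * dg 0 1 x) / J x
   else (h 0 1 * dg 0 0 x - h 0 0 * dg 1 0 x) / J x).

Let L0 x h : L x h 0 0 = (h 0 0 * dg 1 1 x - h 0 1 * dg 0 1 x) / J x.
Proof. by rewrite mxE. Qed.
Let L1 x h : L x h 0 1 = (h 0 1 * dg 0 0 x - h 0 0 * dg 1 0 x) / J x.
Proof. by rewrite mxE. Qed.

Let Llin x : linear (L x).
Proof. by move=> a u v; apply: rV2P; rewrite !(L0, L1, mxE); ring. Qed.

Let Lx x : {linear E -> E} :=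
  HB.pack (L x) (GRing.isLinear.Build R E E _ (L x) (Llin x)).

Let Lcont x : continuous (L x).
Proof.
suff H : Ck 0 setT (L x) by move=> y; apply: H.
apply: Ck_mx => [|i k]; first exact: openT.
have C j c : Ck 0 setT (fun h : E => h 0 j * c).
  apply: CkM (@Ck_cst _ _ _ _ _ _); first exact: openT.
  by apply: Ck_coord; [exact: openT|exact: Ck_id].
have oT := @openT E.
case: (I2P k) => ->.
  rewrite ord1; apply: (@eq_Ck _ _ _ _ _
    (fun h : E => h 0 0 * (dg 1 1 x / J x) + h 0 1 * (- dg 0 1 x / J x))) => //.
    by move=> h _; rewrite L0; ring.
  exact: CkD.
rewrite ord1; apply: (@eq_Ck _ _ _ _ _
    (fun h : E => h 0 1 * (dg 0 0 x / J x) + h 0 0 * (- dg 1 0 x / J x))) => //.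
  by move=> h _; rewrite L1; ring.
exact: CkD.
Qed.

Let g_coord i : smooth_on W (fun y => g y 0 i).
Proof. exact: smooth_coord. Qed.

Let dg_smooth i j : smooth_on W (dg i j).
Proof. exact: smooth_partial. Qed.

Let J_smooth : smooth_on W J.
Proof.
apply: smoothD => //; first exact: smoothM.
by apply: smoothN => //; apply: smoothM.
Qed.

(** Newton's map with frozen derivative: as [L q] is injective, g(x) = p is the fixed point equation
    x = k x + L q p, and k has zero derivative at q. *)
Let k x := x - L q (g x).

Let k_coord i : smooth_on W (fun x => k x 0 i).
Proof.
apply: smooth_coord => // n; apply: CkD => //; first exact: Ck_id.
apply: (@eq_Ck _ _ _ _ _ (fun x => L q (- g x))) => //.
  by move=> x _; exact: (linearN (Lx q)).
apply: (@Ck_lin _ _ _ _ _ _ (fun x => - g x) (L q)) => //.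
apply: (@Ck_lin _ _ _ _ _ _ g (fun x : E => - x)) => //.
  by move=> a u v; rewrite opprD scalerN.
by move=> x; apply: continuousN; apply: cvg_id.
Qed.

Let k_partial i j : partial j (fun x => k x 0 i) q = 0.
Proof.
have dgq : differentiable g q by apply: smooth_differentiable g_smooth Wq.
have dL x : differentiable (L q) x by exact: (@linear_differentiable _ _ _ (Lx q) x (@Lcont q)).
have dLg : differentiable (L q \o g) q by apply: differentiable_comp.
have dk : differentiable k q by apply: differentiableB.
rewrite /partial derive_coord//.
rewrite (_ : k = id - (L q \o g)) // deriveB; [|exact/diff_derivable..].
rewrite derive_id (@derive_comp _ _ _ _ g (L q))//.
rewrite [X in _ - X]deriveE// (@diff_lin _ _ _ (Lx q) _ (@Lcont q))/=.
have -> : L q ('D_(delta_mx 0 j) g q) = delta_mx 0 j; last by rewrite subrr mxE.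
have D a : ('D_(delta_mx 0 j) g q) 0 a = dg a j q by rewrite -derive_coord.
apply: rV2P; rewrite !(L0, L1, D) mxE /=.
  case: (I2P j) => ->; first by rewrite [X in _ - X]mulrC divff.
  by rewrite [X in _ - X]mulrC subrr mul0r.
case: (I2P j) => ->; first by rewrite [X in X - _]mulrC subrr mul0r.
by rewrite [X in X - _]mulrC divff.
Qed.

Let Linj x h : J x != 0 -> L x h = 0 -> h = 0.
Proof.
move=> Jx Lh.
have [E0 E1] : h 0 0 = L x h 0 0 * dg 0 0 x + L x h 0 1 * dg 0 1 x
    /\ h 0 1 = L x h 0 0 * dg 1 0 x + L x h 0 1 * dg 1 1 x.
  rewrite L0 L1; move: Jx; rewrite /J.
  by move: (dg 0 0 x) (dg 0 1 x) (dg 1 0 x) (dg 1 1 x) => *; split; field.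
by apply: rV2P; rewrite ?E0 ?E1 Lh mxE [(0 : E) 0 1]mxE !mul0r addr0.
Qed.

Let LK x y : W x -> J x != 0 -> L x ('d g x y) = y.
Proof.
move=> Wx Jx; have dgx : differentiable g x by apply: smooth_differentiable g_smooth Wx.
have D a : ('d g x y) 0 a = y 0 0 * dg a 0 x + y 0 1 * dg a 1 x.
  rewrite -deriveE// -derive_coord// derive_partial//.
  exact: smooth_differentiable (g_coord a) Wx.
move: Jx; rewrite /J => Jx.
apply: rV2P; rewrite ?(L0, L1) !D /J; move: Jx;
  by move: (dg 0 0 x) (dg 0 1 x) (dg 1 0 x) (dg 1 1 x) => *; field.
Qed.

Let contraction_radius : exists r : R, [/\ 0 < r,
  forall x, `|q - x| <= r -> W x /\ J x != 0 &
  forall x y, `|q - x| <= r -> `|q - y| <= r -> `|k x - k y| <= 2^-1 * `|x - y|].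
Proof.
(* Partial derivatives below 1/4 give, through the factor 2 of [scalar_lipschitz], the contraction
   factor 1/2. *)
have c0 : 0 < (4^-1 : R) by rewrite invr_gt0.
have nW : \forall x \near q, W x by exact: open_nbhs_nbhs.
have nJ : \forall x \near q, J x != 0.
  have cJ : {for q, continuous J} by have := J_smooth 0%N; apply.
  by apply: (cJ [set y | y != 0]); apply: open_nbhs_nbhs; split=> //; apply: open_neq.
have nk : \forall x \near q, forall ij : 'I_2 * 'I_2,
    `|partial ij.2 (fun x => k x 0 ij.1) x| < 4^-1.
  suff ck i j : \forall x \near q, `|partial j (fun x => k x 0 i) x| < 4^-1.
    apply: filterS (filterI (filterI (ck 0 0) (ck 0 1)) (filterI (ck 1 0) (ck 1 1))).
    move=> x [[H1 H2] [H3 H4]] [i j].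
    case: (I2P i) => ->; case: (I2P j) => ->;
      [exact: H1|exact: H2|exact: H3|exact: H4].
  have ck : {for q, continuous (partial j (fun x => k x 0 i))}.
    by have := smooth_partial j (k_coord i); move=> /(_ 0%N); apply.
  move/cvgrPdist_lt : ck => /(_ _ c0); apply: filterS => x.
  by rewrite k_partial sub0r normrN.
have /nbhs_ballP[r /= r0 Hr] : \forall x \near q, [/\ W x, J x != 0 &
    forall ij : 'I_2 * 'I_2, `|partial ij.2 (fun x => k x 0 ij.1) x| < 4^-1].
  by apply: filterS3 nW nJ nk => x; exact: And3.
have r2 : 0 < r / 2 by rewrite divr_gt0.
have Br x : `|q - x| <= r / 2 -> ball q r x.
  move=> qx; rewrite -ball_normE /ball_/=; apply: le_lt_trans qx _.
  by rewrite ltr_pdivrMr// ltr_pMr// ltr1n.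
exists (r / 2); split=> [//|x /Br/Hr[]//|x y qx qy].
rewrite rV2_norm_le; last by rewrite mulr_ge0// invr_ge0.
have H i : `|k x 0 i - k y 0 i| <= 2^-1 * `|x - y|.
  have -> : 2^-1 = 2 * 4^-1 :> R by field.
  apply: (@scalar_lipschitz (fun x => k x 0 i) q (r / 2) 4^-1) => //.
  - by move=> z /Br/Hr[Wz _ _]; apply: smooth_differentiable (k_coord i) Wz.
  - by move=> j z /Br/Hr[_ _ /(_ (i, j))]/ltW.
by rewrite [(k x - k y) 0 0]mxE [(k x - k y) 0 1]mxE ![(- k y) _ _]mxE !H.
Qed.

Theorem inverse_function : exists f : point_transformation R,
  [/\ pt_inv f = g, pt_dom f (g q), pt_fun f (g q) = q
    & forall p, pt_dom f p -> W (pt_fun f p)].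
Proof.
have [r [r0 Br kr]] := contraction_radius.
have [C C0 LC] := @linear_lipschitz _ _ _ (Lx q) (@Lcont q).
have kE x y : x - y = k x - k y + L q (g x - g y).
  by rewrite [L q (g x - g y)](linearB (Lx q)) /k /=; apply/rowP => j; rewrite !mxE; ring.
have r2 : 0 < r / 2 by rewrite divr_gt0.
(* Absorbing |k x - k y| <= |x - y| / 2 leaves a lower bound for the increments of g; it gives
   injectivity and makes the inverse Lipschitz. *)
have uniq x y : `|q - x| <= r -> `|q - y| <= r -> `|x - y| <= 2 * `|L q (g x - g y)|.
  move=> qx qy; have := kr _ _ qx qy; have := ler_normD (k x - k y) (L q (g x - g y)).
  by rewrite -kE; lra.
(* For p in D the map x -> k x + L q p sends the closed ball of radius r into itself: the
   contraction accounts for r/2, the distance from p to g(q) for less than r/2. *)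
pose D := L q @^-1` ball (L q (g q)) (r / 2).
have oD : open D.
  have /continuousP := @Lcont q; apply; exact: ball_open.
pose f p := xget q [set x | `|q - x| <= r /\ g x = p].
have fP p : D p -> `|q - f p| < r /\ g (f p) = p.
  rewrite /D /= -ball_normE /ball_/= => Dp.
  have qq : `|q - q| <= r by rewrite subrr normr0 ltW.
  have [|x|x y qx qy|x qx xT] := @ball_fixed_point q r (fun x => k x + L q p).
  - exact: ltW.
  - move=> qx; have -> : q - (k x + L q p) = (k q - k x) + (L q (g q) - L q p).
      by rewrite /k; apply/rowP => j; rewrite !mxE; ring.
    apply: le_trans (ler_normD _ _) _; have := kr _ _ qq qx.
    by move: Dp; move: (`|q - x|) qx (`|L q (g q) - L q p|) (`|k q - k x|) => *; lra.
  - by rewrite opprD addrACA subrr addr0; apply: kr.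
  have [qf gf] : `|q - f p| <= r /\ g (f p) = p.
    apply: (@xgetPex _ q [set x | `|q - x| <= r /\ g x = p]); exists x; split=> //.
    have [Wx Jx] := Br _ qx; apply/subr0_eq; apply: (Linj J0).
    rewrite [LHS](linearB (Lx q)) /=; apply/eqP; rewrite subr_eq0.
    by apply/eqP; apply: (addrI (x - L q (g x))); rewrite subrK; exact: xT.
  split=> //; have := uniq _ _ qq qf; rewrite gf [L q _](linearB (Lx q)) /=.
  by move: Dp; lra.
have fW p : D p -> W (f p) /\ J (f p) != 0 by case/fP => /ltW/Br.
have fK x : `|q - x| <= r -> D (g x) -> f (g x) = x.
  move=> qx Dgx; have [/ltW qf gf] := fP _ Dgx.
  have := uniq _ _ qf qx; rewrite gf subrr [L q 0](linear0 (Lx q)) normr0 mulr0.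
  by rewrite normr_le0 subr_eq0 => /eqP.
have fL p p' : D p -> D p' -> `|f p - f p'| <= 2 * C * `|p - p'|.
  move=> /fP[/ltW qf gf] /fP[/ltW qf' gf'].
  apply: le_trans (uniq _ _ qf qf') _; rewrite gf gf' -mulrA ler_wpM2l//; exact: LC.
have fd p : D p -> differentiable f p /\ 'd f p = Lx (f p) :> (E -> E).
  move=> Dp; have [_ gf] := fP _ Dp; have [Wx Jx] := fW _ Dp.
  apply: diff_of_bound => [|e e0]; first exact: (@Lcont (f p)).
  have [C' C'0 LC'] := @linear_lipschitz _ _ _ (Lx (f p)) (@Lcont (f p)).
  have dgx := smooth_differentiable g_smooth Wx.
  have [_ /eqaddoP] := (diff_locallyP (f p) g).1 dgx.
  have CC : 0 < 2 * C by rewrite mulr_gt0.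
  (* C' bounds [L (f p)] and 2C is the Lipschitz constant of f, so the linearization error of g at y
     = f(h + p) - f(p) costs at most e |h|. *)
  have e'0 : 0 < e / (C' * (2 * C)) by rewrite divr_gt0// mulr_gt0.
  move=> /(_ _ e'0) /nbhs_ballP[d /= d0 Hd].
  have nD : \forall h \near (0 : E), D (h + p).
    have : \forall x \near p, D x by apply: open_nbhs_nbhs.
    by rewrite (near_shift 0 p)/=; apply: filterS => h; rewrite /= subr0.
  have nd : \forall h \near (0 : E), `|h| < d / (2 * C).
    by apply: nbhs0_lt; rewrite divr_gt0.
  apply: filterS2 nD nd => h Dh hd /=.
  have [_ gfh] := fP _ Dh.
  pose y := f (h + p) - f p.
  have yh : `|y| <= 2 * C * `|h|.
    by have := fL _ _ Dh Dp; rewrite addrK.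
  have yd : ball 0 d y.
    rewrite -ball_normE /ball_/= sub0r normrN; apply: le_lt_trans yh _.
    by rewrite mulrC -ltr_pdivlMr.
  have := Hd _ yd; rewrite /= !fctE /= /y subrK gfh gf => Hy.
  have EL : L (f p) (h - 'd g (f p) y) = L (f p) h - y.
    by rewrite [LHS](linearB (Lx (f p))) /= (LK _ Wx Jx).
  have -> : f (h + p) - f p - L (f p) h = - L (f p) (h - 'd g (f p) y).
    by rewrite EL opprB.
  rewrite normrN; apply: le_trans (LC' _) _.
  have -> : h - 'd g (f p) y = h + p - (p + 'd g (f p) y).
    by rewrite opprD addrA addrK.
  apply: le_trans (ler_wpM2l (ltW C'0) Hy) _.
  apply: le_trans (ler_wpM2l (ltW C'0) (ler_wpM2l (ltW e'0) yh)) _.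
  have -> : C' * (e / (C' * (2 * C)) * (2 * C * `|h|)) = e * `|h|.
    by field; rewrite !gt_eqF.
  exact: lexx.
have oB : open [set x : E | `|q - x| < r] by have := @ball_open _ E q r; rewrite -ball_normE.
(* Bootstrapping: the differential of f at p is [L (f p)], a smooth function of f(p), so class C^n
   of f implies class C^(n+1). *)
have f_smooth : smooth_on D f.
  elim=> [|n IH].
    by move=> p Dp; apply: differentiable_continuous; apply: (fd p Dp).1.
  apply/CkS; split=> [p /fd[]//|v].
  apply: (@eq_Ck _ _ _ _ _ (fun p => L (f p) v)) => // [p Dp|].
    by have [df dE] := fd p Dp; rewrite deriveE// dE.
  apply: Ck_mx => // i j; rewrite ord1.
  have fB p : D p -> `|q - f p| < r by case/fP.
  have JB x : `|q - x| < r -> J x != 0 by case/ltW/Br.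
  have BW : [set x | `|q - x| < r] `<=` W by move=> x /ltW/Br[].
  have dB a b := smooth_sub BW (@dg_smooth a b).
  apply: (@Ck_comp R n _ _ D [set x | `|q - x| < r] f (fun x => L x v 0 j)) => //.
  move: n {IH}; change (smooth_on [set x | `|q - x| < r] (fun x => L x v 0 j)).
  have cM c a b : smooth_on [set x | `|q - x| < r] (fun x => c * dg a b x).
    by apply: smoothM => //; apply: smooth_cst.
  have JV : smooth_on [set x | `|q - x| < r] (fun x => (J x)^-1).
    by apply: smoothV => //; apply: smooth_sub BW _.
  case: (I2P j) => ->.
    apply: (@eq_smooth _ _ _ _
      (fun x => (v 0 0 * dg 1 1 x + - (v 0 1 * dg 0 1 x)) * (J x)^-1)) => //.
    by apply: smoothM => //; apply: smoothD => //; apply: smoothN.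
  apply: (@eq_smooth _ _ _ _
    (fun x => (v 0 1 * dg 0 0 x + - (v 0 0 * dg 1 0 x)) * (J x)^-1)) => //.
  by apply: smoothM => //; apply: smoothD => //; apply: smoothN.
have imf : f @` D = [set x | `|q - x| < r /\ D (g x)].
  apply/seteqP; split=> [_ [p Dp <-]|x [qx Dgx]].
    by have [qf gf] := fP _ Dp; split; rewrite ?gf.
  by exists (g x) => //; apply: fK => //; apply: ltW.
have oI : open (f @` D).
  rewrite imf openE => x [qx Dgx]; apply: filterI; first exact: open_nbhs_nbhs.
  have [Wx _] := Br _ (ltW qx).
  have cg : {for x, continuous g}.
    by apply: differentiable_continuous; apply: smooth_differentiable g_smooth Wx.
  by apply: cg; apply: open_nbhs_nbhs.
have g_im : smooth_on (f @` D) g.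
  by apply: smooth_sub g_smooth => _ [p Dp <-]; case: (fW p Dp).
have fgK p : D p -> g (f p) = p by case/fP.
have Dgq : D (g q) by rewrite /D /=; apply: ballxx.
exists (PointTransformation oD oI fgK f_smooth g_im); split=> //=.
  by apply: fK => //; rewrite subrr normr0 ltW.
by move=> p /fW[].
Qed.

End InverseFunction.

(** * Jets and Taylor polynomials *)

Section Jets.
Variable R : realType.
Local Notation E := 'rV[R]_2.

Lemma mem_midx k s : (s \in midx k) = (s.1 + s.2 <= k)%N.
Proof.
apply/allpairsPdep/idP => [[n [b [Hn Hb ->]]]|Hs].
  by move: Hn Hb; rewrite !mem_iota !add0n !ltnS /= => nk bn; rewrite subnK.
exists (s.1 + s.2)%N, s.2; rewrite !mem_iota !add0n !ltnS Hs leq_addl; split=> //.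
by rewrite addnK; case: s {Hs}.
Qed.

Lemma midx_uniq k : uniq (midx k).
Proof.
apply: allpairs_uniq_dep => [|n _|]; try exact: iota_uniq.
move=> _ _ /allpairsPdep[n [b [_ Hb ->]]] /allpairsPdep[n' [b' [_ Hb' ->]]] /=.
move: Hb Hb'; rewrite !mem_iota !add0n !ltnS /= => bn bn' [E1 E2].
have En : n = n' by rewrite -(subnK bn) -(subnK bn') E1 E2.
by rewrite En E2.
Qed.

Lemma jcoordE k (M : 'M[R]_(4, size (midx k))) (p : E) i s
    (h : (index s (midx k) < size (midx k))%N) :
  jcoord ((p, M) : jet R k) i s = M i (Ordinal h).
Proof.
rewrite /jcoord; case: insubP => [m _ Em|/negP[]//].
by congr (M i _); apply/val_inj.
Qed.

Lemma jcoord_out k (theta : jet R k) i s : (s.1 + s.2 <= k)%N = false ->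
  jcoord theta i s = 0.
Proof.
move=> Hs; rewrite /jcoord; case: insubP => [m|//].
by rewrite index_mem mem_midx Hs.
Qed.

Lemma jcoord_matrix k (p : E) (c : 'I_4 -> nat * nat -> R) i s :
  (s.1 + s.2 <= k)%N ->
  jcoord ((p, \matrix_(i < 4, m < size (midx k)) c i (nth (0, 0)%N (midx k) m)) : jet R k) i s
  = c i s.
Proof.
move=> Hs; have h : (index s (midx k) < size (midx k))%N by rewrite index_mem mem_midx.
by rewrite jcoordE mxE nth_index// mem_midx.
Qed.

Lemma jet_eqP k (t t' : jet R k) : t.1 = t'.1 ->
  (forall i s, (s.1 + s.2 <= k)%N -> jcoord t i s = jcoord t' i s) -> t = t'.
Proof.
case: t t' => p M [p' M'] /= <- H; congr (_, _); apply/matrixP => i m.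
set s := nth (0, 0)%N (midx k) m.
have Hs : s \in midx k by apply: mem_nth.
have h : (index s (midx k) < size (midx k))%N by rewrite index_mem.
have Em : m = Ordinal h
  by apply: val_inj; apply: esym; apply: index_uniq; [exact: ltn_ord|exact: midx_uniq].
by have := H i s; rewrite -mem_midx !jcoordE -Em; apply.
Qed.

Lemma jcoord_jet_of k (S : E -> total_space R) p i s : (s.1 + s.2 <= k)%N ->
  jcoord (jet_of k S p) i s = partials s (fun q => (S q).2 0 i) p.
Proof. exact: (@jcoord_matrix k p (fun i s => partials s (fun q => (S q).2 0 i) p)). Qed.

(** Divided powers: differentiation lowers the exponent without a factor, so Taylor coefficients are
    the derivatives themselves. *)
Definition dpow (p : E) j n (x : E) : R := (x 0 j - p 0 j) ^+ n / n`!%:R.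

Lemma smooth_dpow p j n : smooth_on setT (dpow p j n).
Proof.
have oT := @openT E.
apply: smoothM => //; last exact: smooth_cst.
apply: smoothX => //; apply: smoothD => //; last exact: smooth_cst.
by apply: smooth_coord => // m; apply: Ck_id.
Qed.

Lemma partial_dpow p i j n x :
  partial i (dpow p j n) x = if n is m.+1 then (i == j)%:R * dpow p j m x else 0.
Proof.
have oT := @openT E.
have Sc : smooth_on setT (fun x : E => x 0 j) by apply: smooth_coord => // m; apply: Ck_id.
have Sp : smooth_on setT (fun x : E => x 0 j + - p 0 j).
  by apply: smoothD => //; apply: smooth_cst.
case: n => [|n].
  by rewrite (_ : dpow p j 0 = fun=> 1) ?partial_cst//;
    apply/funext => y; rewrite /dpow expr0 divr1.
have Sn m := smoothX oT Sp m.
have D1 y : partial i (fun x : E => x 0 j + - p 0 j) y = (i == j)%:R.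
  rewrite (partialD _ Sc (@smooth_cst _ _ _ (- p 0 j)))// partial_cst addr0.
  rewrite [LHS](@derive_coord R _ _ _ (fun x : E => x))// derive_id mxE eqxx /=.
  by rewrite eq_sym.
have Dn m y : partial i (fun x : E => (x 0 j - p 0 j) ^+ m.+1) y =
    (i == j)%:R * (m.+1%:R * (y 0 j - p 0 j) ^+ m).
  elim: m => [|m IH].
    by rewrite expr0 !mulr1; exact: D1.
  rewrite (_ : (fun _ => _) = fun x : E => (x 0 j + - p 0 j) * (x 0 j - p 0 j) ^+ m.+1); last first.
    by apply/funext => z; rewrite [LHS]exprS.
  rewrite (partialM _ Sp (Sn m.+1))// D1 IH -[m.+2%:R]natr1 exprS; ring.
rewrite (partialM _ (Sn n.+1) (@smooth_cst _ _ _ (n.+1`!%:R^-1)))// partial_cst mulr0 addr0 Dn.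
rewrite /dpow factS natrM; field.
by rewrite pnatr_eq0 -lt0n fact_gt0 addrC natr1 pnatr_eq0.
Qed.

Definition mono (p : E) (s : nat * nat) (x : E) : R := dpow p 0 s.1 x * dpow p 1 s.2 x.

Lemma smooth_mono p s : smooth_on setT (mono p s).
Proof. by apply: smoothM; [exact: openT|exact: smooth_dpow|exact: smooth_dpow]. Qed.

Lemma partial0_mono p a b : partial 0 (mono p (a, b)) =
  if a is a'.+1 then mono p (a', b) else fun=> 0.
Proof.
apply/funext => x; rewrite (partialM _ (@smooth_dpow p 0 a) (@smooth_dpow p 1 b))//.
rewrite !partial_dpow; case: a => [|a]; case: b => [|b] /=;
by rewrite ?mul0r ?mulr0 ?mul1r ?addr0 ?add0r.
Qed.

Lemma partial1_mono p a b : partial 1 (mono p (a, b)) =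
  if b is b'.+1 then mono p (a, b') else fun=> 0.
Proof.
apply/funext => x; rewrite (partialM _ (@smooth_dpow p 0 a) (@smooth_dpow p 1 b))//.
rewrite !partial_dpow; case: a => [|a]; case: b => [|b] /=;
by rewrite ?mul0r ?mulr0 ?mul1r ?addr0 ?add0r.
Qed.

Lemma partials_zero s : partials s (fun=> 0 : R) = (fun=> 0) :> (E -> R).
Proof.
case: s => a b; rewrite /partials /=.
have Z j : partial j (fun=> 0 : R) = (fun=> 0) :> (E -> R).
  by apply/funext => x; apply: partial_cst.
have -> : iter b (partial 1) (fun=> 0 : R) = (fun=> 0) :> (E -> R).
  by elim: b => //= b ->; rewrite Z.
by elim: a => //= a ->; rewrite Z.
Qed.

Lemma partials_mono p a b c d : partials (a, b) (mono p (c, d)) =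
  if (a <= c)%N && (b <= d)%N then mono p (c - a, d - b)%N else fun=> 0.
Proof.
have Z j : partial j (fun=> 0 : R) = (fun=> 0) :> (E -> R).
  by apply/funext => x; apply: partial_cst.
rewrite /partials /=.
have -> : iter b (partial 1) (mono p (c, d)) =
    if (b <= d)%N then mono p (c, d - b)%N else fun=> 0.
  elim: b => [|b IH] /=; first by rewrite subn0.
  rewrite IH; case: (ltngtP b d) => [bd|bd|->]; last first.
  - by rewrite subnn partial1_mono.
  - exact: Z.
  - by rewrite partial1_mono -(subnSK bd).
case: (b <= d)%N; last first.
  by rewrite andbF; elim: a => //= a ->; apply: Z.
rewrite andbT; elim: a => [|a IH] /=; first by rewrite subn0.
rewrite IH; case: (ltngtP a c) => [ac|ac|->]; last first.
- by rewrite subnn partial0_mono.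
- exact: Z.
- by rewrite partial0_mono -(subnSK ac).
Qed.

Lemma mono_center p s : mono p s p = (s == (0, 0)%N)%:R.
Proof.
case: s => [[|a] [|b]]; rewrite /mono /dpow /= !subrr ?expr0 ?exprS;
by rewrite ?(mul0r, mulr0, divr1, mulr1).
Qed.

Lemma partials_mono_center p s t : partials s (mono p t) p = (t == s)%:R.
Proof.
case: s t => a b [c d]; rewrite partials_mono; case: ifP => [/andP[ac bd]|H].
  rewrite mono_center !xpair_eqE; congr ((_ && _)%:R).
    by rewrite subn_eq0 eqn_leq ac andbT.
  by rewrite subn_eq0 eqn_leq bd andbT.
case: eqP => [[Ea Eb]|//]; by rewrite Ea Eb !leqnn in H.
Qed.

Definition taylor (p : E) k (c : nat * nat -> R) (x : E) : R :=
  \sum_(s <- midx k) c s * mono p s x.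

Lemma smooth_taylor p k c : smooth_on setT (taylor p k c).
Proof.
move=> n; have oT := @openT E; apply: Ck_sum => // s _.
by apply: CkM => //; [apply: Ck_cst|apply: smooth_mono].
Qed.

Lemma partials_sum (r : seq (nat * nat)) (c : nat * nat -> R) p s x :
  partials s (fun x => \sum_(t <- r) c t * mono p t x) x =
  \sum_(t <- r) c t * partials s (mono p t) x.
Proof.
have oT := @openT E; case: s => a b.
have Sr r' : smooth_on setT (fun x => \sum_(t <- r') c t * mono p t x).
  move=> n; apply: Ck_sum => // t _.
  by apply: CkM => //; [apply: Ck_cst|apply: smooth_mono].
have Sm t : smooth_on setT (fun x => c t * mono p t x).
  by apply: smoothM => //; [exact: smooth_cst|exact: smooth_mono].
have addP (f g : E -> R) : smooth_on setT f -> smooth_on setT g ->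
    partials (a, b) (fun x => f x + g x) = (fun x => partials (a, b) f x + partials (a, b) g x).
  move=> Sf Sg; apply/funext => y; rewrite /partials /=.
  have Eb z : iter b (partial 1) (fun x => f x + g x) z =
      iter b (partial 1) f z + iter b (partial 1) g z.
    elim: b z => //= b IH z; rewrite (eq_partial _ oT (fun z _ => IH z))//.
    by apply: partialD (smooth_partials (0, b)%N Sf) (smooth_partials (0, b)%N Sg) _.
  elim: a y => [|a IH] y //=; rewrite (eq_partial _ oT (fun z _ => IH z))//.
  by apply: partialD (smooth_partials (a, b)%N Sf) (smooth_partials (a, b)%N Sg) _.
have mulP t : partials (a, b) (fun x => c t * mono p t x) =
    (fun x => c t * partials (a, b) (mono p t) x).
  clear addP; apply/funext => y; rewrite /partials /=.
  have Eb z : iter b (partial 1) (fun x => c t * mono p t x) z =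
      c t * iter b (partial 1) (mono p t) z.
    elim: b z => //= b IH z; rewrite (eq_partial _ oT (fun z _ => IH z))//.
    rewrite (partialM _ (@smooth_cst _ _ setT (c t))
      (smooth_partials (0, b)%N (@smooth_mono p t)))//.
    by rewrite partial_cst mul0r add0r.
  elim: a y => [|a IH] y //=; rewrite (eq_partial _ oT (fun z _ => IH z))//.
  rewrite (partialM _ (@smooth_cst _ _ setT (c t)) (smooth_partials (a, b)%N (@smooth_mono p t)))//.
  by rewrite partial_cst mul0r add0r.
elim: r => [|t r IH].
  by rewrite big_nil (_ : (fun _ => _) = fun=> 0) ?partials_zero//;
    apply/funext => y; rewrite big_nil.
rewrite big_cons -IH (_ : (fun x => \sum_(t <- t :: r) _) =
    (fun x => c t * mono p t x + \sum_(t <- r) c t * mono p t x)).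
  by rewrite addP// mulP.
by apply/funext => y; rewrite big_cons.
Qed.

Lemma partials_taylor p k c s :
  partials s (taylor p k c) p = if (s.1 + s.2 <= k)%N then c s else 0.
Proof.
rewrite [LHS]partials_sum -mem_midx; under eq_bigr do rewrite partials_mono_center.
case: ifP => Hs.
  rewrite (bigD1_seq s Hs (midx_uniq k)) /= eqxx mulr1 [X in _ + X]big1 ?addr0// => t /negPf ->.
  by rewrite mulr0.
rewrite big_seq big1// => t Ht; case: eqP => [Et|]; last by rewrite mulr0.
by rewrite -Et Ht in Hs.
Qed.

(** A polynomial representative on the whole plane: every jet comes from a global section, whose
    derivatives beyond order k vanish at the base point. *)
Definition taylor_section k (theta : jet R k) (x : E) : total_space R :=
  (x, \row_(i < 4) taylor theta.1 k (fun s => jcoord theta i s) x).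

Lemma taylor_local_section k (theta : jet R k) : local_section setT (taylor_section theta).
Proof.
have oT := @openT E.
split=> // n; apply: Ck_pair => //; first exact: Ck_id.
apply: Ck_mx => // i j.
apply: (@eq_Ck _ _ _ _ _ (taylor theta.1 k (fun s => jcoord theta j s))) => //.
  by move=> x _; rewrite mxE.
exact: smooth_taylor.
Qed.

Lemma partials_taylor_section k (theta : jet R k) i s :
  partials s (fun q => (taylor_section theta q).2 0 i) theta.1 = jcoord theta i s.
Proof.
rewrite (_ : (fun q => _) = taylor theta.1 k (fun s => jcoord theta i s)).
  by rewrite partials_taylor; case: ifP => // /jcoord_out ->.
by apply/funext => x; rewrite mxE.
Qed.

Lemma jet_of_taylor_section k (theta : jet R k) :
  jet_of k (taylor_section theta) theta.1 = theta.
Proof.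
apply: jet_eqP => // i s Hs.
by rewrite jcoord_jet_of// partials_taylor_section.
Qed.

End Jets.

(** * The lift of a point transformation *)

(* With g = f^-1 and i a boolean, [Gv i a b] stands for the (a, b) derivative of g^1
   (i = false) or g^2 (i = true), [Rv] for 1/J.  [Uv i a b], i < 4, stands for
   u^(i+1)_(a,b) taken at the point g(x), and [Uv 4], [Uv 5] for F1, F2 and their
   derivatives. *)
Inductive lvar := Gv of bool & nat & nat | Uv of nat & nat & nat | Rv.

Declare Scope term_scope.
Delimit Scope term_scope with tm.
Local Notation "x + y" := (Add x y) : term_scope.
Local Notation "x - y" := (Add x (Opp y)) : term_scope.
Local Notation "x * y" := (Mul x y) : term_scope.
Local Notation "- x" := (Opp x) : term_scope.
Local Notation gT i a b := (Var (Gv i a b)).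
Local Notation uT i a b := (Var (Uv i a b)).
Local Notation rT := (Var Rv).
Local Notation twoT := (Nat 2).
Local Notation threeT := (Nat 3).

Definition jacT : term lvar :=
  (gT false 1 0 * gT true 0 1 - gT false 0 1 * gT true 1 0)%tm.

(** Kept apart from [dvar] so that the derivative of 1/J can be written there without recursion:
    [jacT] involves only derivatives of g. *)
Definition dgvar (j : bool) (v : lvar) : term lvar :=
  if v is Gv i a b then (if j then gT i a b.+1 else gT i a.+1 b) else Var v.

Definition dvar (j : bool) (v : lvar) : term lvar :=
  match v with
  | Gv i a b => dgvar j v
  | Uv i a b => if j then (gT false 0 1 * uT i a.+1 b + gT true 0 1 * uT i a b.+1)%tm
                else (gT false 1 0 * uT i a.+1 b + gT true 1 0 * uT i a b.+1)%tm
  | Rv => (- (rT * rT * tder (dgvar j) jacT))%tm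
  end.

(** Rows 0 to 3 are the coefficients of the cubic in t that defines the lift; rows 4 and 5 are the
    expected law of F1 and F2, established in [liouville_law]. *)
Definition liftT (i : nat) : term lvar :=
  (let a0 := gT false 1 0 in let a1 := gT false 0 1 in
  let b0 := gT true 1 0 in let b1 := gT true 0 1 in
  let A0 := gT false 2 0 in let A1 := gT false 1 1 in let A2 := gT false 0 2 in
  let B0 := gT true 2 0 in let B1 := gT true 1 1 in let B2 := gT true 0 2 in
  match i with
  | 0%N => rT * (uT 0 0 0 * (a0 * a0 * a0) + uT 1 0 0 * (b0 * a0 * a0) + uT 2 0 0 * (b0 * b0 * a0)
      + uT 3 0 0 * (b0 * b0 * b0) - a0 * B0 + b0 * A0)
  | 1%N => rT * (uT 0 0 0 * (threeT * a0 * a0 * a1)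
      + uT 1 0 0 * (b1 * a0 * a0 + twoT * b0 * a0 * a1)
      + uT 2 0 0 * (twoT * b0 * b1 * a0 + b0 * b0 * a1) + uT 3 0 0 * (threeT * b0 * b0 * b1)
      - (a1 * B0 + twoT * a0 * B1) + (b1 * A0 + twoT * b0 * A1))
  | 2%N => rT * (uT 0 0 0 * (threeT * a0 * a1 * a1)
      + uT 1 0 0 * (b0 * a1 * a1 + twoT * b1 * a0 * a1)
      + uT 2 0 0 * (twoT * b0 * b1 * a1 + b1 * b1 * a0) + uT 3 0 0 * (threeT * b0 * b1 * b1)
      - (a0 * B2 + twoT * a1 * B1) + (b0 * A2 + twoT * b1 * A1))
  | 3%N => rT * (uT 0 0 0 * (a1 * a1 * a1) + uT 1 0 0 * (b1 * a1 * a1) + uT 2 0 0 * (b1 * b1 * a1)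
      + uT 3 0 0 * (b1 * b1 * b1) - a1 * B2 + b1 * A2)
  | 4%N => jacT * (a0 * uT 4 0 0 + b0 * uT 5 0 0)
  | _ => jacT * (a1 * uT 4 0 0 + b1 * uT 5 0 0)
  end)%tm.

(** * The transformation law of F1 and F2 *)

Section Liouville.
Variables (S : comPzRingType) (c : nat -> nat -> nat -> S).

(** Liouville's relative invariants, whose common vanishing characterizes the equations linearizable
    by point transformations. They are written over an arbitrary table of derivatives so as to serve
    for jets, sections and terms alike. *)
Definition liouville1 : S :=
  3 * c 0 0 2 - 2 * c 1 1 1 + c 2 2 0
  + 3 * c 3 0 0 * c 0 1 0 - 3 * c 2 0 0 * c 0 0 1
  + 2 * c 1 0 0 * c 1 0 1 - c 1 0 0 * c 2 1 0
  - 3 * c 0 0 0 * c 2 0 1 + 6 * c 0 0 0 * c 3 1 0.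

Definition liouville2 : S :=
  c 1 0 2 - 2 * c 2 1 1 + 3 * c 3 2 0
  - 3 * c 0 0 0 * c 3 0 1 + 3 * c 1 0 0 * c 3 1 0
  - 2 * c 2 0 0 * c 2 1 0 + c 2 0 0 * c 1 0 1
  + 3 * c 3 0 0 * c 1 1 0 - 6 * c 3 0 0 * c 0 0 1.

End Liouville.

(** Two derivatives of the lift bring in derivatives of g up to order 4; all those of order above 1
    cancel. With the variables independent this is an identity of rational functions whose only
    denominators are powers of J. *)
Lemma liouville_law (S : fieldType) (e : lvar -> S) :
  eval e jacT != 0 -> e Rv = (eval e jacT)^-1 ->
  e (Uv 4 0 0) = liouville1 (fun i a b => e (Uv i a b)) ->
  e (Uv 5 0 0) = liouville2 (fun i a b => e (Uv i a b)) ->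
  liouville1 (fun i a b => eval e (tders dvar (a, b) (liftT i))) = eval e (liftT 4) /\
  liouville2 (fun i a b => eval e (tders dvar (a, b) (liftT i))) = eval e (liftT 5).
Proof.
move=> J0 rho E4 E5; rewrite /liouville1 /liouville2 /tders /= E4 E5 /liouville1 /liouville2.
move: J0; rewrite rho /=.
move: (e (Gv false 1 0)) (e (Gv false 0 1)) (e (Gv true 1 0)) (e (Gv true 0 1)) => a b c d J0.
by split; field.
Qed.

(** * The lift and its derivatives as values of terms *)

Section LiftCoef.
Variable R : realType.
Local Notation E := 'rV[R]_2.

Lemma cubic_expansion (a0 a1 b0 b1 A0 A1 A2 B0 B1 B2 r u0 u1 u2 u3 : R) :
  let A : {poly R} := a0%:P + a1 *: 'X in
  let B : {poly R} := b0%:P + b1 *: 'X in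
  r *: (u0 *: (B ^+ 0 * A ^+ (3 - 0)) + (u1 *: (B ^+ 1 * A ^+ (3 - 1)) +
       (u2 *: (B ^+ 2 * A ^+ (3 - 2)) + (u3 *: (B ^+ 3 * A ^+ (3 - 3)) + 0)))
     - A * (B0%:P + (2 * B1) *: 'X + B2 *: 'X^2)
     + B * (A0%:P + (2 * A1) *: 'X + A2 *: 'X^2)) =
  (r * (u0 * (a0 * a0 * a0) + u1 * (b0 * a0 * a0) + u2 * (b0 * b0 * a0)
      + u3 * (b0 * b0 * b0) - a0 * B0 + b0 * A0))%:P +
  (r * (u0 * (3 * a0 * a0 * a1) + u1 * (b1 * a0 * a0 + 2 * b0 * a0 * a1)
      + u2 * (2 * b0 * b1 * a0 + b0 * b0 * a1) + u3 * (3 * b0 * b0 * b1)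
      - (a1 * B0 + 2 * a0 * B1) + (b1 * A0 + 2 * b0 * A1)))%:P * 'X +
  (r * (u0 * (3 * a0 * a1 * a1) + u1 * (b0 * a1 * a1 + 2 * b1 * a0 * a1)
      + u2 * (2 * b0 * b1 * a1 + b1 * b1 * a0) + u3 * (3 * b0 * b1 * b1)
      - (a0 * B2 + 2 * a1 * B1) + (b0 * A2 + 2 * b1 * A1)))%:P * 'X^2 +
  (r * (u0 * (a1 * a1 * a1) + u1 * (b1 * a1 * a1) + u2 * (b1 * b1 * a1)
      + u3 * (b1 * b1 * b1) - a1 * B2 + b1 * A2))%:P * 'X^3.
Proof. by rewrite /= -!mul_polyC; ring. Qed.

Lemma lift_coefE (g : E -> E) q (u : 'rV[R]_4) (e : lvar -> R) i :
  (forall i a b, (0 < a + b <= 2)%N ->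
     e (Gv i a b) = partials (a, b) (fun x => g x 0 (ix i)) q) ->
  (forall i, (i < 4)%N -> e (Uv i 0 0) = u 0 (inord i)) ->
  e Rv = (eval e jacT)^-1 -> (i < 4)%N ->
  lift_coef g q u 0 (inord i) = eval e (liftT i).
Proof.
move=> eG eU eR i4; rewrite /lift_coef !mxE inordK//.
rewrite !big_ord_recl big_ord0.
have E0 : @ord0 3 = inord 0 by apply/val_inj; rewrite /= inordK.
have E1 : lift (@ord0 3) ord0 = inord 1 by apply/val_inj; rewrite /= inordK.
have E2 : lift (@ord0 3) (lift ord0 ord0) = inord 2 by apply/val_inj; rewrite /= inordK.
have E3 : lift (@ord0 3) (lift ord0 (lift ord0 ord0)) = inord 3 by apply/val_inj; rewrite /= inordK.
rewrite E1 E2 E3 E0 !inordK// -!eU//.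
rewrite -(eG false 1 0)%N// -(eG false 0 1)%N// -(eG true 1 0)%N// -(eG true 0 1)%N//.
rewrite -(eG false 2 0)%N// -(eG false 1 1)%N// -(eG true 2 0)%N// -(eG true 1 1)%N//.
rewrite -(eG false 0 2)%N// -(eG true 0 2)%N//.
have -> : e (Gv false 1 0) * e (Gv true 0 1) - e (Gv false 0 1) * e (Gv true 1 0) =
  eval e jacT by [].
rewrite -eR.
rewrite cubic_expansion !coefD !coefCM coefX !coefXn coefC.
by move: i i4 => [|[|[|[|//]]]] _ /=; ring.
Qed.

(** The family v is a parameter: it is the fields of a section when a lift is differentiated, and
    the components of a second map when two changes of variables are composed. *)
Definition penv (g : E -> E) (v : nat -> E -> R) (x : E) (l : lvar) : R :=
  match l with
  | Gv i a b => partials (a, b) (fun y => g y 0 (ix i)) x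
  | Uv i a b => partials (a, b) (v i) (g x)
  | Rv => (partials (1, 0)%N (fun y => g y 0 0) x * partials (0, 1)%N (fun y => g y 0 1) x
         - partials (0, 1)%N (fun y => g y 0 0) x * partials (1, 0)%N (fun y => g y 0 1) x)^-1
  end.

Lemma penv_Rv g v x : penv g v x Rv = (eval (penv g v x) jacT)^-1.
Proof. by []. Qed.

Section Pullback.
Variables (g : E -> E) (v : nat -> E -> R) (W V : set E).
Hypotheses (oW : open W) (oV : open V) (g_smooth : smooth_on W g).
Hypothesis (v_smooth : forall i, smooth_on V (v i)).
Hypothesis gWV : forall x, W x -> V (g x).
Hypothesis J0 : forall x, W x -> eval (penv g v x) jacT != 0.

Lemma smooth_penv l : smooth_on W (fun x => penv g v x l).
Proof.
have Sg i s : smooth_on W (partials s (fun y => g y 0 i)).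
  by apply: smooth_partials; apply: smooth_coord.
case: l => [i a b|i a b|] /=; first exact: Sg.
  by apply: (smooth_comp oW gWV g_smooth); apply: smooth_partials.
apply: smoothV => //; apply: smoothD => //; first by apply: smoothM.
by apply: smoothN => //; apply: smoothM.
Qed.

Lemma partial_penv j l x : W x ->
  partial (ix j) (fun x => penv g v x l) x = eval (penv g v x) (dvar j l).
Proof.
move=> Wx.
have Sg i : smooth_on W (fun y => g y 0 i) by apply: smooth_coord.
have Sp i s : smooth_on W (partials s (fun y => g y 0 i)) by apply: smooth_partials.
have Dp i a b : partial (ix j) (partials (a, b) (fun y => g y 0 (ix i))) x =
    eval (penv g v x) (dgvar j (Gv i a b)).
  by case: j => //=; rewrite -(partialsS1 a b oW (Sg (ix i)) Wx).
case: l => [i a b|i a b|]; first exact: Dp.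
  rewrite [LHS](partial_comp (ix j) g_smooth (smooth_partials (a, b) (v_smooth i)) Wx (gWV Wx)).
  have := Dp false 0%N 0%N; have := Dp true 0%N 0%N; rewrite [partials (0, 0)%N _]/=.
  rewrite [partials (0, 0)%N (fun y : E => g y 0 (ix false))]/= => -> ->.
  by rewrite -(partialsS1 a b oV (v_smooth i) (gWV Wx)) -partialsS0; case: j {Dp}.
have J0' := J0 Wx.
have SM i s k t : smooth_on W
    (fun x => partials s (fun y => g y 0 i) x * partials t (fun y => g y 0 k) x).
  by apply: smoothM.
have SN := smoothN oW (SM 0 (0, 1)%N 1 (1, 0)%N).
rewrite (partialV (ix j) (smoothD oW (SM 0 (1, 0)%N 1 (0, 1)%N) SN) Wx)//.
rewrite (partialD (ix j) (SM 0 (1, 0)%N 1 (0, 1)%N) SN Wx).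
rewrite (partialN (ix j) (SM 0 (0, 1)%N 1 (1, 0)%N) Wx).
rewrite !(partialM (ix j) (Sp _ _) (Sp _ _) Wx).
have D0 a b : partial (ix j) (partials (a, b) (fun y => g y 0 0)) x =
    eval (penv g v x) (dgvar j (Gv false a b)) := Dp false a b.
have D1 a b : partial (ix j) (partials (a, b) (fun y => g y 0 1)) x =
    eval (penv g v x) (dgvar j (Gv true a b)) := Dp true a b.
by rewrite !D0 !D1; case: j {Dp D0 D1}.
Qed.

Lemma partials_penv s t x : W x ->
  partials s (fun x => eval (penv g v x) t) x = eval (penv g v x) (tders dvar s t).
Proof.
exact: (@partials_eval _ R W (fun l x => penv g v x l) dvar oW smooth_penv
  (fun j l x Wx => partial_penv j l Wx) s t x).
Qed.

End Pullback.

Definition sect (S : E -> total_space R) (i : nat) (x : E) : R := (S x).2 0 (inord i).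

Definition field (S : E -> total_space R) (i : nat) : E -> R :=
  match i with
  | 0 | 1 | 2 | 3 => sect S i
  | 4 => fun x => liouville1 (fun i a b => partials (a, b) (sect S i) x)
  | _ => fun x => liouville2 (fun i a b => partials (a, b) (sect S i) x)
  end%N.

Lemma smooth_sect V S i : local_section V S -> smooth_on V (sect S i).
Proof.
case=> oV HS _; apply: smooth_coord => // n.
by apply: (Ck_snd (f := S)).
Qed.

Lemma smooth_liouville (V : normedModType R) (U : set V) (c : nat -> nat -> nat -> V -> R) :
  open U -> (forall i a b, smooth_on U (c i a b)) ->
  smooth_on U (fun x => liouville1 (fun i a b => c i a b x)) /\
  smooth_on U (fun x => liouville2 (fun i a b => c i a b x)).
Proof.
move=> oU Sc; have Sn (n : nat) : smooth_on U (fun=> n%:R : R) by apply: smooth_cst.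
by split; rewrite /liouville1 /liouville2;
  repeat (apply: smoothD => // || apply: smoothM => // || apply: smoothN => //).
Qed.

Lemma smooth_field V S i : local_section V S -> smooth_on V (field S i).
Proof.
move=> HS; have [oV _ _] := HS.
have Sp j s : smooth_on V (partials s (sect S j)) by apply: smooth_partials; apply: smooth_sect HS.
move: i => [|[|[|[|[|i]]]]]; try exact: smooth_sect HS.
  exact: (smooth_liouville oV _).1.
exact: (smooth_liouville oV _).2.
Qed.

(** Functoriality of the lift, in environments: [e1] is for the map applied last in the composite of
    inverses, [e2] for the one applied first. In [e] the rows [Uv 0] and [Uv 1] are reinterpreted as
    the components of the former map, so that [dvar] also provides the chain rule for the
    composite. *)
Lemma eval_lift_comp (F : fieldType) (e1 e2 e12 : lvar -> F) i :
  let e l := if l is Uv j c d then e1 (Gv (j != 0)%N c d) else e2 l in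
  eval e1 jacT != 0 -> e1 Rv = (eval e1 jacT)^-1 ->
  eval e2 jacT != 0 -> e2 Rv = (eval e2 jacT)^-1 -> e12 Rv = (eval e12 jacT)^-1 ->
  (forall j : bool, forall c d, (0 < c + d <= 2)%N ->
    e12 (Gv j c d) = eval e (tders dvar (c, d) (uT j 0 0))) ->
  (forall j, (j < 4)%N -> e12 (Uv j 0 0) = e1 (Uv j 0 0)) ->
  (forall j, (j < 4)%N -> e2 (Uv j 0 0) = eval e1 (liftT j)) ->
  (i < 4)%N -> eval e12 (liftT i) = eval e2 (liftT i).
Proof.
move=> e J1 R1 J2 R2 R12 HG H1 H2 i4.
have G j c d cd := HG j c d cd.
have {}G := (G false 1 0 isT, G false 0 1 isT, G true 1 0 isT, G true 0 1 isT,
  G false 2 0 isT, G false 1 1 isT, G false 0 2 isT,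
  G true 2 0 isT, G true 1 1 isT, G true 0 2 isT)%N.
rewrite /tders /= in G.
have {}H1 := (H1 0 isT, H1 1 isT, H1 2 isT, H1 3 isT)%N.
have {}H2 := (H2 0 isT, H2 1 isT, H2 2 isT, H2 3 isT)%N.
rewrite /= R1 /= in H2.
have {}R12 : e12 Rv = (eval e1 jacT * eval e2 jacT)^-1.
  by rewrite R12 /= !G; congr (_^-1); ring.
move: J1 J2; case: i i4 => [|[|[|[|//]]]] _ /=;
  rewrite R12 R2 /= !H2 !G !H1;
  move: (e1 (Gv false 1 0)) (e1 (Gv false 0 1)) (e1 (Gv true 1 0)) (e1 (Gv true 0 1))
    (e2 (Gv false 1 0)) (e2 (Gv false 0 1)) (e2 (Gv true 1 0)) (e2 (Gv true 0 1))
    => a b c d a' b' c' d' J1 J2; field; exact/andP.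
Qed.

Lemma lift_coef_comp (a b : E -> E) (W V : set E) x (u : 'rV[R]_4) :
  open W -> open V -> smooth_on W b -> smooth_on V a ->
  (forall x, W x -> V (b x)) -> W x ->
  (forall x, W x -> eval (penv b (fun _ _ => 0) x) jacT != 0) ->
  eval (penv a (fun _ _ => 0) (b x)) jacT != 0 ->
  lift_coef (a \o b) x u = lift_coef b x (lift_coef a (b x) u).
Proof.
move=> oW oV Sb Sa bWV Wx Jb Ja.
pose v (i : nat) (y : E) : R := a y 0 (ix (i != 0)%N).
have Sv i : smooth_on V (v i) by apply: smooth_coord.
have Pab (i : bool) s : partials s (fun y => (a \o b) y 0 (ix i)) x =
    eval (penv b v x) (tders dvar s (uT i 0 0)).
  rewrite -(partials_penv oW oV Sb Sv bWV Jb)//.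
  by congr (partials _ _ _); apply/funext => y; rewrite /= /v; case: i.
pose ext (e : lvar -> R) (w : 'rV[R]_4) (l : lvar) : R := match l with
  | Gv i c d => e l
  | Uv i c d => w 0 (inord i)
  | Rv => (eval e jacT)^-1
  end.
pose e1 := ext (penv a (fun _ _ => 0) (b x)) u.
pose e2 := ext (penv b (fun _ _ => 0) x) (lift_coef a (b x) u).
pose e12 := ext (penv (a \o b) (fun _ _ => 0) x) u.
apply/rowP => i; rewrite -(inord_val i); move: (val i) (ltn_ord i) => {}i i4.
have L12 : lift_coef (a \o b) x u 0 (inord i) = eval e12 (liftT i) by apply: lift_coefE.
have L2 : lift_coef b x (lift_coef a (b x) u) 0 (inord i) = eval e2 (liftT i) by apply: lift_coefE.
have Ja' : eval e1 jacT != 0 by exact: Ja.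
have Jb' : eval e2 jacT != 0 by exact: (Jb x Wx).
have HG j c d : (0 < c + d <= 2)%N -> e12 (Gv j c d) =
    eval (fun l => if l is Uv k c d then e1 (Gv (k != 0)%N c d) else e2 l)
      (tders dvar (c, d) (uT (nat_of_bool j) 0 0)).
  move=> cd; apply: etrans (Pab j (c, d)) _.
  apply: (@eq_eval _ _ _ _ (fun l => if l is Rv then false else true)).
    by apply: tall_tders => // -[] [].
  by case=> [k c' d' _|k c' d' _|].
have H1 j : (j < 4)%N -> e12 (Uv j 0 0) = e1 (Uv j 0 0) by [].
have H2 j : (j < 4)%N -> e2 (Uv j 0 0) = eval e1 (liftT j).
  by move=> j4; apply: lift_coefE.
apply: etrans L12 (etrans _ (esym L2)).
exact: (eval_lift_comp Ja' erefl Jb' erefl erefl HG H1 H2 i4).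
Qed.

Lemma open_preimage (U V : set E) (f : E -> E) : open U -> open V -> smooth_on U f ->
  open (U `&` f @^-1` V).
Proof.
move=> oU oV Sf; rewrite openE => x [Ux Vfx]; apply: filterI.
  exact: open_nbhs_nbhs.
have cf : {for x, continuous f} by have := Sf 0%N; apply.
by apply: cf; apply: open_nbhs_nbhs.
Qed.

Lemma smooth_comp_rV (U V : set E) (f g : E -> E) : open U -> open V ->
  (forall x, U x -> V (f x)) -> smooth_on U f -> smooth_on V g -> smooth_on U (g \o f).
Proof.
move=> oU oV UV Sf Sg n; apply: Ck_mx => // i j; rewrite ord1.
by apply: (@Ck_comp R n E 2 U V f (fun y => g y 0 j)) => //; apply: smooth_coord.
Qed.

(** * Sections transformed by a point transformation *)

Let zf (i : nat) (y : E) : R := 0.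

Lemma pt_inv_dom (f : point_transformation R) x :
  (pt_fun f @` pt_dom f) x -> pt_dom f (pt_inv f x) /\ pt_fun f (pt_inv f x) = x.
Proof. by move=> [p dp <-]; rewrite pt_funK. Qed.

(* By the chain rule for f o g = id, the two Jacobian determinants have product 1. *)
Lemma pt_inv_jac (f : point_transformation R) x : (pt_fun f @` pt_dom f) x ->
  eval (penv (pt_inv f) zf x) jacT != 0.
Proof.
move=> fx; have oW := @pt_img_open _ f; have Sg := @pt_inv_smooth _ f.
have oV := @pt_dom_open _ f; have Sf := @pt_fun_smooth _ f.
have D i j : partial j (fun y => pt_fun f (pt_inv f y) 0 i) x = (i == j)%:R.
  rewrite (eq_partial _ oW (g := fun y : E => y 0 i) _ fx); last by move=> y /pt_inv_dom[_ ->].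
  rewrite [LHS](@derive_coord R _ _ _ (fun x : E => x))// derive_id mxE eqxx /=.
  by [].
have C i j := partial_comp j Sg (smooth_coord 0 i oV Sf) fx (pt_inv_dom fx).1.
have D00 := D 0 0; have D01 := D 0 1; have D10 := D 1 0; have D11 := D 1 1.
rewrite !C /= in D00 D01 D10 D11.
rewrite /= /partials /=; apply/eqP.
move: D00 D01 D10 D11.
move: (partial 0 (fun y => pt_inv f y 0 0) x) (partial 1 (fun y => pt_inv f y 0 0) x)
  (partial 0 (fun y => pt_inv f y 0 1) x) (partial 1 (fun y => pt_inv f y 0 1) x)
  (partial 0 (fun y => pt_fun f y 0 0) _) (partial 1 (fun y => pt_fun f y 0 0) _)
  (partial 0 (fun y => pt_fun f y 0 1) _) (partial 1 (fun y => pt_fun f y 0 1) _).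
move=> a b c d a' b' c' d' E1 E2 E3 E4 J0.
have /eqP : (1 : R) = (a * d - b * c) * (a' * d' - b' * c').
  transitivity ((a * a' + c * b') * (b * c' + d * d') - (b * a' + d * b') * (a * c' + c * d')).
    by rewrite E1 E2 E3 E4; ring.
  by ring.
by rewrite J0 mul0r oner_eq0.
Qed.

(* This is lift0 f o S o f^-1 where S is a section, as a function of g = f^-1 only. *)
Definition lifted (g : E -> E) (S : E -> total_space R) (x : E) : total_space R :=
  (x, lift_coef g x (S (g x)).2).

Section Lifted.
Variables (g : E -> E) (S : E -> total_space R) (W V : set E).
Hypotheses (oW : open W) (g_smooth : smooth_on W g) (HS : local_section V S).
Hypothesis gWV : forall x, W x -> V (g x).
Hypothesis J0 : forall x, W x -> eval (penv g zf x) jacT != 0.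

Let oV : open V. Proof. by case: HS. Qed.
Let fS i : smooth_on V (field S i). Proof. exact: smooth_field. Qed.

Lemma sect_lifted i x : (i < 4)%N -> W x ->
  sect (lifted g S) i x = eval (penv g (field S) x) (liftT i).
Proof.
move=> i4 Wx; apply: lift_coefE => //.
by move=> [|[|[|[|]]]].
Qed.

Lemma partials_sect_lifted i s x : (i < 4)%N -> W x ->
  partials s (sect (lifted g S) i) x = eval (penv g (field S) x) (tders dvar s (liftT i)).
Proof.
move=> i4 Wx; rewrite -(partials_penv oW oV g_smooth fS gWV J0 s (liftT i) Wx).
by apply: eq_partials oW _ Wx => y Wy; apply: sect_lifted.
Qed.

(** Rows 4 and 5 of [field S] are by definition the Liouville expressions of rows 0 to 3, so
    [liouville_law] applies at every point; holding on the open set W, the law may then be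
    differentiated. *)
Lemma field_lifted i x : (i < 6)%N -> W x ->
  field (lifted g S) i x = eval (penv g (field S) x) (liftT i).
Proof.
have H y (Wy : W y) := @liouville_law R (penv g (field S) y) (J0 Wy) erefl erefl erefl.
have F4 y : W y -> field (lifted g S) 4 y = eval (penv g (field S) y) (liftT 4).
  move=> Wy; rewrite -(H y Wy).1 /field /liouville1.
  by rewrite !(partials_sect_lifted _ _ Wy).
have F5 y : W y -> field (lifted g S) 5 y = eval (penv g (field S) y) (liftT 5).
  move=> Wy; rewrite -(H y Wy).2 /field /liouville2.
  by rewrite !(partials_sect_lifted _ _ Wy).
by move: i => [|[|[|[|[|[|//]]]]]] _ Wx; [exact: sect_lifted..|exact: F4|exact: F5].
Qed.

Lemma partials_field_lifted i s x : (i < 6)%N -> W x ->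
  partials s (field (lifted g S) i) x = eval (penv g (field S) x) (tders dvar s (liftT i)).
Proof.
move=> i6 Wx; rewrite -(partials_penv oW oV g_smooth fS gWV J0 s (liftT i) Wx).
by apply: eq_partials oW _ Wx => y Wy; apply: field_lifted.
Qed.

Lemma lifted_local_section : local_section W (lifted g S).
Proof.
split=> // n; apply: Ck_pair => //; first exact: Ck_id.
apply: Ck_mx => // i j; rewrite ord1 -(inord_val j).
apply: (@eq_Ck _ _ _ _ _ (fun x => eval (penv g (field S) x) (liftT j))) => //.
  by move=> x Wx; rewrite -sect_lifted.
apply: (@smooth_eval _ R _ W (fun l x => penv g (field S) x l)) => // l.
exact: (smooth_penv oW g_smooth fS gWV J0).
Qed.

End Lifted.

Lemma eq_jet_of k U (S S' : E -> total_space R) p : open U -> U p ->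
  (forall x, U x -> S x = S' x) -> jet_of k S p = jet_of k S' p.
Proof.
move=> oU Up SS'; congr (_, _); apply/matrixP => i m; rewrite !mxE.
by apply: eq_partials oU _ Up => y Uy; rewrite SS'.
Qed.

Lemma lift0_lifted (f : point_transformation R) V S x : local_section V S ->
  (pt_fun f @` pt_dom f) x -> V (pt_inv f x) ->
  (Defs.lift0 f \o S \o pt_inv f) x = lifted (pt_inv f) S x.
Proof.
move=> [_ _ S1] /pt_inv_dom[_ fg] Vx.
rewrite /Defs.lift0 /lifted /= (S1 _ Vx) fg; exact: erefl.
Qed.

Definition lift_dom (f : point_transformation R) (V : set E) : set E :=
  (pt_fun f @` pt_dom f) `&` pt_inv f @^-1` V.

Lemma lift_domP f V p : pt_dom f p -> V p -> lift_dom f V (pt_fun f p).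
Proof. by move=> dp Vp; split; [exists p|rewrite /= pt_funK]. Qed.

Lemma lift_dom_open f V : open V -> open (lift_dom f V).
Proof. by move=> oV; apply: open_preimage (@pt_inv_smooth _ f); [exact: pt_img_open|]. Qed.

Lemma prolongationP k f (theta theta' : jet R k) :
  prolongation f theta theta' <->
  exists V S p, [/\ local_section V S, V p, pt_dom f p, theta = jet_of k S p &
    theta' = jet_of k (lifted (pt_inv f) S) (pt_fun f p)].
Proof.
have E V S p : local_section V S -> V p -> pt_dom f p ->
    jet_of k (Defs.lift0 f \o S \o pt_inv f) (pt_fun f p) =
    jet_of k (lifted (pt_inv f) S) (pt_fun f p).
  move=> HS Vp dp; have [oV _ _] := HS.
  apply: (@eq_jet_of k (lift_dom f V)); [exact: lift_dom_open|exact: lift_domP|].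
  by move=> x [fx Vx]; apply: lift0_lifted HS fx Vx.
split=> -[V [S [p [HS Vp dp -> ->]]]]; exists V, S, p;
  (split; [exact: HS|exact: Vp|exact: dp|exact: erefl|]).
  exact: E HS Vp dp.
exact/esym/(E V S p HS Vp dp).
Qed.

Definition jet_var k (l : lvar) : bool :=
  if l is Uv i a b then (i < 4)%N && (a + b <= k)%N else true.

(** Each differentiation raises the order of the u involved by at most one, so the k-jet of a lifted
    section depends only on the k-jet of the section. *)
Lemma tall_liftT k i a b : (i < 4)%N -> (a + b <= k)%N ->
  tall (jet_var k) (tders dvar (a, b) (liftT i)).
Proof.
move=> i4; rewrite /tders /=.
have step n j t : tall (jet_var n) t -> tall (jet_var n.+1) (tder (dvar j) t).
  apply: tall_tder => [[]//= i' a' b' /andP[-> /leqW//]|].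
  case=> [i' a' b'|i' a' b'|] /=; first by case: j.
    by move=> /andP[i4' ab]; case: j => /=; rewrite i4' ?addSn ?addnS ltnS ab.
  by case: j.
elim: a k => [|a IH] k /=; last first.
  by case: k => [//|k]; rewrite addSn ltnS => /IH; apply: step.
elim: b k => [|b IH] k /=; last by case: k => [//|k] /IH; apply: step.
by case: i i4 => [|[|[|[|//]]]].
Qed.

Lemma jcoord_lifted k f V S p i a b : local_section V S -> V p -> pt_dom f p ->
  (i < 4)%N -> (a + b <= k)%N ->
  jcoord (jet_of k (lifted (pt_inv f) S) (pt_fun f p)) (inord i) (a, b) =
  eval (penv (pt_inv f) (field S) (pt_fun f p)) (tders dvar (a, b) (liftT i)).
Proof.
move=> HS Vp dp i4 ab; rewrite jcoord_jet_of//; have [oV _ _] := HS.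
have Wq := lift_domP dp Vp.
apply: (@partials_sect_lifted _ _ (lift_dom f V) V) => //.
- exact: lift_dom_open.
- by apply: smooth_sub (@pt_inv_smooth _ f); apply: subIsetl.
- by move=> x [].
- by move=> x [fx _]; apply: pt_inv_jac.
Qed.

(** Makes f^(k) a well-defined map; composing two graphs requires changing the section that
    represents the intermediate jet. *)
Lemma jet_of_lifted_eq k f V S V' S' p : local_section V S -> V p ->
  local_section V' S' -> V' p -> pt_dom f p -> jet_of k S p = jet_of k S' p ->
  jet_of k (lifted (pt_inv f) S) (pt_fun f p) =
  jet_of k (lifted (pt_inv f) S') (pt_fun f p).
Proof.
move=> HS Vp HS' Vp' dp E0; apply: jet_eqP; first exact: erefl.
move=> i [a b] ab; rewrite -(inord_val i).
rewrite (jcoord_lifted HS Vp dp (ltn_ord i) ab) (jcoord_lifted HS' Vp' dp (ltn_ord i) ab).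
apply: eq_eval (tall_liftT (ltn_ord i) ab) _.
case=> [//|j c d /andP[j4 cd]|//].
have := congr1 (fun t => jcoord t (inord j) (c, d)) E0.
rewrite !jcoord_jet_of// /penv pt_funK//.
by move: j j4 => [|[|[|[|]]]].
Qed.

(** * Composition, identity and inverses in the pseudogroup *)

Lemma prolongation_trans k f h (t1 t2 t3 : jet R k) :
  prolongation f t1 t2 -> prolongation h t2 t3 -> exists f', prolongation f' t1 t3.
Proof.
move=> /prolongationP[V [S [p [HS Vp dp -> E2]]]].
move=> /prolongationP[V' [S' [q [HS' Vq dq E2' ->]]]].
have qE : q = pt_fun f p by have := congr1 (fun t => t.1) E2; rewrite E2'.
have [oV _ _] := HS; subst q.
pose D := pt_dom f `&` pt_fun f @^-1` pt_dom h.
have oD : open D by apply: open_preimage (@pt_fun_smooth _ f); exact: pt_dom_open.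
pose F := pt_fun h \o pt_fun f; pose G := pt_inv f \o pt_inv h.
have imD : F @` D = (pt_fun h @` pt_dom h) `&` pt_inv h @^-1` (pt_fun f @` pt_dom f).
  apply/seteqP; split=> [_ [x [fx hx] <-]|y [/pt_inv_dom[hy Ey] [x fx Ex]]].
    by split; [exists (pt_fun f x)|rewrite /= pt_funK//; exists x].
  exists x; first by split=> //; rewrite /= Ex.
  by rewrite /F /= Ex.
have oI : open (F @` D).
  rewrite imD; apply: open_preimage (@pt_inv_smooth _ h); [exact: pt_img_open..].
have FK x : D x -> G (F x) = x by move=> [fx hx]; rewrite /F /G /= !pt_funK.
have SF : smooth_on D F.
  apply: (@smooth_comp_rV _ (pt_dom h)) => //; first exact: pt_dom_open.
  - by move=> x [].
  - by apply: smooth_sub (@pt_fun_smooth _ f); apply: subIsetl.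
  - exact: pt_fun_smooth.
have SG : smooth_on (F @` D) G.
  apply: (@smooth_comp_rV _ (pt_fun f @` pt_dom f)) => //; first exact: pt_img_open.
  - by move=> x; rewrite imD => -[].
  - by apply: smooth_sub (@pt_inv_smooth _ h); rewrite imD; apply: subIsetl.
  - exact: pt_inv_smooth.
pose f' := PointTransformation oD oI FK SF SG.
exists f'; apply/prolongationP; exists V, S, p.
split; [exact: HS|exact: Vp|by split|exact: erefl|].
have HL : local_section (lift_dom f V) (lifted (pt_inv f) S).
  apply: (@lifted_local_section _ _ _ V) => //; first exact: lift_dom_open.
  - by apply: smooth_sub (@pt_inv_smooth _ f); apply: subIsetl.
  - by move=> x [].
  - by move=> x [fx _]; apply: pt_inv_jac.
have Wq := lift_domP dp Vp.
rewrite E2 in E2'.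
(* The section S' chosen for the intermediate jet is traded for the lift of S, which has the same
   k-jet there. *)
apply: etrans (esym (jet_of_lifted_eq HL Wq HS' Vq dq E2')) _.
apply: (@eq_jet_of k (F @` D)); [exact: oI|by exists p|].
move=> x Ix; rewrite imD in Ix; have [hx fx] := Ix.
have C : lift_coef (pt_inv f \o pt_inv h) x (S (G x)).2 =
    lift_coef (pt_inv h) x (lift_coef (pt_inv f) (pt_inv h x) (S (G x)).2).
  apply: (@lift_coef_comp _ _ (F @` D) (pt_fun f @` pt_dom f)).
  - exact: oI.
  - exact: pt_img_open.
  - by apply: smooth_sub (@pt_inv_smooth _ h); rewrite imD; apply: subIsetl.
  - exact: pt_inv_smooth.
  - by move=> y; rewrite imD => -[].
  - by rewrite imD.
  - by move=> y; rewrite imD => -[hy _]; apply: pt_inv_jac.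
  - exact: pt_inv_jac.
exact: (congr1 (pair x) (esym C)).
Qed.

Lemma lift_coef_id (g : E -> E) W x u : open W -> W x -> (forall y, W y -> g y = y) ->
  lift_coef g x u = u.
Proof.
move=> oW Wx gid.
have P1 i j y : partial j (fun y : E => y 0 i) y = (i == j)%:R.
  by rewrite [LHS](@derive_coord R _ _ _ (fun x : E => x))// derive_id mxE eqxx.
pose e (l : lvar) : R := match l with
  | Gv i a b => partials (a, b) (fun y : E => y 0 (ix i)) x
  | Uv i _ _ => u 0 (inord i)
  | Rv => 1 end.
have eG i a b : e (Gv i a b) = partials (a, b) (fun y => g y 0 (ix i)) x.
  by apply: eq_partials oW _ Wx => y Wy; rewrite gid.
have P2 i j k y : partial k (partial j (fun y : E => y 0 i)) y = 0.
  rewrite (eq_partial _ (@openT E) (g := fun=> (i == j)%:R)) ?partial_cst//.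
have J1 : eval e jacT = 1 by rewrite /= /partials /= !P1 /=; ring.
apply/rowP => i; rewrite -(inord_val i).
rewrite (@lift_coefE g x u e _ (fun i a b _ => eG i a b))//; last by rewrite J1 invr1.
case: i => -[|[|[|[|//]]]] i4 /=; rewrite /partials /= !P2 !P1 /=; ring.
Qed.

Lemma prolongation_refl k (t : jet R k) : exists f, prolongation f t t.
Proof.
have oT := @openT E.
have oI : open (id @` [set: E]) by rewrite image_id.
have Si (U : set E) : smooth_on U (id : E -> E) by move=> n; apply: Ck_id.
exists (@PointTransformation R setT id id oT oI (fun _ _ => erefl) (Si _) (Si _)).
have [oV SS S1] := taylor_local_section t.
apply/prolongationP; exists setT, (taylor_section t), t.1.
split; [exact: taylor_local_section|by []|by []|exact/esym/jet_of_taylor_section|].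
rewrite -[LHS]jet_of_taylor_section; apply: (@eq_jet_of k setT) => // x _.
rewrite /lifted /= (@lift_coef_id _ setT)//.
Qed.

Lemma prolongation_sym k f (t1 t2 : jet R k) :
  prolongation f t1 t2 -> exists f', prolongation f' t2 t1.
Proof.
move=> /prolongationP[V [S [p [HS Vp dp -> ->]]]].
have [oV _ S1] := HS.
have oI : open (pt_inv f @` (pt_fun f @` pt_dom f)).
  rewrite (_ : _ @` _ = pt_dom f); first exact: pt_dom_open.
  apply/seteqP; split=> [_ [_ [x dx <-] <-]|x dx]; first by rewrite pt_funK.
  by exists (pt_fun f x); [exists x|rewrite pt_funK].
have SI : smooth_on (pt_inv f @` (pt_fun f @` pt_dom f)) (pt_fun f).
  apply: smooth_sub (@pt_fun_smooth _ f) => _ [_ [x dx <-] <-]; by rewrite pt_funK.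
have K y : (pt_fun f @` pt_dom f) y -> pt_fun f (pt_inv f y) = y by case/pt_inv_dom.
pose f' := PointTransformation (@pt_img_open _ f) oI K (@pt_inv_smooth _ f) SI.
exists f'; apply/prolongationP; exists (lift_dom f V), (lifted (pt_inv f) S), (pt_fun f p).
have HL : local_section (lift_dom f V) (lifted (pt_inv f) S).
  apply: (@lifted_local_section _ _ _ V) => //; first exact: lift_dom_open.
  - by apply: smooth_sub (@pt_inv_smooth _ f); apply: subIsetl.
  - by move=> x [].
  - by move=> x [fx _]; apply: pt_inv_jac.
have Wq := lift_domP dp Vp.
split; [exact: HL|exact: Wq|by exists p|exact: erefl|].
rewrite /= pt_funK//.
apply: (@eq_jet_of k (V `&` pt_dom f)); [|by split|].
  by apply: openI => //; exact: pt_dom_open.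
move=> x [Vx dx].
have fx : (pt_fun f @` pt_dom f) (pt_fun f x) by exists x.
have imf' y : pt_dom f y -> (pt_fun f' @` pt_dom f') y.
  by move=> dy; exists (pt_fun f y); [exists y|exact: pt_funK].
have C : lift_coef (pt_inv f \o pt_fun f) x (S x).2 =
    lift_coef (pt_fun f) x (lift_coef (pt_inv f) (pt_fun f x) (S x).2).
  apply: (@lift_coef_comp _ _ (pt_dom f) (pt_fun f @` pt_dom f)).
  - exact: pt_dom_open.
  - exact: pt_img_open.
  - exact: pt_fun_smooth.
  - exact: pt_inv_smooth.
  - by move=> y dy; exists y.
  - exact: dx.
  - by move=> y /imf' /(@pt_inv_jac f').
  - exact: pt_inv_jac.
have I : lift_coef (pt_inv f \o pt_fun f) x (S x).2 = (S x).2.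
  apply: (@lift_coef_id _ (pt_dom f)) dx _; first exact: pt_dom_open.
  by move=> y dy; apply: pt_funK.
rewrite /lifted (pt_funK dx) /= -C I -{2}(S1 x Vx).
exact: surjective_pairing.
Qed.

(** * F1, F2 and total derivatives along sections *)

Lemma smooth_jcoord k i s : smooth_on setT (fun z : jet R k => jcoord z i s).
Proof.
move=> n; rewrite /jcoord; case: insubP => [m _ _|_]; last exact: Ck_cst.
have oT := @openT (jet R k); apply: Ck_coord => //.
apply: (@Ck_snd R n (jet R k) _ _ _ (fun z => z)) => //.
exact: Ck_id.
Qed.

Lemma F1E (z : jet R 2) : F1 z = liouville1 (fun i a b => jcoord z (inord i) (a, b)).
Proof. by []. Qed.

Lemma F2E (z : jet R 2) : F2 z = liouville2 (fun i a b => jcoord z (inord i) (a, b)).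
Proof. by []. Qed.

Lemma smooth_F1 : smooth_on setT (@F1 R).
Proof.
exact: (smooth_liouville (@openT (jet R 2)) (fun i a b => @smooth_jcoord 2 (inord i) (a, b))).1.
Qed.

Lemma smooth_F2 : smooth_on setT (@F2 R).
Proof.
exact: (smooth_liouville (@openT (jet R 2)) (fun i a b => @smooth_jcoord 2 (inord i) (a, b))).2.
Qed.

Lemma F1_jet_of (S : E -> total_space R) p : F1 (jet_of 2 S p) = field S 4 p.
Proof. by rewrite F1E /liouville1 !jcoord_jet_of. Qed.

Lemma F2_jet_of (S : E -> total_space R) p : F2 (jet_of 2 S p) = field S 5 p.
Proof. by rewrite F2E /liouville2 !jcoord_jet_of. Qed.

Lemma jproj_jet_of k (S : E -> total_space R) p :
  jproj (jet_of k.+1 S p) = jet_of k S p.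
Proof.
apply: jet_eqP; first exact: erefl.
move=> i s Hs; rewrite (@jcoord_matrix R k p (fun i s => jcoord (jet_of k.+1 S p) i s))//.
by rewrite !jcoord_jet_of// leqW.
Qed.

Lemma derive_pair (V W1 W2 : normedModType R) (f : V -> W1) (g : V -> W2) x v :
  differentiable f x -> differentiable g x ->
  'D_v (fun y => (f y, g y)) x = ('D_v f x, 'D_v g x).
Proof.
move=> df dg; rewrite deriveE; last exact: differentiable_pair.
by rewrite diff_pair// !deriveE.
Qed.

(** [total_vector] is the velocity of the curve of k-jets of S in direction j, so the total
    derivative is the chain rule along the prolonged section. *)
Lemma totalD_jet_of k V (S : E -> total_space R) p j (F : jet R k -> R) :
  local_section V S -> V p -> differentiable F (jet_of k S p) ->
  totalD j F (jet_of k.+1 S p) = partial j (fun q => F (jet_of k S q)) p.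
Proof.
move=> HS Vp dF; have [oV SS S1] := HS.
have Ssec i : smooth_on V (fun q => (S q).2 0 i).
  by apply: smooth_coord => // n; apply: (Ck_snd (f := S)).
pose M q := \matrix_(i < 4, m < size (midx k))
  partials (nth (0, 0)%N (midx k) m) (fun q => (S q).2 0 i) q.
have SM : smooth_on V M.
  apply: smooth_mx => // i m.
  apply: (@eq_smooth _ _ _ _ (partials (nth (0, 0)%N (midx k) m) (fun q => (S q).2 0 i))) => //.
    by move=> q _; rewrite mxE.
  exact: smooth_partials.
have dM := smooth_differentiable SM Vp.
have di : differentiable (fun q : E => q) p by apply: (Ck_differentiable (@Ck_id R 1 E setT)).
have dj : differentiable (fun q => jet_of k S q) p.
  by apply: (@differentiable_pair _ _ _ _ (fun q : E => q) M).
rewrite /totalD jproj_jet_of /partial (@derive_comp R _ _ _ (fun q => jet_of k S q) F)//.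
congr ('D_ _ F _).
rewrite [RHS](@derive_pair _ _ _ (fun q : E => q) M)// derive_id /total_vector; congr (_, _).
rewrite derive_mx; last exact: diff_derivable.
apply/matrixP => i m; rewrite !mxE; set s := nth _ _ _.
have Hs : (s.1 + s.2 <= k)%N by rewrite -mem_midx; apply: mem_nth.
rewrite (_ : (fun t => M t i m) = partials s (fun q => (S q).2 0 i)); last first.
  by apply/funext => q; rewrite mxE.
case: s Hs => a b Hs /=; case: (I2P j) => ->; rewrite jcoord_jet_of /= ?addn0 ?addn1//.
  by rewrite (partialsS1 a b oV (Ssec i) Vp).
by rewrite addnS.
Qed.

(* Same convention as for [Uv]: rows 4 and 5 are F1, F2 and their total derivatives,
   meaningful for a + b <= 1 only. *)
Definition jet_field (z : jet R 3) (i a b : nat) : R :=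
  match i with
  | 0 | 1 | 2 | 3 => jcoord z (inord i) (a, b)
  | 4 => match a, b with
         | 0, 0 => F1 (jproj z)
         | 1, 0 => totalD 0%R (@F1 R) z
         | _, _ => totalD 1%R (@F1 R) z
         end
  | _ => match a, b with
         | 0, 0 => F2 (jproj z)
         | 1, 0 => totalD 0%R (@F2 R) z
         | _, _ => totalD 1%R (@F2 R) z
         end
  end%N.

(** What a 3-jet determines: the u up to order 3 and, F1 and F2 being of order 2, their first
    derivatives. *)
Definition in_range (i a b : nat) : bool :=
  if (i < 4)%N then (a + b <= 3)%N else (i < 6)%N && (a + b <= 1)%N.

Lemma jet_field_jet_of V (S : E -> total_space R) p i a b :
  local_section V S -> V p -> in_range i a b ->
  jet_field (jet_of 3 S p) i a b = partials (a, b) (field S i) p.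
Proof.
move=> HS Vp; rewrite /in_range.
have oT := @openT (jet R 2).
have d1 := smooth_differentiable smooth_F1 (I : setT (jet_of 2 S p)).
have d2 := smooth_differentiable smooth_F2 (I : setT (jet_of 2 S p)).
have E4 : (fun q => F1 (jet_of 2 S q)) = field S 4 by apply/funext => q; apply: F1_jet_of.
have E5 : (fun q => F2 (jet_of 2 S q)) = field S 5 by apply/funext => q; apply: F2_jet_of.
have T1 j := totalD_jet_of j HS Vp d1.
have T2 j := totalD_jet_of j HS Vp d2.
rewrite E4 in T1; rewrite E5 in T2.
move: i => [|[|[|[|[|[|//]]]]]] /=; try by move=> ab; rewrite jcoord_jet_of.
  by move: a b => [|[|a]] [|[|b]] //= _; rewrite ?T1// jproj_jet_of F1_jet_of.
by move: a b => [|[|a]] [|[|b]] //= _; rewrite ?T2// jproj_jet_of F2_jet_of.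
Qed.

(** * The action on 3-jets in algebraic form *)

Definition range_var (l : lvar) : bool := if l is Uv i a b then in_range i a b else true.

Lemma tall_liftT3 i a b : in_range i a b -> tall range_var (tders dvar (a, b) (liftT i)).
Proof.
rewrite /in_range; case: ltnP => [i4 ab|i4 /andP[i6 ab]].
  apply: tall_sub (tall_liftT i4 ab) => -[//|j c d|//] /=.
  by rewrite /in_range => /andP[-> ->].
move: i i4 i6 => [|[|[|[|[|[|//]]]]]] // _ _;
by move: a b ab => [|[|a]] [|[|b]].
Qed.

(** Reduces invariance statements to algebra: the transformed jet is read from z through a single
    environment with nonzero J. *)
Lemma orbit_law (z z' : jet R 3) : jet_orbit z z' ->
  exists2 e : lvar -> R, eval e jacT != 0 /\ e Rv = (eval e jacT)^-1 &
    (forall i a b, in_range i a b -> e (Uv i a b) = jet_field z i a b) /\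
    (forall i a b, in_range i a b ->
      jet_field z' i a b = eval e (tders dvar (a, b) (liftT i))).
Proof.
move=> [f /prolongationP[V [S [p [HS Vp dp -> ->]]]]]; have [oV _ _] := HS.
have Wq := lift_domP dp Vp.
have oW := @lift_dom_open f V oV.
have SW : smooth_on (lift_dom f V) (pt_inv f).
  by apply: smooth_sub (@pt_inv_smooth _ f); apply: subIsetl.
have WV x : lift_dom f V x -> V (pt_inv f x) by case.
have JW x : lift_dom f V x -> eval (penv (pt_inv f) zf x) jacT != 0.
  by move=> [fx _]; apply: pt_inv_jac.
exists (penv (pt_inv f) (field S) (pt_fun f p)).
  by split; [exact: JW|exact: penv_Rv].
split=> i a b iab.
  by rewrite (jet_field_jet_of HS Vp iab) /penv (pt_funK dp).
have HL := lifted_local_section oW SW HS WV JW.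
rewrite (jet_field_jet_of HL Wq iab).
apply: (partials_field_lifted oW SW HS WV JW) => //.
by move: iab; rewrite /in_range; case: ltnP => [i4 _|_ /andP[]//]; apply: leq_trans i4 _.
Qed.

Definition cjac (c : bool -> nat -> nat -> R) : R :=
  c false 1%N 0%N * c true 0%N 1%N - c false 0%N 1%N * c true 1%N 0%N.

(* g is taken polynomial of degree 5, since 3-jets of lifted sections involve the
   derivatives of g up to that order. *)
Definition step_env (c : bool -> nat -> nat -> R) (z : jet R 3) (l : lvar) : R :=
  match l with
  | Gv i a b => if (a + b <= 5)%N then c i a b else 0
  | Uv i a b => jet_field z i a b
  | Rv => (cjac c)^-1
  end.

(** A converse to [orbit_law]: the derivatives of g at q up to order 5 may be prescribed at will,
    provided J is nonzero and g(q) is the base point of z, since the Taylor polynomial they define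
    is invertible near q. *)
Lemma orbit_step (z : jet R 3) (q : E) (c : bool -> nat -> nat -> R) :
  (forall i, c i 0%N 0%N = z.1 0 (ix i)) ->
  cjac c != 0 ->
  exists z', [/\ jet_orbit z z', z'.1 = q & forall i a b, in_range i a b ->
    jet_field z' i a b = eval (step_env c z) (tders dvar (a, b) (liftT i))].
Proof.
move=> c0 J0; have oT := @openT E.
pose g (x : E) : E := \row_(i < 2) taylor q 5 (fun s => c (i == 1) s.1 s.2) x.
have gE i : (fun x => g x 0 (ix i)) = taylor q 5 (fun s => c i s.1 s.2).
  by apply/funext => x; rewrite mxE; congr (taylor _ _ _ _); case: i.
have gP i a b : partials (a, b) (fun x => g x 0 (ix i)) q =
    if (a + b <= 5)%N then c i a b else 0.
  by rewrite gE partials_taylor.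
have Sg : smooth_on setT g.
  apply: smooth_mx => // k j; rewrite ord1.
  have -> : j = ix (j == 1) by case: (I2P j) => ->.
  by rewrite gE; apply: smooth_taylor.
have gq : g q = z.1.
  have P i : g q 0 (ix i) = z.1 0 (ix i) by rewrite -c0; have := gP i 0%N 0%N.
  by apply: rV2P; [exact: P false|exact: P true].
have gJ : (partials (1, 0)%N (fun y => g y 0 0) q * partials (0, 1)%N (fun y => g y 0 1) q
   - partials (0, 1)%N (fun y => g y 0 0) q * partials (1, 0)%N (fun y => g y 0 1) q) != 0.
  by rewrite (gP false 1 0)%N (gP true 0 1)%N (gP false 0 1)%N (gP true 1 0)%N.
have [f [Ef df fq _]] := inverse_function oT (I : setT q) Sg gJ.
pose S := taylor_section z; have HS := taylor_local_section z.
have fzq : pt_fun f z.1 = q by rewrite -gq.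
have dz : pt_dom f z.1 by rewrite -gq.
exists (jet_of 3 (lifted (pt_inv f) S) (pt_fun f z.1)); split.
- exists f; apply/prolongationP; exists setT, S, z.1.
  by split; [exact: HS|by []|exact: dz|exact/esym/jet_of_taylor_section|exact: erefl].
- by rewrite -fzq.
move=> i a b iab.
have Wq : lift_dom f setT (pt_fun f z.1) by apply: lift_domP.
have oW := @lift_dom_open f setT oT.
have SW : smooth_on (lift_dom f setT) (pt_inv f).
  by apply: smooth_sub (@pt_inv_smooth _ f); apply: subIsetl.
have WV x : lift_dom f setT x -> setT (pt_inv f x) by [].
have JW x : lift_dom f setT x -> eval (penv (pt_inv f) zf x) jacT != 0.
  by move=> [fx _]; apply: pt_inv_jac.
have HL := lifted_local_section oW SW HS WV JW.
rewrite (jet_field_jet_of HL Wq iab).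
apply: etrans (partials_field_lifted oW SW HS WV JW (a, b) _ Wq) _.
  by move: iab; rewrite /in_range; case: ltnP => [i4 _|_ /andP[]//]; apply: leq_trans i4 _.
apply: eq_eval (tall_liftT3 iab) _; rewrite fzq Ef.
case=> [j c' d' _|j c' d' jcd|_].
- exact: gP.
- rewrite /penv /step_env gq -[in RHS](jet_of_taylor_section z).
  by rewrite (jet_field_jet_of HS (I : setT z.1) jcd).
- by rewrite /penv (gP false 1 0)%N (gP true 0 1)%N (gP false 0 1)%N (gP true 1 0)%N.
Qed.

(** * The relative invariant F3 *)

Section Tresse.
Variables (S : pzRingType) (f : nat -> nat -> nat -> S).

Definition tresse : S :=
  f 5 0 0 * (f 4 0 0 * f 5 1 0 - f 5 0 0 * f 4 1 0)
  - f 4 0 0 * (f 4 0 0 * f 5 0 1 - f 5 0 0 * f 4 0 1)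
  + f 4 0 0 ^+ 3 * f 3 0 0 - f 4 0 0 ^+ 2 * f 5 0 0 * f 2 0 0
  + f 4 0 0 * f 5 0 0 ^+ 2 * f 1 0 0 - f 5 0 0 ^+ 3 * f 0 0 0.

End Tresse.

(** The terms of F3 cubic in F1, F2 and linear in u compensate the second derivatives of g that D_j
    F_i brings in. *)
Lemma tresse_law (S : fieldType) (e : lvar -> S) :
  eval e jacT != 0 -> e Rv = (eval e jacT)^-1 ->
  tresse (fun i a b => eval e (tders dvar (a, b) (liftT i))) =
  eval e jacT ^+ 5 * tresse (fun i a b => e (Uv i a b)).
Proof.
move=> J0 rho; rewrite /tresse /tders /=; move: J0; rewrite rho /=.
move: (e (Gv false 1 0)) (e (Gv false 0 1)) (e (Gv true 1 0)) (e (Gv true 0 1)) => a b c d.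
move: (e (Gv false 2 0)) (e (Gv false 1 1)) (e (Gv false 0 2)).
move: (e (Gv true 2 0)) (e (Gv true 1 1)) (e (Gv true 0 2)).
move: (e (Uv 4 0 0)) (e (Uv 5 0 0)) (e (Uv 4 1 0)) (e (Uv 5 1 0)) (e (Uv 4 0 1)) (e (Uv 5 0 1)).
move: (e (Uv 0 0 0)) (e (Uv 1 0 0)) (e (Uv 2 0 0)) (e (Uv 3 0 0)).
by intros; field; exact: J0.
Qed.

Lemma F3E (z : jet R 3) : F3 z = tresse (jet_field z).
Proof. by []. Qed.

Lemma F3_law (z z' : jet R 3) : jet_orbit z z' ->
  exists2 J : R, J != 0 & F3 z' = J ^+ 5 * F3 z.
Proof.
move=> /orbit_law[e [J0 eR] [eU eZ]]; exists (eval e jacT) => //.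
rewrite !F3E -[X in _ * X](_ : tresse (fun i a b => e (Uv i a b)) = _).
  by rewrite -tresse_law// /tresse !eZ.
by rewrite /tresse !eU.
Qed.

Lemma F12_law (z z' : jet R 3) : jet_orbit z z' ->
  (F1 (jproj z'), F2 (jproj z')) = (0, 0) -> (F1 (jproj z), F2 (jproj z)) = (0, 0).
Proof.
move=> /orbit_law[e [J0 eR] [eU eZ]] [E1 E2].
have := eZ 4 0 0 isT; have := eZ 5 0 0 isT; rewrite /= E1 E2.
rewrite (eU 4 0 0 isT) (eU 5 0 0 isT) /=; move: J0 => /=.
move: (e (Gv false 1 0)) (e (Gv false 0 1)) (e (Gv true 1 0)) (e (Gv true 0 1)).
move=> a b c d; set J := _ - _ => J0 /esym/eqP; rewrite mulf_eq0 (negPf J0) /= => /eqP H2.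
move=> /esym/eqP; rewrite mulf_eq0 (negPf J0) /= => /eqP H1.
(* Multiplication by the adjugate of the Jacobian matrix. *)
have : J * F1 (jproj z) = 0.
  have -> : J * F1 (jproj z) = d * (a * F1 (jproj z) + c * F2 (jproj z))
     - c * (b * F1 (jproj z) + d * F2 (jproj z)) by rewrite /J; ring.
  by rewrite H1 H2 !mulr0 subrr.
have : J * F2 (jproj z) = 0.
  have -> : J * F2 (jproj z) = a * (b * F1 (jproj z) + d * F2 (jproj z))
     - b * (a * F1 (jproj z) + c * F2 (jproj z)) by rewrite /J; ring.
  by rewrite H1 H2 !mulr0 subrr.
move=> /eqP; rewrite mulf_eq0 (negPf J0) => /eqP -> /eqP.
by rewrite mulf_eq0 (negPf J0) => /eqP ->.
Qed.

(** * Changes of variables tangent to the identity *)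

Section Simplify.
Variables (T : Type) (known : T -> option nat).

Definition sadd (t1 t2 : term T) : term T :=
  match t1, t2 with
  | Nat 0, t | t, Nat 0 => t
  | _, _ => Add t1 t2
  end.

Definition smul (t1 t2 : term T) : term T :=
  match t1, t2 with
  | Nat 0, _ | _, Nat 0 => Nat 0
  | Nat 1, t | t, Nat 1 => t
  | _, _ => Mul t1 t2
  end.

Definition sopp (t : term T) : term T := if t is Nat 0 then Nat 0 else Opp t.

Fixpoint tsimp (t : term T) : term T :=
  match t with
  | Var v => if known v is Some n then Nat n else t
  | Nat _ => t
  | Add t1 t2 => sadd (tsimp t1) (tsimp t2)
  | Mul t1 t2 => smul (tsimp t1) (tsimp t2)
  | Opp t1 => sopp (tsimp t1)
  end.

Lemma eval_tsimp (S : pzRingType) (e : T -> S) t :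
  (forall v n, known v = Some n -> e v = n%:R) -> eval e (tsimp t) = eval e t.
Proof.
move=> H; elim: t => [v|n|t1 IH1 t2 IH2|t1 IH1 t2 IH2|t IH] //=.
- by case E : (known v) => [n|] //=; rewrite (H _ _ E).
- rewrite -IH1 -IH2; case: (tsimp t1) => [?|[|?]|? ?|? ?|?];
  case: (tsimp t2) => [?|[|?]|? ?|? ?|?] //=;
  by rewrite ?add0r ?addr0.
- rewrite -IH1 -IH2; case: (tsimp t1) => [?|[|[|?]]|? ?|? ?|?];
  case: (tsimp t2) => [?|[|[|?]]|? ?|? ?|?] //=;
  by rewrite ?mul0r ?mulr0 ?mul1r ?mulr1.
- by rewrite -IH; case: (tsimp t) => [?|[|?]|? ?|? ?|?] //=; rewrite oppr0.
Qed.

End Simplify.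

(* The values forced by g = id + h with h homogeneous of degree n, at its center.
   Simplifying terms with them first keeps what is left to [ring] small. *)
Definition near_id n (l : lvar) : option nat :=
  match l with
  | Gv i a b => match (a + b)%N with
      | 0 => None
      | 1 => Some (if i then b else a)
      | k => if k == n then None else Some 0
      end%N
  | Uv i a b => None
  | Rv => Some 1%N
  end.

(** The coefficients in t of - Q^2 + t Q^1, which is what - A Q^2 + B Q^1 becomes for A = 1 and B =
    t, differentiated a times in x^1 and b times in x^2. *)
Definition near_id_shift (G : bool -> nat -> nat -> R) (i a b : nat) : R :=
  match i with
  | 0%N => - G true a.+2 b
  | 1%N => G false a.+2 b - 2 * G true a.+1 b.+1
  | 2%N => 2 * G false a.+1 b.+1 - G true a b.+2
  | _ => G false a b.+2
  end.

(** The last clause needs n > 2: the law of F1 and F2 involves first derivatives of g, so D_j F_i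
    sees its second derivatives, which vanish at the center exactly in these degrees. *)
Lemma near_id_eval n (e : lvar -> R) : (2 <= n <= 5)%N ->
  (forall l m, near_id n l = Some m -> e l = m%:R) ->
  [/\ forall i a b, (i < 4)%N -> (a + b < n - 2)%N ->
        eval e (tders dvar (a, b) (liftT i)) = e (Uv i a b),
      forall i a b, (i < 4)%N -> (a + b = n - 2)%N ->
        eval e (tders dvar (a, b) (liftT i)) =
        e (Uv i a b) + near_id_shift (fun i a b => e (Gv i a b)) i a b &
      (2 < n)%N -> forall i a b, (3 < i < 6)%N -> (a + b < 2)%N ->
        eval e (tders dvar (a, b) (liftT i)) = e (Uv i a b)].
Proof.
move=> n25 H.
have S t := esym (eval_tsimp t H).
split.
- move=> i a b i4 ab; rewrite S.
  suff -> : tsimp (near_id n) (tders dvar (a, b) (liftT i)) = uT i a b by [].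
  move: n n25 ab {S H} i i4 => [|[|[|[|[|[|//]]]]]] // _;
  move: a b => [|[|[|a]]] [|[|[|b]]] // _ [|[|[|[|//]]]] // _; by vm_compute.
- move=> i a b i4 ab; rewrite S.
  move: n n25 ab {S H} i i4 => [|[|[|[|[|[|//]]]]]] // _;
  move: a b => [|[|[|[|a]]]] [|[|[|[|b]]]] // _ [|[|[|[|//]]]] // _;
  match goal with |- context [tsimp ?f ?t] =>
    let t' := eval vm_compute in (tsimp f t) in
    have -> : tsimp f t = t' by vm_compute end; rewrite /=; ring.
- move=> n2 i a b i4 ab; rewrite S.
  suff -> : tsimp (near_id n) (tders dvar (a, b) (liftT i)) = uT i a b by [].
  move: n n25 n2 {S H} i i4 => [|[|[|[|[|[|//]]]]]] // _ _;
  move: a b ab => [|[|a]] [|[|b]] // _ [|[|[|[|[|[|//]]]]]] // _; by vm_compute.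
Qed.

(** * F1, F2 and their total derivatives in coordinates *)

Definition sect_der (j : bool) (v : nat * nat * nat) : term (nat * nat * nat) :=
  let: (i, a, b) := v in Var (if j then (i, a, b.+1) else (i, a.+1, b)).

Definition secT (i a b : nat) : term (nat * nat * nat) := Var (i, a, b).

Definition liouvilleT (i : nat) : term (nat * nat * nat) :=
  (if i == 4%N then
    threeT * secT 0 0 2 - twoT * secT 1 1 1 + secT 2 2 0
    + threeT * secT 3 0 0 * secT 0 1 0 - threeT * secT 2 0 0 * secT 0 0 1
    + twoT * secT 1 0 0 * secT 1 0 1 - secT 1 0 0 * secT 2 1 0
    - threeT * secT 0 0 0 * secT 2 0 1 + Nat 6 * secT 0 0 0 * secT 3 1 0
  else
    secT 1 0 2 - twoT * secT 2 1 1 + threeT * secT 3 2 0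
    - threeT * secT 0 0 0 * secT 3 0 1 + threeT * secT 1 0 0 * secT 3 1 0
    - twoT * secT 2 0 0 * secT 2 1 0 + secT 2 0 0 * secT 1 0 1
    + threeT * secT 3 0 0 * secT 1 1 0 - Nat 6 * secT 3 0 0 * secT 0 0 1)%tm.

Definition coord_env (z : jet R 3) (v : nat * nat * nat) : R :=
  jcoord z (inord v.1.1) (v.1.2, v.2).

(** Turns the total derivatives, defined as derivatives on jet space, into explicit polynomials in
    the jet coordinates, by evaluating along the Taylor section. *)
Lemma jet_fieldE (z : jet R 3) i a b : (3 < i < 6)%N -> (a + b < 2)%N ->
  jet_field z i a b = eval (coord_env z) (tders sect_der (a, b) (liouvilleT i)).
Proof.
move=> /andP[i3 i6] ab; have oT := @openT E.
have HS := taylor_local_section z; pose S := taylor_section z.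
pose e (v : nat * nat * nat) x := partials (v.1.2, v.2) (sect S v.1.1) x.
have Se v : smooth_on setT (e v).
  by apply: smooth_partials; apply: smooth_sect HS.
have De j v x : setT x -> partial (ix j) (e v) x = eval (e ^~ x) (sect_der j v).
  case: v => [[k c] d] _; case: j => //=.
  by rewrite /e /= (partialsS1 c d oT (smooth_sect k HS)).
have ranged : in_range i a b by rewrite /in_range ltnNge i3 /= i6.
rewrite -[z in LHS]jet_of_taylor_section (jet_field_jet_of HS _ ranged)//.
rewrite (_ : field _ i = fun x => eval (e ^~ x) (liouvilleT i)); last first.
  by apply/funext => x; move: i i3 i6 {ranged} => [|[|[|[|[|[|//]]]]]].
rewrite (partials_eval oT Se De)//.
apply: (@eq_eval _ _ _ _ (fun=> true)); first by elim: (tders _ _ _) => //= ? -> ? ->.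
by move=> [[k c] d] _; rewrite /e /coord_env /= -partials_taylor_section.
Qed.

Section Order3.
Variable z : jet R 3.
Hypothesis z0 : forall i a b, (i < 4)%N -> (a + b < 2)%N -> jet_field z i a b = 0.

Let zE :=
  (@z0 0%N 0%N 0%N isT isT, @z0 1%N 0%N 0%N isT isT,
   @z0 2%N 0%N 0%N isT isT, @z0 3%N 0%N 0%N isT isT,
  (@z0 0%N 1%N 0%N isT isT, @z0 1%N 1%N 0%N isT isT,
   @z0 2%N 1%N 0%N isT isT, @z0 3%N 1%N 0%N isT isT,
   @z0 0%N 0%N 1%N isT isT, @z0 1%N 0%N 1%N isT isT,
   @z0 2%N 0%N 1%N isT isT, @z0 3%N 0%N 1%N isT isT)).

(** Every nonlinear term of F1 and F2 is some u times a first derivative; it vanishes together with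
    its first derivatives once orders 0 and 1 are zero. Only the linear parts survive here and in
    the lemmas that follow. *)
Lemma F1_order2 :
  jet_field z 4 0 0 = 3 * jet_field z 0 0 2 - 2 * jet_field z 1 1 1 + jet_field z 2 2 0.
Proof.
by rewrite jet_fieldE//=; have H := zE; rewrite /jet_field in H;
  rewrite /coord_env /= !H; ring.
Qed.

Lemma F2_order2 :
  jet_field z 5 0 0 = jet_field z 1 0 2 - 2 * jet_field z 2 1 1 + 3 * jet_field z 3 2 0.
Proof.
by rewrite jet_fieldE//=; have H := zE; rewrite /jet_field in H;
  rewrite /coord_env /= !H; ring.
Qed.

Lemma DF1_order3 :
  jet_field z 4 1 0 = 3 * jet_field z 0 1 2 - 2 * jet_field z 1 2 1 + jet_field z 2 3 0 /\
  jet_field z 4 0 1 = 3 * jet_field z 0 0 3 - 2 * jet_field z 1 1 2 + jet_field z 2 2 1.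
Proof.
by split; rewrite jet_fieldE//=; have H := zE; rewrite /jet_field in H;
  rewrite /coord_env /= !H; ring.
Qed.

Lemma DF2_order3 :
  jet_field z 5 1 0 = jet_field z 1 1 2 - 2 * jet_field z 2 2 1 + 3 * jet_field z 3 3 0 /\
  jet_field z 5 0 1 = jet_field z 1 0 3 - 2 * jet_field z 2 1 2 + 3 * jet_field z 3 2 1.
Proof.
by split; rewrite jet_fieldE//=; have H := zE; rewrite /jet_field in H;
  rewrite /coord_env /= !H; ring.
Qed.

End Order3.

(** * Normal forms *)

Local Notation jf := jet_field.
Arguments jet_field : simpl never.

(* Keeps ring from comparing these atoms up to conversion. *)
Ltac gen_jf := repeat match goal with |- context [jet_field ?z ?i ?a ?b] =>
  generalize (jet_field z i a b); intro end.

Definition step_coef (q : E) n (h : bool -> nat -> nat -> R) (i : bool) (a b : nat) : R :=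
  match (a + b)%N with
  | 0%N => q 0 (ix i)
  | 1%N => (if i then b else a)%:R
  | k => if k == n then h i a b else 0
  end.

Lemma near_id_step n (z : jet R 3) h : (2 <= n <= 5)%N ->
  exists z', [/\ jet_orbit z z', z'.1 = 0,
    forall i a b, (i < 4)%N -> (a + b < n - 2)%N -> jf z' i a b = jf z i a b,
    forall i a b, (i < 4)%N -> (a + b = n - 2)%N ->
      jf z' i a b = jf z i a b + near_id_shift h i a b &
    (2 < n)%N -> forall i a b, (3 < i < 6)%N -> (a + b < 2)%N -> jf z' i a b = jf z i a b].
Proof.
(* Since g sends 0 to the base point of z, each step also moves the base point to the origin. *)
move=> n25; pose c := step_coef z.1 n h.
have [||z' [zz' z'0 E0]] := @orbit_step z 0 c; first by move=> i.
  by rewrite /cjac /c /step_coef /= mulr1 mulr0 subr0 oner_eq0.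
have H l m : near_id n l = Some m -> step_env c z l = m%:R.
  case: l => [i a b|//|] /=; last first.
    by move=> [<-]; rewrite /cjac /c /step_coef /= mulr1 mulr0 subr0 invr1.
  rewrite /c /step_coef; case Eab : (a + b)%N => [//|[|k]] /=; first by move=> [<-].
  by case: ifP => // _ [<-]; rewrite if_same.
have [H1 H2 H3] := near_id_eval n25 H.
have n2 : (n - 2 <= 3)%N by move: n25 => /andP[_]; rewrite leq_subLR.
exists z'; split=> //.
- move=> i a b i4 ab; rewrite E0 ?H1// /in_range i4.
  by apply: leq_trans n2; apply: ltnW.
- move=> i a b i4 ab; rewrite E0 ?H2//; last by rewrite /in_range i4 ab.
  congr (_ + _).
  have Gh j a' b' : (a' + b' = n)%N -> step_env c z (Gv j a' b') = h j a' b'.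
    move=> Eab; rewrite /= /c /step_coef Eab; move: n25 => /andP[n2' n5]; rewrite n5.
    by move: n n2' {H H1 H2 H3 c E0 n5 n2 ab Eab} => [|[|k]]//; rewrite eqxx.
  have En : (a + b + 2 = n)%N by rewrite ab subnK//; case/andP: n25.
  rewrite /near_id_shift; move: i i4 => [|[|[|i]]] _; rewrite !Gh//;
  by rewrite -En addn2 ?(addSn, addnS).
- move=> n3 i a b /andP[i3 i6] ab; rewrite E0 ?H3 ?i3 ?i6//.
  by rewrite /in_range ltnNge i3 /= i6.
Qed.

Section Steps.
Variable z : jet R 3.
Local Notation u := (jf z).

(** A solution of u + [near_id_shift] h = 0 for n = 2: four equations in six unknowns, the freedom
    being used to set two second derivatives of h^1 to 0. *)
Definition shift2 (i : bool) (a b : nat) : R :=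
  match i, a with
  | true, 2%N => u 0 0 0 | true, 1%N => u 1 0 0 / 2 | true, _ => u 2 0 0
  | false, 0%N => - u 3 0 0 | false, _ => 0
  end.

Lemma normalize_order0 : exists z', [/\ jet_orbit z z', z'.1 = 0 &
  forall i, (i < 4)%N -> jf z' i 0 0 = 0].
Proof.
have [//|z' [zz' z'0 _ H _]] := @near_id_step 2 z shift2.
exists z'; split=> // i i4; rewrite H//.
by move: i i4 => [|[|[|[|//]]]] _; rewrite /near_id_shift /shift2; gen_jf; field.
Qed.

(** The unique solution for n = 3: eight equations in eight unknowns. *)
Definition shift3 (i : bool) (a b : nat) : R :=
  match i, a with
  | true, 3%N => u 0 1 0 | true, 2%N => u 0 0 1
  | true, 1%N => (2 * u 1 0 1 - u 2 1 0) / 3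
  | true, _ => u 2 0 1 - 2 * u 3 1 0
  | false, 3%N => 2 * u 0 0 1 - u 1 1 0
  | false, 2%N => (u 1 0 1 - 2 * u 2 1 0) / 3
  | false, 1%N => - u 3 1 0 | false, _ => - u 3 0 1
  end.

Lemma normalize_order1 : exists z', [/\ jet_orbit z z', z'.1 = 0,
  forall i, (i < 4)%N -> jf z' i 0 0 = jf z i 0 0,
  forall i a b, (i < 4)%N -> (a + b = 1)%N -> jf z' i a b = 0 &
  forall i a b, (3 < i < 6)%N -> (a + b < 2)%N -> jf z' i a b = jf z i a b].
Proof.
have [//|z' [zz' z'0 H1 H H3]] := @near_id_step 3 z shift3.
exists z'; split=> // [i i4|i a b i4 ab|]; [by rewrite H1|rewrite H//|exact: H3].
by move: a b ab i i4 => [|[|a]] [|[|b]]// _ [|[|[|[|//]]]] _;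
  rewrite /near_id_shift /shift3; gen_jf; field.
Qed.

(** Ten unknowns for twelve equations; the two coordinates left over are those of [normal2]. *)
Definition shift4 (i : bool) (a b : nat) : R :=
  match i, a with
  | true, 4%N => u 0 2 0 | true, 3%N => u 0 1 1
  | true, 2%N => (2 * u 1 1 1 - u 2 2 0) / 3
  | true, 1%N => (2 * u 1 0 2 - u 2 1 1) / 3
  | true, _ => u 2 0 2 - 2 * u 3 1 1
  | false, 4%N => 2 * u 0 1 1 - u 1 2 0
  | false, 3%N => (u 1 1 1 - 2 * u 2 2 0) / 3
  | false, 2%N => (u 1 0 2 - 2 * u 2 1 1) / 3
  | false, 1%N => - u 3 1 1 | false, _ => - u 3 0 2
  end.

(** In F1 and F2 the coordinates u^1_22 and u^4_11 have coefficient 3, whence the thirds. *)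
Definition normal2 (f1 f2 : R) (i a b : nat) : R :=
  match i, a, b with 0%N, 0%N, 2%N => f1 / 3 | 3%N, 2%N, 0%N => f2 / 3 | _, _, _ => 0 end.

Lemma normalize_order2 :
  (forall i a b, (i < 4)%N -> (a + b < 2)%N -> jf z i a b = 0) ->
  exists z', [/\ jet_orbit z z', z'.1 = 0,
  forall i a b, (i < 4)%N -> (a + b < 2)%N -> jf z' i a b = 0,
  forall i a b, (i < 4)%N -> (a + b = 2)%N ->
    jf z' i a b = normal2 (jf z 4 0 0) (jf z 5 0 0) i a b &
  forall i a b, (3 < i < 6)%N -> (a + b < 2)%N -> jf z' i a b = jf z i a b].
Proof.
move=> z0; have [//|z' [zz' z'0 H1 H H3]] := @near_id_step 4 z shift4.
exists z'; split=> // [i a b i4 ab|i a b i4 ab|]; [by rewrite H1//; exact: z0| |exact: H3].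
have E4 := F1_order2 z0; have E5 := F2_order2 z0.
rewrite H//; by move: a b ab i i4 => [|[|[|a]]] [|[|[|b]]]// _ [|[|[|[|//]]]] _;
  rewrite /near_id_shift /shift4 /normal2 ?E4 ?E5; gen_jf; field.
Qed.

(** Twelve unknowns for sixteen equations. Where a coordinate is to survive, only its deviation from
    the corresponding D_j F_i / 3 is removed. *)
Definition shift5 (i : bool) (a b : nat) : R :=
  match i, a with
  | true, 5%N => u 0 3 0 | true, 4%N => u 0 2 1
  | true, 3%N => u 0 1 2 - u 4 1 0 / 3
  | true, 2%N => u 0 0 3 - u 4 0 1 / 3
  | true, 1%N => u 2 1 2 + 2 * (u 5 0 1 / 3 - u 3 2 1)
  | true, _ => u 2 0 3 - 2 * u 3 1 2
  | false, 5%N => 2 * u 0 2 1 - u 1 3 0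
  | false, 4%N => 2 * (u 0 1 2 - u 4 1 0 / 3) - u 1 2 1
  | false, 3%N => u 5 1 0 / 3 - u 3 3 0
  | false, 2%N => u 5 0 1 / 3 - u 3 2 1
  | false, 1%N => - u 3 1 2 | false, _ => - u 3 0 3
  end.

Definition normal3 (i a b : nat) : R :=
  match i, a, b with
  | 0%N, 1%N, 2%N => u 4 1 0 / 3 | 0%N, 0%N, 3%N => u 4 0 1 / 3
  | 3%N, 3%N, 0%N => u 5 1 0 / 3 | 3%N, 2%N, 1%N => u 5 0 1 / 3
  | _, _, _ => 0 end.

Lemma normalize_order3 :
  (forall i a b, (i < 4)%N -> (a + b < 2)%N -> jf z i a b = 0) ->
  exists z', [/\ jet_orbit z z', z'.1 = 0,
  forall i a b, (i < 4)%N -> (a + b < 3)%N -> jf z' i a b = jf z i a b &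
  forall i a b, (i < 4)%N -> (a + b = 3)%N -> jf z' i a b = normal3 i a b].
Proof.
move=> z0; have [//|z' [zz' z'0 H1 H H3]] := @near_id_step 5 z shift5.
exists z'; split=> // i a b i4 ab.
have [E10 E01] := DF1_order3 z0; have [G10 G01] := DF2_order3 z0.
rewrite H//; by move: a b ab i i4 => [|[|[|[|a]]]] [|[|[|[|b]]]]// _ [|[|[|[|//]]]] _;
  rewrite /near_id_shift /shift5 /normal3 ?E10 ?E01 ?G10 ?G01; gen_jf; field.
Qed.

End Steps.

(** For affine g the inhomogeneous part of the lift vanishes, and F_i and D_j F_i transform as
    tensors up to the factor J. *)
Lemma linear_step (z : jet R 3) (a b c d : R) : a * d - b * c != 0 ->
  exists z', [/\ jet_orbit z z', z'.1 = 0,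
    (forall i, (i < 4)%N -> jf z i 0 0 = 0) -> (forall i, (i < 4)%N -> jf z' i 0 0 = 0),
    jf z' 4 0 0 = (a * d - b * c) * (a * jf z 4 0 0 + c * jf z 5 0 0) /\
    jf z' 5 0 0 = (a * d - b * c) * (b * jf z 4 0 0 + d * jf z 5 0 0) &
    [/\ jf z' 4 1 0 = (a * d - b * c) * (a * (a * jf z 4 1 0 + c * jf z 4 0 1)
          + c * (a * jf z 5 1 0 + c * jf z 5 0 1)),
        jf z' 4 0 1 = (a * d - b * c) * (a * (b * jf z 4 1 0 + d * jf z 4 0 1)
          + c * (b * jf z 5 1 0 + d * jf z 5 0 1)),
        jf z' 5 1 0 = (a * d - b * c) * (b * (a * jf z 4 1 0 + c * jf z 4 0 1)
          + d * (a * jf z 5 1 0 + c * jf z 5 0 1)) &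
        jf z' 5 0 1 = (a * d - b * c) * (b * (b * jf z 4 1 0 + d * jf z 4 0 1)
          + d * (b * jf z 5 1 0 + d * jf z 5 0 1))]].
Proof.
move=> J0.
pose m (i : bool) (k l : nat) : R := match (k + l)%N with
  | 0%N => z.1 0 (ix i)
  | 1%N => if k == 1%N then (if i then c else a) else (if i then d else b)
  | _ => 0 end.
have [//|//|z' [zz' z'0 E0]] := @orbit_step z 0 m.
exists z'; split=> //.
- move=> z0 i i4; rewrite E0 ?/in_range ?i4//.
  by move: i i4 => [|[|[|[|//]]]] _; rewrite /tders /= /m /= !z0//; gen_jf; ring.
- by split; rewrite E0//= /m /=; gen_jf; ring.
- by split; rewrite E0//= /m /=; gen_jf; ring.
Qed.

(* g = id - (l . q) q, to second order. *)
Lemma quadratic_step (z : jet R 3) (l1 l2 : R) :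
  exists z', [/\ jet_orbit z z', z'.1 = 0,
    forall i, (i < 4)%N -> jf z' i 0 0 = jf z i 0 0,
    jf z' 4 0 0 = jf z 4 0 0 /\ jf z' 5 0 0 = jf z 5 0 0 &
    [/\ jf z' 4 1 0 = jf z 4 1 0 - 5 * l1 * jf z 4 0 0,
        jf z' 4 0 1 = jf z 4 0 1 - 4 * l2 * jf z 4 0 0 - l1 * jf z 5 0 0,
        jf z' 5 1 0 = jf z 5 1 0 - 4 * l1 * jf z 5 0 0 - l2 * jf z 4 0 0 &
        jf z' 5 0 1 = jf z 5 0 1 - 5 * l2 * jf z 5 0 0]].
Proof.
pose m (i : bool) (k l : nat) : R := match i, k, l with
  | _, 0%N, 0%N => z.1 0 (ix i)
  | false, 1%N, 0%N | true, 0%N, 1%N => 1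
  | false, 2%N, 0%N => - (2 * l1) | false, 1%N, 1%N => - l2
  | true, 1%N, 1%N => - l1 | true, 0%N, 2%N => - (2 * l2)
  | _, _, _ => 0 end.
have J1 : cjac m = 1 by rewrite /cjac /m mulr1 mulr0 subr0.
have [||z' [zz' z'0 E0]] := @orbit_step z 0 m; first by case.
  by rewrite J1 oner_neq0.
exists z'; split=> //.
(* The quadratic part of g lies in the kernel of [near_id_shift] for n = 2: it is the 2-jet of a
   projective map. *)
- move=> i i4; rewrite E0 ?/in_range ?i4//.
  by move: i i4 => [|[|[|[|//]]]] _; rewrite /tders /= J1 /m /= invr1; gen_jf; ring.
- by split; rewrite E0//= /m /=; gen_jf; ring.
(* In the factors 5 and 4, a 3 comes from J = 1 - 3 l.q + ..., the remaining 2 or 1 from the second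
   derivatives of g. *)
- by split; rewrite E0//= /m /=; gen_jf; ring.
Qed.

Lemma orbit_trans k (z1 z2 z3 : jet R k) :
  jet_orbit z1 z2 -> jet_orbit z2 z3 -> jet_orbit z1 z3.
Proof. by move=> [f H1] [h H2]; apply: prolongation_trans H1 H2. Qed.

Lemma orbit_sym k (z1 z2 : jet R k) : jet_orbit z1 z2 -> jet_orbit z2 z1.
Proof. by move=> [f H]; apply: prolongation_sym H. Qed.

Lemma flat1_normal (z : jet R 3) : exists z', [/\ jet_orbit z z', z'.1 = 0 &
  forall i a b, (i < 4)%N -> (a + b < 2)%N -> jf z' i a b = 0].
Proof.
have [z1 [zz1 _ H1]] := normalize_order0 z; have [z2 [z12 z20 H2 H2' _]] := normalize_order1 z1.
exists z2; split=> //; first exact: orbit_trans zz1 z12.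
move=> i a b i4 ab; case: (posnP (a + b)%N) => [/eqP|ab0].
  by rewrite addn_eq0 => /andP[/eqP -> /eqP ->]; rewrite H2// H1.
by apply: H2' => //; apply/eqP; rewrite eqn_leq -ltnS ab ab0.
Qed.

Definition flat2 (z : jet R 3) (f1 f2 : R) : Prop :=
  [/\ z.1 = 0, forall i a b, (i < 4)%N -> (a + b < 2)%N -> jf z i a b = 0 &
  forall i a b, (i < 4)%N -> (a + b = 2)%N -> jf z i a b = normal2 f1 f2 i a b].

Lemma flat2_normal (z : jet R 3) : (forall i, (i < 4)%N -> jf z i 0 0 = 0) ->
  exists z', [/\ jet_orbit z z', flat2 z' (jf z 4 0 0) (jf z 5 0 0) &
  forall i a b, (3 < i < 6)%N -> (a + b < 2)%N -> jf z' i a b = jf z i a b].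
Proof.
move=> z0; have [z1 [zz1 z10 H0 H1 H1']] := normalize_order1 z.
have z1f i a b : (i < 4)%N -> (a + b < 2)%N -> jf z1 i a b = 0.
  move=> i4 ab; case: (posnP (a + b)%N) => [/eqP|ab0].
    by rewrite addn_eq0 => /andP[/eqP -> /eqP ->]; rewrite H0// z0.
  by apply: H1 => //; apply/eqP; rewrite eqn_leq -ltnS ab ab0.
have [z2 [z12 z20 H2 H2' H2'']] := normalize_order2 z1f.
exists z2; split; first exact: orbit_trans zz1 z12.
  by split=> // i a b i4 ab; rewrite H2'// !H1'.
by move=> i a b i6 ab; rewrite H2''// H1'.
Qed.

Lemma F_normal (z : jet R 3) : (jf z 4 0 0, jf z 5 0 0) != (0, 0) ->
  exists z', [/\ jet_orbit z z', forall i, (i < 4)%N -> jf z' i 0 0 = 0,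
    jf z' 4 0 0 = 1 & jf z' 5 0 0 = 0].
Proof.
move=> F0; have [z1 [zz1 _ H1]] := normalize_order0 z.
have F1 : (jf z1 4 0 0, jf z1 5 0 0) != (0, 0).
  by apply: contra F0 => /eqP F1; apply/eqP; apply: F12_law zz1 F1.
move: F1; set f1 := jf z1 4 0 0; set f2 := jf z1 5 0 0.
have [f10|f10] := eqVneq f1 0.
  have [f20|f20 _] := eqVneq f2 0; first by rewrite f10 f20 eqxx.
  (* An exchange of the axes, scaled so that J = 1/f2. *)
  have J0 : 0 * 0 - (- f2^-1) * 1 != 0 by rewrite mulr0 sub0r mulr1 opprK invr_neq0.
  have [z2 [z12 _ H2 [E4 E5] _]] := linear_step z1 J0.
  exists z2; split; [exact: orbit_trans zz1 z12|exact: H2| |].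
    by rewrite E4 -/f1 -/f2; field.
  by rewrite E5 -/f1 -/f2 f10; gen_jf; ring.
move=> _.
(* Here J = 1/f1 brings F1 to 1, and the entry b = - f2 / f1^2 cancels F2. *)
have J0 : 1 * f1^-1 - (- f2 / f1 ^+ 2) * 0 != 0 by rewrite mulr0 subr0 mul1r invr_neq0.
have [z2 [z12 _ H2 [E4 E5] _]] := linear_step z1 J0.
exists z2; split; [exact: orbit_trans zz1 z12|exact: H2| |].
  by rewrite E4 -/f1 -/f2; field.
by rewrite E5 -/f1 -/f2; field.
Qed.

(** Because the exponent of J in the law of F3 is odd, the sign of F3 is no obstruction and a single
    orbit covers F3 <> 0. *)
Lemma fifth_root (k : R) : k != 0 -> exists2 a : R, a != 0 & a ^+ 5 = k.
Proof.
have pos (x : R) : 0 < x -> exists2 a : R, a != 0 & a ^+ 5 = x.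
  move=> x0; exists (x `^ 5^-1); first by rewrite gt_eqF// powR_gt0.
  by rewrite -powR_mulrn ?powR_ge0// -powRrM mulVf ?powRr1 ?ltW.
rewrite neq_lt => /orP[k0|]; last exact: pos.
have [|a a0 Ea] := pos (- k); first by rewrite oppr_gt0.
by exists (- a); rewrite ?oppr_eq0// exprNn Ea -signr_odd /= expr1 mulN1r opprK.
Qed.

Lemma DF_normal (z : jet R 3) : F3 z != 0 ->
  exists z', [/\ jet_orbit z z', forall i, (i < 4)%N -> jf z' i 0 0 = 0,
    jf z' 4 0 0 = 1 /\ jf z' 5 0 0 = 0 &
    [/\ jf z' 4 1 0 = 0, jf z' 4 0 1 = 0, jf z' 5 1 0 = 0 & jf z' 5 0 1 = 1]].
Proof.
move=> F30.
have F0 : (jf z 4 0 0, jf z 5 0 0) != (0, 0).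
  apply: contra F30; rewrite xpair_eqE => /andP[/eqP E4 /eqP E5].
  by rewrite F3E /tresse E4 E5; apply/eqP; gen_jf; ring.
have [z1 [zz1 u1 F1 F2]] := F_normal F0.
(* For (F1, F2) = (1, 0) and zero coordinates of order 0, F3 is - D_2 F2. *)
have k0 : jf z1 5 0 1 != 0.
  have [J J0 E] := F3_law zz1.
  have : F3 z1 != 0 by rewrite E mulf_neq0 ?expf_neq0.
  apply: contra => /eqP k0; rewrite F3E /tresse F1 F2 k0 u1//; apply/eqP; gen_jf; ring.
set k := jf z1 5 0 1 in k0.
(* l2 makes D_2 F1 and D_1 F2 equal, with common value h; l1 makes D_1 F1 = h^2 / k. The matrix of
   the D_j F_i is then symmetric of rank one, with quadratic form k (h x / k + y)^2. *)
pose l2 := (jf z1 4 0 1 - jf z1 5 1 0) / 3.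
pose h := (4 * jf z1 5 1 0 - jf z1 4 0 1) / 3.
pose l1 := (jf z1 4 1 0 - h ^+ 2 / k) / 5.
have [z2 [z12 _ u2 [G1 G2] [D1 D2 D3 D4]]] := quadratic_step z1 l1 l2.
rewrite F1 in G1 D1 D2 D3; rewrite F2 in G2 D2 D3 D4.
have {}D1 : jf z2 4 1 0 = h ^+ 2 / k
  by rewrite D1 /l1 mulr1; move: (h ^+ 2 / k); gen_jf => ?; field.
have {}D2 : jf z2 4 0 1 = h by rewrite D2 /l2 /h; gen_jf; field.
have {}D3 : jf z2 5 1 0 = h by rewrite D3 /l2 /h; gen_jf; field.
have {}D4 : jf z2 5 0 1 = k by rewrite D4 mulr0 subr0.
have [a a0 ak] := fifth_root k0.
(* The first column (a, - a h / k) of the Jacobian matrix spans the kernel of the form. The second,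
   (0, a^-2), gives J = 1/a, which keeps F1 = 1, and D_2 F2 = k / a^5 = 1. *)
have J0 : a * (a ^+ 2)^-1 - 0 * (- a * h / k) != 0.
  by rewrite mul0r subr0 mulf_neq0// invr_neq0// expf_neq0.
have [z3 [z23 _ u3 [L4 L5] [M1 M2 M3 M4]]] := linear_step z2 J0.
exists z3; split.
- exact: orbit_trans zz1 (orbit_trans z12 z23).
- by apply: u3 => i i4; rewrite u2// u1.
- by rewrite L4 L5 G1 G2 -ak; clearbody h; split; field; rewrite ?a0.
- by rewrite M1 M2 M3 M4 D1 D2 D3 D4 -ak; clearbody h; split; field; rewrite ?a0.
Qed.

(** * Orbits *)

(** Projection between jets of arbitrary orders, by which results on 3-jets descend; it is
    convertible with [jproj] where both apply. *)
Definition trunc k m (z : jet R m) : jet R k :=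
  (z.1, \matrix_(i < 4, l < size (midx k)) jcoord z i (nth (0, 0)%N (midx k) l)).

Lemma jcoord_trunc k m (z : jet R m) i s : (s.1 + s.2 <= k)%N ->
  jcoord (trunc k z) i s = jcoord z i s.
Proof. exact: (@jcoord_matrix R k z.1 (fun i s => jcoord z i s)). Qed.

Lemma trunc_jet_of k m (S : E -> total_space R) p : (k <= m)%N ->
  trunc k (jet_of m S p) = jet_of k S p.
Proof.
move=> km; apply: jet_eqP => [|i s Hs]; first exact: erefl.
by rewrite jcoord_trunc// !jcoord_jet_of// (leq_trans Hs).
Qed.

Lemma orbit_trunc k m (z z' : jet R m) : (k <= m)%N ->
  jet_orbit z z' -> jet_orbit (trunc k z) (trunc k z').
Proof.
move=> km [f [V [S [p [HS Vp dp -> ->]]]]]; exists f, V, S, p.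
by split; [exact: HS|exact: Vp|exact: dp|exact: trunc_jet_of|exact: trunc_jet_of].
Qed.

(** The f and S that relate two k-jets also relate their m-jets, so laws proved on 3-jets hold for
    the orbits in lower orders. *)
Lemma orbit_extend k m (t t' : jet R k) : (k <= m)%N -> jet_orbit t t' ->
  exists z z' : jet R m, [/\ trunc k z = t, trunc k z' = t' & jet_orbit z z'].
Proof.
move=> km [f [V [S [p [HS Vp dp -> ->]]]]].
exists (jet_of m S p), (jet_of m (Defs.lift0 f \o S \o pt_inv f) (pt_fun f p)).
split; [exact: trunc_jet_of|exact: trunc_jet_of|].
by exists f, V, S, p; split; [exact: HS|exact: Vp|exact: dp|exact: erefl|exact: erefl].
Qed.

Lemma jet_extend k m (t : jet R k) : (k <= m)%N -> exists z : jet R m, trunc k z = t.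
Proof.
move=> km; exists (jet_of m (taylor_section t) t.1).
by rewrite trunc_jet_of// jet_of_taylor_section.
Qed.

(** With u^1_22 = f / 3 and u^4_112 = t / 3 one gets F1 = f, F2 = 0 and D_2 F2 = t. The pairs (0,
    0), (1, 0) and (1, 1) represent the described orbits. *)
Definition normal_coef (f t : R) (i : 'I_4) (s : nat * nat) : R :=
  match val i, s.1, s.2 with
  | 0%N, 0%N, 2%N => f / 3
  | 3%N, 2%N, 1%N => t / 3
  | _, _, _ => 0
  end.

Definition normal_jet (f t : R) : jet R 3 :=
  (0, \matrix_(i < 4, l < size (midx 3)) normal_coef f t i (nth (0, 0)%N (midx 3) l)).

Lemma jcoord_normal f t i a b : (i < 4)%N -> (a + b <= 3)%N ->
  jcoord (normal_jet f t) (inord i) (a, b) = normal_coef f t (inord i) (a, b).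
Proof. by move=> i4 ab; apply: (@jcoord_matrix R 3 0 (normal_coef f t)). Qed.

Lemma jf_coord (z : jet R 3) i a b : (i < 4)%N -> jf z i a b = jcoord z (inord i) (a, b).
Proof. by move: i => [|[|[|[|//]]]]. Qed.

Lemma jf_normal f t i a b : (i < 4)%N -> (a + b <= 3)%N ->
  jf (normal_jet f t) i a b =
  match i, a, b with
  | 0%N, 0%N, 2%N => f / 3 | 3%N, 2%N, 1%N => t / 3 | _, _, _ => 0 end.
Proof. by move=> i4 ab; rewrite jf_coord// jcoord_normal// /normal_coef /= inordK. Qed.

Lemma normal_flat f t i a b : (i < 4)%N -> (a + b < 2)%N -> jf (normal_jet f t) i a b = 0.
Proof.
move=> i4 ab; rewrite jf_normal//; last by apply: leq_trans (ltnW ab) _.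
by move: i a b i4 ab => [|[|[|[|//]]]] [|[|a]] [|[|b]].
Qed.

Lemma F_normal_jet f t : jf (normal_jet f t) 4 0 0 = f /\ jf (normal_jet f t) 5 0 0 = 0.
Proof.
have N := @normal_flat f t.
by rewrite (F1_order2 N) (F2_order2 N) !jf_normal//; split; field.
Qed.

Lemma F3_normal_jet f t : F3 (normal_jet f t) = - f ^+ 2 * t.
Proof.
have N := @normal_flat f t; have [E4 E5] := F_normal_jet f t.
have [_ G01] := DF2_order3 N.
have {}G01 : jf (normal_jet f t) 5 0 1 = t.
  by rewrite G01 !jf_normal//; field.
rewrite F3E /tresse E4 E5 G01 (N 3 0 0)%N// (N 2 0 0)%N// (N 1 0 0)%N// (N 0 0 0)%N//.
by gen_jf; ring.
Qed.

Lemma trunc_normal k f f2 t z : (k <= 2)%N -> flat2 z f f2 -> f2 = 0 ->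
  trunc k z = trunc k (normal_jet f t).
Proof.
move=> k2 [z0 z1 z2] f20; apply: jet_eqP; first exact: z0.
move=> i [a b] ab; rewrite !jcoord_trunc// -(inord_val i) -!jf_coord//.
have ab2 : (a + b <= 2)%N by apply: leq_trans ab k2.
case: (ltngtP (a + b) 2)%N => [ab1|ab3|abE].
- by rewrite z1// normal_flat.
- by rewrite leqNgt ab3 in ab2.
- rewrite z2// jf_normal ?abE// /normal2 f20 mul0r.
  by move: (val i) a b abE {ab ab2} => [|[|[|[|j]]]] [|[|[|a]]] [|[|[|b]]].
Qed.

Lemma zero_reach (z : jet R 3) : (F1 (jproj z), F2 (jproj z)) = (0, 0) ->
  exists2 z', jet_orbit z z' & forall k, (k <= 2)%N -> trunc k z' = trunc k (normal_jet 0 0).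
Proof.
move=> F0; have [z1 [zz1 _ u1]] := normalize_order0 z.
have [E4 E5] := F12_law (orbit_sym zz1) F0.
have [z2 [z12 H2 _]] := flat2_normal u1.
exists z2 => [|k k2]; first exact: orbit_trans zz1 z12.
apply: trunc_normal (k2) _ E5; move: H2; rewrite -[0]E4; exact.
Qed.

Lemma nonzero_reach (z : jet R 3) : (F1 (jproj z), F2 (jproj z)) != (0, 0) ->
  exists2 z', jet_orbit z z' & forall k, (k <= 2)%N -> trunc k z' = trunc k (normal_jet 1 0).
Proof.
move=> F0; have [z1 [zz1 u1 E4 E5]] := F_normal F0.
have [z2 [z12 H2 _]] := flat2_normal u1; rewrite E4 in H2.
exists z2 => [|k k2]; first exact: orbit_trans zz1 z12.
exact: trunc_normal k2 H2 E5.
Qed.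

Lemma flat1_reach (z : jet R 3) : exists2 z', jet_orbit z z' &
  forall k, (k <= 1)%N -> trunc k z' = trunc k (normal_jet 0 0).
Proof.
have [z1 [zz1 z10 H1]] := flat1_normal z; exists z1 => // k k1.
apply: jet_eqP; first exact: z10.
move=> i [a b] ab; rewrite !jcoord_trunc// -(inord_val i) -!jf_coord//.
by rewrite H1 ?normal_flat// ltnS (leq_trans ab).
Qed.

(** The linear and quadratic changes come first, as they are controlled only on order 0 and on F_i,
    D_j F_i. The later ones, of degree n > 2, do not alter F_i and D_j F_i, which then fix what
    remains in orders 2 and 3. *)
Lemma F3_reach (z : jet R 3) : F3 z != 0 -> jet_orbit z (normal_jet 1 1).
Proof.
move=> /DF_normal[z1 [zz1 u1 [E4 E5] [D1 D2 D3 D4]]].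
have [z2 [z12 [z20 H1 H2] H]] := flat2_normal u1.
have [z3 [z23 z30 K1 K2]] := normalize_order3 H1.
suff <- : z3 = normal_jet 1 1 by apply: orbit_trans zz1 (orbit_trans z12 z23).
apply: jet_eqP => [|i [a b] ab]; first exact: z30.
rewrite -(inord_val i) -!jf_coord// jf_normal//.
case: (ltngtP (a + b) 2)%N => [ab1|ab3|abE].
- rewrite K1// ?H1//; last exact: ltnW.
  by move: (val i) a b {ab} ab1 => [|[|[|[|j]]]] [|[|[|a]]] [|[|[|b]]].
- rewrite K2//; last by apply/eqP; rewrite eqn_leq ab.
  rewrite /normal3 !H// D1 D2 D3 D4 !mul0r.
  by move: (val i) a b ab ab3 => [|[|[|[|j]]]] [|[|[|[|a]]]] [|[|[|[|b]]]].
- rewrite K1// ?abE// H2// E4 E5 /normal2 mul0r.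
  by move: (val i) a b abE {ab} => [|[|[|[|j]]]] [|[|[|a]]] [|[|[|b]]].
Qed.

Lemma F12_trunc (z : jet R 3) : (F1 (trunc 2 z), F2 (trunc 2 z)) = (F1 (jproj z), F2 (jproj z)).
Proof. by []. Qed.

Lemma low_orbit k : (k <= 1)%N -> is_orbit [set: jet R k].
Proof.
move=> k1; exists (trunc k (normal_jet 0 0)); apply/seteqP; split=> // t _.
have k3 : (k <= 3)%N by apply: leq_trans k1 _.
have [z <-] := jet_extend t k3; have [z' zz' <-//] := flat1_reach z.
by apply: orbit_sym; apply: orbit_trunc.
Qed.

Lemma zero_orbit :
  [set t : jet R 2 | F1 t = 0 /\ F2 t = 0] = jet_orbit (trunc 2 (normal_jet 0 0)).
Proof.
have N : (F1 (trunc 2 (normal_jet 0 0)), F2 (trunc 2 (normal_jet 0 0))) = (0, 0).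
  by have [E4 E5] := F_normal_jet 0 0; congr (_, _).
apply/seteqP; split=> [t [t1 t2]|t /(@orbit_extend 2 3 _ _ isT)[z [z' [zN zt zz']]]].
  have [z zt] := @jet_extend 2 3 t isT.
  have [|z' zz' <-//] := @zero_reach z; first by rewrite -F12_trunc zt t1 t2.
  by rewrite -zt; apply: orbit_sym; apply: orbit_trunc.
rewrite /= -zt; have := F12_law (orbit_sym zz'); rewrite -!F12_trunc zN N.
by move=> /(_ erefl)[].
Qed.

Lemma nonzero_orbit :
  [set t : jet R 2 | (F1 t, F2 t) != (0, 0)] = jet_orbit (trunc 2 (normal_jet 1 0)).
Proof.
have N : (F1 (trunc 2 (normal_jet 1 0)), F2 (trunc 2 (normal_jet 1 0))) != (0, 0).
  have [E4 E5] := F_normal_jet 1 0.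
  rewrite xpair_eqE negb_and; apply/orP; left.
  have -> : F1 (trunc 2 (normal_jet 1 0)) = 1 by exact: E4.
  exact: oner_neq0.
apply/seteqP; split=> [t t0|t /(@orbit_extend 2 3 _ _ isT)[z [z' [zN zt zz']]]].
  have [z zt] := @jet_extend 2 3 t isT.
  have [|z' zz' <-//] := @nonzero_reach z; first by rewrite -F12_trunc zt.
  by rewrite -zt; apply: orbit_sym; apply: orbit_trunc.
rewrite /= -zt; apply: contra N => /eqP F0; rewrite -zN.
by apply/eqP; apply: F12_law zz' F0.
Qed.

Lemma F3_orbit : [set z : jet R 3 | F3 z != 0] = jet_orbit (normal_jet 1 1).
Proof.
apply/seteqP; split=> [z /F3_reach/orbit_sym//|z /F3_law[J J0 /= ->]].
by rewrite F3_normal_jet expr1n mulr1 mulf_neq0 ?expf_neq0// oppr_eq0 oner_neq0.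
Qed.

(** * Submanifolds and equations *)

Lemma codim0_open (V : normedModType R) (N : set V) : open N -> submanifold_codim 0 N.
Proof.
move=> oN x Nx; exists N, (fun=> 0); split=> //; split=> //.
- by move=> n; apply: Ck_cst.
- by move=> y _ _ w; exists 0; rewrite !thinmx0.
- by apply/seteqP; split=> y []; split.
Qed.

Lemma smooth_open (V : normedModType R) (f : V -> R) :
  smooth_on setT f -> open [set x | f x != 0].
Proof.
move=> /(_ 0%N) Hf; rewrite (_ : mkset _ = f @^-1` [set~ 0]).
  by apply: open_comp => [x _|]; [exact: Hf|exact/closed_openC/closed_eq].
by apply/seteqP; split=> x /eqP.
Qed.

Lemma smooth_tresse (V : normedModType R) (U : set V) (c : nat -> nat -> nat -> V -> R) :
  open U -> (forall i a b, in_range i a b -> smooth_on U (c i a b)) ->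
  smooth_on U (fun x => tresse (fun i a b => c i a b x)).
Proof.
move=> oU Sc; rewrite /tresse; repeat
  (apply: smoothD => // || apply: smoothM => // || apply: smoothN => // || apply: smoothX => //);
  exact: Sc.
Qed.

(** The total derivatives in F3 are handled through their polynomial expressions from
    [jet_fieldE]. *)
Lemma smooth_F3 : smooth_on setT (@F3 R).
Proof.
have oT := @openT (jet R 3).
apply: (@smooth_tresse _ setT (fun i a b z => jf z i a b)) => // i a b.
rewrite /in_range; case: ltnP => [i4 _|i3 /andP[i6 ab]].
  rewrite (_ : (fun z => _) = fun z => jcoord z (inord i) (a, b)).
    exact: smooth_jcoord.
  by apply/funext => z; apply: jf_coord.
rewrite (_ : (fun z => _) = fun z =>
    eval (coord_env z) (tders sect_der (a, b) (liouvilleT i))); last first.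
  by apply/funext => z; rewrite jet_fieldE// i3.
apply: (@smooth_eval _ R _ setT (fun v z => coord_env z v)) => // -[[j c] d].
exact: smooth_jcoord.
Qed.

Lemma open_F12 : open [set t : jet R 2 | (F1 t, F2 t) != (0, 0)].
Proof.
rewrite (_ : mkset _ = [set t | F1 t != 0] `|` [set t | F2 t != 0]).
  by apply: openU; apply: smooth_open; [exact: smooth_F1|exact: smooth_F2].
by apply/seteqP; split=> t /=; rewrite xpair_eqE negb_and => /orP.
Qed.

Definition F12 (t : jet R 2) : 'rV[R]_2 := \row_(i < 2) [:: F1 t; F2 t]`_i.

Lemma smooth_F12 : smooth_on setT F12.
Proof.
have oT := @openT (jet R 2).
apply: smooth_mx => // i j; rewrite ord1.
have [->|->] := I2P j.
  by apply: (eq_smooth oT _ smooth_F1) => t _; rewrite mxE.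
by apply: (eq_smooth oT _ smooth_F2) => t _; rewrite mxE.
Qed.

Lemma derive_affine (V : normedModType R) (f : V -> R) x v (c : R) :
  differentiable f x -> (forall t : R, f (x + t *: v) = f x + t * c) -> 'D_v f x = c.
Proof.
move=> df fE; have df0 : differentiable f (x + 0 *: v) by rewrite scale0r addr0.
have /(@derive_val _ _ _ _ _ _ _) := derive_line df0; rewrite scale0r addr0 => <-.
rewrite (_ : (fun t => _) = cst (f x) + c *: (@idfun R)); last first.
  by apply/funext => t; rewrite fE mulrC.
by rewrite deriveD// derive_cst deriveZ// derive_id add0r [LHS]mulr1.
Qed.

Lemma jcoord_line k (t v : jet R k) (h : R) i s :
  jcoord (t + h *: v) i s = jcoord t i s + h * jcoord v i s.
Proof.
by rewrite /jcoord; case: insubP => [m _ _|_]; rewrite ?mulr0 ?addr0// !mxE.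
Qed.

(** u^1_22 occurs only in F1, with coefficient 3, and u^2_22 only in F2, with coefficient 1. Along
    this direction (F1, F2) is therefore affine with slope (c, d), which shows the differential to
    be onto at every jet. *)
Definition pure_coef (c d : R) (i : 'I_4) (s : nat * nat) : R :=
  match val i, s.1, s.2 with
  | 0%N, 0%N, 2%N => c / 3 | 1%N, 0%N, 2%N => d | _, _, _ => 0
  end.

Definition pure_jet (c d : R) : jet R 2 :=
  (0, \matrix_(i < 4, l < size (midx 2)) pure_coef c d i (nth (0, 0)%N (midx 2) l)).

Lemma F12_line (t : jet R 2) (c d h : R) :
  F1 (t + h *: pure_jet c d) = F1 t + h * c /\ F2 (t + h *: pure_jet c d) = F2 t + h * d.
Proof.
have P i a b : (i < 4)%N -> (a + b <= 2)%N ->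
    jcoord (pure_jet c d) (inord i) (a, b) = pure_coef c d (inord i) (a, b).
  by move=> _ ab; apply: (@jcoord_matrix R 2 0 (pure_coef c d)).
rewrite !F1E !F2E /liouville1 /liouville2 !jcoord_line !P// /pure_coef /= !inordK//=.
set T := fun i a b => jcoord t (inord i) (a, b).
by split; rewrite -![jcoord t _ _]/(T _ _ _); clearbody T; field.
Qed.

Lemma F12_regular (t : jet R 2) w : exists v, 'd F12 t v = w.
Proof.
exists (pure_jet (w 0 0) (w 0 1)).
have dF := smooth_differentiable smooth_F12 (I : setT t).
have dF1 := smooth_differentiable smooth_F1 (I : setT t).
have dF2 := smooth_differentiable smooth_F2 (I : setT t).
rewrite -deriveE//; apply: rV2P; rewrite -derive_coord//.
  rewrite (_ : (fun y => _) = @F1 R); last by apply/funext => y; rewrite mxE.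
  by apply: derive_affine => // h; case: (F12_line t (w 0 0) (w 0 1) h).
rewrite (_ : (fun y => _) = @F2 R); last by apply/funext => y; rewrite mxE.
by apply: derive_affine => // h; case: (F12_line t (w 0 0) (w 0 1) h).
Qed.

Lemma F12_equations : regular_equations setT F12 [set t | F1 t = 0 /\ F2 t = 0].
Proof.
split; [exact: openT|exact: smooth_F12|by move=> t _ _; apply: F12_regular|].
apply/seteqP; split=> t.
  by move=> [[t1 t2] _]; split=> //; apply: rV2P; rewrite !mxE.
move=> [_ /rowP t0]; split=> //.
by split; [have := t0 0|have := t0 1]; rewrite !mxE.
Qed.

End LiftCoef.

Theorem theorem3p6 (R : realType) :
  (is_orbit [set: jet R 0] /\ is_orbit [set: jet R 1]) /\
  (exists Orb20 Orb22 : set (jet R 2),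
    [/\ [set: jet R 2] = Orb20 `|` Orb22,
        generic_orbit Orb20
        /\ Orb20 = [set theta | (F1 theta, F2 theta) != (0, 0)]
      & [/\ is_orbit Orb22,
            submanifold_codim 2 Orb22,
            Orb22 = [set theta | F1 theta = 0 /\ F2 theta = 0]
          & regular_equations [set: jet R 2]
              (fun theta => \row_(i < 2) [:: F1 theta; F2 theta]`_i) Orb22]]) /\
  (exists Orbs : set (set (jet R 3)),
    [/\ forall O, Orbs O -> is_orbit O,
        [set: jet R 3] = \bigcup_(O in Orbs) O
      & exists2 Orb30, Orbs Orb30 &
          generic_orbit Orb30 /\ Orb30 = [set theta | F3 theta != 0]]).
Proof.
split; first by split; exact: low_orbit.
split.
  exists [set t | (F1 t, F2 t) != (0, 0)], [set t | F1 t = 0 /\ F2 t = 0]; split.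
  - apply/seteqP; split=> // t _ /=.
    have [[E1 E2]|] := eqVneq (F1 t, F2 t) (0, 0); by [right|left].
  - split=> //; split; first by eexists; exact: nonzero_orbit.
    exact/codim0_open/open_F12.
  - have H := @F12_equations R.
    split=> //; first by eexists; exact: zero_orbit.
    by move=> t _; exists setT, (@F12 R).
exists [set O | is_orbit O]; split=> //.
  apply/seteqP; split=> // z _; exists (jet_orbit z); first by exists z.
  exact: prolongation_refl.
have H3 : is_orbit [set z : jet R 3 | F3 z != 0] by eexists; exact: F3_orbit.
exists [set z | F3 z != 0] => //; split=> //; split=> //.
exact/codim0_open/smooth_open/smooth_F3.
Qed.
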